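(* Let $\Omega\subset\mathbb{R}^2$ be a compact convex set with nonempty interior, let $M>0$, and let $u$ be a minimizer of $$F(v)=\iint_\Omega \frac{1}{1+|\nabla v(x_1,x_2)|^2}\,dx_1\,dx_2$$ in the class $\mathfrak{C}_M$ of all concave functions $v:\Omega\to\mathbb{R}$ with $0\le v\le M$. Let $r_0=(x,u(x))$ with $x\in\mathrm{int}(\Omega)$ be a ridge point of the convex body $C_u=\{(x,z): x\in\Omega,\ 0\le z\le u(x)\}\subset\mathbb{R}^3$, and let $\theta\in[0,\pi/2)$, $\varphi_1$, $\varphi_2$ with $-\pi/2<\varphi_2<\varphi_1<\pi/2$ be the angles associated with this ridge point (as defined in the context). Then the following holds. (a) If $\theta\in[\pi/4,\pi/2)$, then $$2\varphi_1+\varphi_2\le \pi/2,\qquad \varphi_1+2\varphi_2\ge -\pi/2.$$ (b) If $\theta\in(0,\pi/4)$, then $$2\varphi_1+\varphi_2\le \pi/2,\quad \varphi_1+2\varphi_2\ge -\pi/2,\quad |\varphi_1|\ge\varphi_*,\quad |\varphi_2|\ge\varphi_*,$$ where $\varphi_*=\arccos\left(\frac{1/\sqrt2}{\cos\theta}\right)$. (c) If $\theta=0$, then either $(\varphi_1,\varphi_2)=(\pi/4,0)$, or $(\varphi_1,\varphi_2)=(0,-\pi/4)$, or $$2\varphi_1+\varphi_2\le \pi/2,\quad \varphi_1+2\varphi_2\ge -\pi/2,\quad \varphi_1\ge\pi/4,\quad \varphi_2\le-\pi/4.$$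
   Context: Points of $\mathbb{R}^3$ are written $(x,z)$ with $x=(x_1,x_2)\in\mathbb{R}^2$ and $z\in\mathbb{R}$; the $x$-plane $\{z=0\}$ is horizontal. A convex body is a compact convex set with nonempty interior. For a minimizer $u$ the body $C_u$ is called an optimal body. Ridge point: a boundary point $r_0$ of a convex body $C\subset\mathbb{R}^3$ is a ridge point if the tangent cone to $C$ at $r_0$ is a (proper) dihedral angle, i.e. the intersection of two closed half-spaces whose boundary planes pass through $r_0$ and are distinct and non-parallel. The edge of the dihedral angle is the line in which the two boundary planes intersect. Associated angles: let $r_0=(x,u(x))$, $x\in\mathrm{int}(\Omega)$, be a ridge point of $C_u$. Let $e_1,e_2$ be the unit outward normals to the two faces of the dihedral angle and $l$ its edge. Let $\theta\in[0,\pi/2)$ be the angle between $l$ and the $x$-plane; equivalently, $\theta$ is the angle between the $z$-axis and a plane orthogonal to $l$ (i.e. parallel to $e_1$ and $e_2$). In this plane take an orthonormal basis $f_1,f_2$ with $f_1$ horizontal and $f_2$ having positive $z$-coordinate. Let $\varphi_1,\varphi_2$ be the signed angles which $e_1,e_2$ form with $f_2$, counted in a fixed direction of rotation in the plane, with the normals labelled so that $-\pi/2<\varphi_2<\varphi_1<\pi/2$. Thus, in suitable orthonormal coordinates $x_1,x_2$ on the $x$-plane, $$e_i=(-\sin\varphi_i,\ \cos\varphi_i\sin\theta,\ \cos\varphi_i\cos\theta),\qquad i=1,2.$$ *)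

(* Defs.v *)
From mathcomp Require Import all_boot all_order all_algebra.
From mathcomp Require Import all_classical all_reals all_analysis.

Set Implicit Arguments.
Unset Strict Implicit.
Unset Printing Implicit Defensive.

Import Order.TTheory GRing.Theory Num.Theory.
Import numFieldNormedType.Exports.

Local Open Scope classical_set_scope.
Local Open Scope ring_scope.

(* A point (x, z) of R^3, x = (x_1, x_2), is ((x_1, x_2), z).
   The regular module R^o carries the scalar multiplication and the norm. *)
Notation plane R := (R^o * R^o)%type.
Notation space R := ((R^o * R^o) * R^o)%type.

(* A function on Om is represented by a total function on the plane. *)
Definition admissible (R : realType) (Om : set (plane R)) (M : R)
    (v : plane R -> R) : Prop :=
  convex_function (E := plane R) Om (fun x => - v x) /\
  (forall x, Om x -> 0 <= v x <= M).

Definition sqnorm_grad (R : realType) (v : plane R -> R) (x : plane R) : R :=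
  ('D_((1, 0) : plane R) (v : plane R -> R^o) x) ^+ 2 +
  ('D_((0, 1) : plane R) (v : plane R -> R^o) x) ^+ 2.

(* For v concave on the convex set Om the gradient exists almost everywhere on
   Om. The derivatives are total functions; their conventional values at the
   remaining points (singular points and the boundary of Om, which has area 0)
   do not affect the integral. *)
Definition resistance (R : realType) (Om : set (plane R))
    (v : plane R -> R) : \bar R :=
  (\int[@lebesgue_measure R \x @lebesgue_measure R]_(x in Om)
    ((1 + sqnorm_grad v x)^-1)%:E)%E.

Definition minimizer (R : realType) (Om : set (plane R)) (M : R)
    (u : plane R -> R) : Prop :=
  admissible Om M u /\
  (forall v, admissible Om M v -> (resistance Om u <= resistance Om v)%E).

Definition body (R : realType) (Om : set (plane R)) (u : plane R -> R) :
    set (space R) :=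
  [set p | Om p.1 /\ 0 <= p.2 <= u p.1].

Definition dot (R : realType) (p q : space R) : R :=
  p.1.1 * q.1.1 + p.1.2 * q.1.2 + p.2 * q.2.

(* The norm `|_| of a product space is the max norm. *)
Definition enorm (R : realType) (p : space R) : R := Num.sqrt (dot p p).

Definition tangent_cone (R : realType) (C : set (space R)) (r0 : space R) :
    set (space R) :=
  closure [set q | exists2 p, C p &
                   exists2 t : R, 0 <= t & q = r0 + t *: (p - r0)].

Definition halfspace (R : realType) (r0 e : space R) : set (space R) :=
  [set p | dot e (p - r0) <= 0].

(* The tangent cone to C at r0 is a dihedral angle whose faces have the unit
   outward normals e1, e2. As both boundary planes pass through r0, they are
   distinct and non-parallel iff e1, e2 are not proportional. *)
Definition dihedral_normals (R : realType) (C : set (space R))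
    (r0 e1 e2 : space R) : Prop :=
  [/\ enorm e1 = 1, enorm e2 = 1, ~ (exists t : R, e2 = t *: e1)
    & tangent_cone C r0 = halfspace r0 e1 `&` halfspace r0 e2].

(* The boundary is the topological one: for an arbitrary concave u the set
   body Om u may fail to be closed over the boundary of Om. *)
Definition ridge_point (R : realType) (C : set (space R)) (r0 : space R) : Prop :=
  (closure C `\` interior C) r0 /\ exists e1 e2, dihedral_normals C r0 e1 e2.

(* The angle between the line R d and the plane z = 0. *)
Definition horizontal_angle (R : realType) (d : space R) : R :=
  asin (`|d.2| / enorm d).

(* The vector d spans the edge; (f1, f2) is an orthonormal basis of the plane
   orthogonal to it. The angles phi1, phi2 are counted from f2 towards - f1;
   since f1 is determined only up to sign, both directions of rotation are
   covered. *)
Definition associated_angles (R : realType) (C : set (space R)) (r0 : space R)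
    (theta phi1 phi2 : R) : Prop :=
  exists e1 e2 d f1 f2 : space R,
    [/\ dihedral_normals C r0 e1 e2,
        [/\ d != 0, dot d e1 = 0 & dot d e2 = 0],
        0 <= theta < pi / 2 /\ theta = horizontal_angle d,
        [/\ dot d f1 = 0, dot d f2 = 0, enorm f1 = 1 /\ enorm f2 = 1,
            dot f1 f2 = 0 & f1.2 = 0 /\ 0 < f2.2]
      & [/\ - (pi / 2) < phi2, phi2 < phi1, phi1 < pi / 2,
            e1 = cos phi1 *: f2 - sin phi1 *: f1
          & e2 = cos phi2 *: f2 - sin phi2 *: f1]].

(* Main.v *)
(* Write f(q) = 1 / (1 + |q|^2), and let g_1, g_2 be the gradients of the two
   planes that bound the tangent cone at the ridge point r_0.  They lie on a
   line g(T) = e d + kappa T n, with d and n orthonormal and d directed along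
   the projected edge, at T_i = tan phi_i.

   For T_0 between T_2 and T_1 the function f(g(T)) exceeds its tangent at T_0
   by (T - T_0)^2 (2 T_0 T + T_0^2 - 1) times a positive factor.  If
   2 T_1 T_2 + T_i^2 > 1 for some i, a suitable T_0 makes this positive at both
   T_1 and T_2.  With P the affine function of gradient g(T_0) through r_0, the
   cut min(u, (1 - t) P) then has a smaller resistance than u for small t > 0:
   the cut region is thin around the edge, the gradients of u there are close to
   the segment [g_2, g_1], and their mean on a slice is determined by the cut.
   Hence cos(2 phi_1 + phi_2) >= 0 and cos(phi_1 + 2 phi_2) >= 0.

   If 0 < |g_i| < 1, there is s parallel to g_i with |s| < 1/2 and
   f(g_i) > 1 - s.g_i.  Let v be the infimum of the affine majorants of u whose
   gradient q satisfies |q| >= 1 or f(q) <= 1 - s.q.  Almost everywhere the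
   gradients of u and v agree where u = v, whereas
   f(grad u) > 1 - s.grad u and f(grad v) <= 1 - s.grad v where u < v.
   Since v - u vanishes on the boundary, grad v - grad u has integral 0, and v
   has a smaller resistance than u, strictly because grad u is close to g_i on
   an open set near r_0.  Hence g_i = 0 or |g_i| >= 1, where
   1 + |g_i|^2 = 1 / (cos theta cos phi_i)^2. *)
Require Import Defs.
From mathcomp Require Import all_boot all_order all_algebra.
From mathcomp Require Import all_classical all_reals all_analysis measurable_realfun.
From mathcomp Require Import ring lra.
Import Order.TTheory GRing.Theory Num.Theory.
Import numFieldNormedType.Exports.
Local Open Scope classical_set_scope.
Local Open Scope ring_scope.

(** * Concave functions of two variables and their supergradients *)

(** All integrals are computed line by line: the right partial derivatives of a concave function
    exist at every interior point and integrate exactly to its increments, so on a line only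
    expressions linear in one component of the gradient can be evaluated. For the cut this is the
    obstacle. The linear part of the tangent bound has mean zero on a slice, so the quadratic part
    must decide. On a slice the cut has width and height both of order t; hence the mean gradients
    on the two sides of a point of the slice differ from that of the plane by an amount that does
    not tend to 0 with t, and the gain is of order t, like the errors, whose constants can be made
    small. Near the two ends of the cut the gradients of u are not controlled; the slices there are
    few and each costs at most its width. For the envelope the obstacle is the boundary, where u
    need not be continuous. Equality of u and v there is replaced by a bound: v - u is at most twice
    any affine function that is nonnegative on the domain and has a coefficient of modulus 1. *)

Section PlanarConcave.
Context {R : realType}.
Implicit Types (S : R -> R -> Prop) (U : R -> R -> R).

Definition cvx2 S := forall a b a' b' t, 0 <= t <= 1 -> S a b -> S a' b' ->
  S (t * a + (1 - t) * a') (t * b + (1 - t) * b').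

Definition ccv2 S U := forall a b a' b' t, 0 <= t <= 1 -> S a b -> S a' b' ->
  t * U a b + (1 - t) * U a' b' <= U (t * a + (1 - t) * a') (t * b + (1 - t) * b').

Definition box_in S a b rho :=
  forall a' b', `|a' - a| < rho -> `|b' - b| < rho -> S a' b'.

Definition inner S a b := exists2 rho, 0 < rho & box_in S a b rho.

Definition sgrad S U a b p q :=
  forall a' b', S a' b' -> U a' b' <= U a b + p * (a' - a) + q * (b' - b).

Definition swap2 (T : Type) (F : R -> R -> T) a b := F b a.

Lemma cvx2_swap S : cvx2 S -> cvx2 (swap2 _ S).
Proof. by move=> cS a b a' b' t t01 s s'; exact: cS. Qed.

Lemma ccv2_swap S U : ccv2 S U -> ccv2 (swap2 _ S) (swap2 _ U).
Proof. by move=> cS a b a' b' t t01 s s'; exact: cS. Qed.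

Lemma inner_swap S a b : inner S a b -> inner (swap2 _ S) b a.
Proof. by move=> [r r0 h]; exists r => // a' b' *; exact: h. Qed.

Lemma inner_sub S a b : inner S a b -> S a b.
Proof. by move=> [r r0]; apply; rewrite subrr normr0. Qed.

(* One step of the Hahn-Banach extension. *)
Lemma separating_slope (Z : R -> R -> Prop) :
  (exists b z, 0 < b /\ Z b z) -> (exists b z, b < 0 /\ Z b z) ->
  (forall z, Z 0 z -> z <= 0) ->
  (forall b z b' z', 0 < b -> b' < 0 -> Z b z -> Z b' z' -> z' * b <= z * b') ->
  exists p, forall b z, Z b z -> z <= p * b.
Proof.
move=> [b0 [z0 [b00 Z0]]] [b1 [z1 [b10 Z1]]] Zz cross.
pose A := [set z / b | b in [set b | 0 < b] & z in [set z | True]].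
pose B : set R := [set w | exists b z, [/\ 0 < b, Z b z & w = z / b]].
have ubB : ubound B (z1 / b1).
  move=> _ [b [z [bp Zb ->]]].
  rewrite ler_pdivrMr// mulrAC ler_ndivlMr//.
  exact: cross.
have Bn : B !=set0 by exists (z0 / b0), b0, z0.
exists (sup B) => b z Zb.
have [b0'|bn|beq] := ltgtP b 0.
- rewrite -ler_ndivlMr//; apply: ge_sup => // _ [b' [z' [bp Zb' ->]]].
  rewrite ler_pdivrMr// mulrAC ler_ndivlMr//.
  exact: cross.
- rewrite -ler_pdivrMr//; apply: ub_le_sup; first by exists (z1 / b1).
  by exists b, z.
- by rewrite beq mulr0; apply: Zz; rewrite -beq.
Qed.

(** Two points of [S] on opposite sides of the line through [(a, b)] in the first direction have a
    convex combination on that line, where the assumption on [p] applies; this is the compatibility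
    of slopes that [separating_slope] asks for. *)
Lemma sgrad_extend S U a b p : cvx2 S -> ccv2 S U -> inner S a b ->
  (forall a', S a' b -> U a' b <= U a b + p * (a' - a)) ->
  exists q, sgrad S U a b p q.
Proof.
move=> cS cU [r r0 hr] hp.
pose Z (t z : R) := exists a' b', [/\ S a' b', t = b' - b
  & z = U a' b' - U a b - p * (a' - a)].
have hS s : `|s| < r -> S a (b + s).
  by move=> sr; apply: hr; rewrite ?subrr ?normr0// addrC addKr.
have [||||q hq] := @separating_slope Z.
- exists (r / 2), (U a (b + r / 2) - U a b - p * (a - a)); split; first by lra.
  exists a, (b + r / 2); split=> //; last by lra.
  by apply: hS; rewrite gtr0_norm; lra.
- exists (- (r / 2)), (U a (b - r / 2) - U a b - p * (a - a)); split; first by lra.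
  exists a, (b - r / 2); split=> //; last by lra.
  by apply: hS; rewrite normrN gtr0_norm; lra.
- move=> z [a' [b' [Sab e ->]]].
  have eb : b' = b by lra.
  by subst b'; have := hp _ Sab; lra.
- move=> t1 z1 t2 z2 t1p t2n [a1 [b1 [S1 e1 ->]]] [a2 [b2 [S2 e2 ->]]].
  pose t := t2 / (t2 - t1).
  have d0 : t2 - t1 < 0 by lra.
  have t01 : 0 <= t <= 1.
    by rewrite /t -mulrNN -invrN divr_ge0 ?ler_pdivrMr; lra.
  have tE : t * (t2 - t1) = t2 by rewrite /t mulfVK// lt_eqF.
  have := cU _ _ _ _ _ t01 S1 S2; have := cS _ _ _ _ _ t01 S1 S2.
  have -> : t * b1 + (1 - t) * b2 = b.
    have -> : b1 = t1 + b by lra.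
    have -> : b2 = t2 + b by lra.
    have : t * (t2 - t1) = t2 by []. 
    lra.
  move=> /hp h1 h2.
  have h3 := le_trans h2 h1.
  have h4 : t * (U a1 b1 - U a b - p * (a1 - a)) +
      (1 - t) * (U a2 b2 - U a b - p * (a2 - a)) <= 0 by lra.
  move: h4; rewrite -(ler_nM2r d0) mul0r mulrDl mulrAC tE.
  have -> : (1 - t) * (U a2 b2 - U a b - p * (a2 - a)) * (t2 - t1) =
    (U a2 b2 - U a b - p * (a2 - a)) * ((t2 - t1) - t * (t2 - t1)) by ring.
  by rewrite tE; lra.
exists q => a' b' S'.
have : Z (b' - b) (U a' b' - U a b - p * (a' - a)) by exists a', b'.
by move=> /hq; lra.
Qed.

(** The one-variable statement is the extension step once more: the slice becomes the second
    variable, and the first one is a dummy for which the slope 0 fits. *)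
Lemma sgrad_slice_exists S U a b : cvx2 S -> ccv2 S U -> inner S a b ->
  exists p, forall a', S a' b -> U a' b <= U a b + p * (a' - a).
Proof.
move=> cS cU iS.
pose S' (t s : R) := S s b; pose U' (t s : R) := U s b.
have [||||q hq] := @sgrad_extend S' U' 0 a 0.
- move=> x y x' y' t t01 h h'; have := cS _ _ _ _ _ t01 h h'.
  by have -> : t * b + (1 - t) * b = b by ring.
- move=> x y x' y' t t01 h h'; have := cU _ _ _ _ _ t01 h h'.
  by have -> : t * b + (1 - t) * b = b by ring.
- case: iS => r r0 h; exists r => // x y x0 ya; apply: h => //.
  by rewrite subrr normr0.
- by move=> a' Sa'; rewrite /U' mul0r addr0.
by exists q => a' Sa'; have := hq 0 a' Sa'; rewrite /U' mul0r addr0.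
Qed.

Lemma sgrad_exists S U a b : cvx2 S -> ccv2 S U -> inner S a b ->
  exists p q, sgrad S U a b p q.
Proof.
move=> cS cU iS; have [p hp] := sgrad_slice_exists _ _ _ _ cS cU iS.
by have [q hq] := sgrad_extend _ _ _ _ _ cS cU iS hp; exists p, q.
Qed.

(** The homothety with centre [(a', b')] and ratio [t] carries the box around [(a, b)] into [S]. *)
Lemma box_conv S a b a' b' t r : cvx2 S -> 0 < t <= 1 -> box_in S a b r -> S a' b' ->
  box_in S (t * a + (1 - t) * a') (t * b + (1 - t) * b') (t * r).
Proof.
move=> cS /andP[t0 t1] h S' x y xr yr.
pose x' := a + (x - (t * a + (1 - t) * a')) / t.
pose y' := b + (y - (t * b + (1 - t) * b')) / t.
have Sx : S x' y'.
  by apply: h; rewrite /x' /y' addrC addKr normrM normfV (gtr0_norm t0)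
    ltr_pdivrMr// [r * t]mulrC.
have t01 : 0 <= t <= 1 by rewrite ltW.
have := cS _ _ _ _ _ t01 Sx S'.
rewrite /x' /y' 2!mulrDr [t * (_ / t)]mulrC [t * (_ / t)]mulrC !divfK ?gt_eqF//.
congr (S _ _); lra.
Qed.

Lemma inner_conv S a b a' b' t : cvx2 S -> 0 < t <= 1 -> inner S a b -> S a' b' ->
  inner S (t * a + (1 - t) * a') (t * b + (1 - t) * b').
Proof.
move=> cS t01 [r r0 h] S'; exists (t * r); first by case/andP: t01 => *; exact: mulr_gt0.
exact: box_conv.
Qed.

Lemma inner_cvx S : cvx2 S -> cvx2 (inner S).
Proof.
move=> cS a b a' b' t /andP[t0 t1] i i'; have [->|tn] := eqVneq t 0.
  by rewrite !mul0r !add0r subr0 !mul1r.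
by apply: inner_conv => //; [rewrite lt_def tn t0|exact: inner_sub].
Qed.

End PlanarConcave.

(** * Slopes of a concave function on an interval *)

Section Slices.
Context {R : realType}.
Local Notation mu := (@lebesgue_measure R).

Section SupergradientIntegral.
Variables (phi p : R -> R) (a b : R).
Hypothesis phip : forall x y, a <= x <= b -> a <= y <= b ->
  phi y <= phi x + p x * (y - x).

Lemma slope_nonincreasing x y : a <= x -> x <= y -> y <= b -> p y <= p x.
Proof.
move=> ax xy yb; have [->//|xny] := eqVneq x y.
have yx0 : 0 < y - x by rewrite subr_gt0 lt_neqAle xny.
have h1 : phi y <= phi x + p x * (y - x) by apply: phip; lra.
have h2 : phi x <= phi y + p y * (x - y) by apply: phip; lra.
by rewrite -(ler_pM2r yx0); lra.
Qed.

Lemma slope_integrable : mu.-integrable `[a, b] (EFin \o p).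
Proof.
have [ab|ba] := leP a b; last first.
  rewrite set_itv_ge ?bnd_simp -?ltNge//.
  exact: integrable_set0.
apply: measurable_bounded_integrable => //.
- by rewrite /= lebesgue_measure_itv /= lte_fin; case: ifP => _;
    rewrite ?ltry// -EFinD ltry.
(* [p] is monotone on [[a, b]] only; composed with the projection onto [[a, b]] it is monotone on
   the line, hence measurable. *)
- pose c x := Num.max a (Num.min b x).
  apply: (@eq_measurable_fun _ _ _ _ _ (p \o c)).
    move=> x; rewrite inE /= in_itv /= => /andP[ax xb].
    by rewrite /c (min_idPr xb) (max_idPr ax).
  have cm s t : s <= t -> c s <= c t.
    move=> st; rewrite /c ge_max le_max lexx /= le_max; apply/orP; right.
    by rewrite le_min !ge_min lexx st orbT.
  apply: nonincreasing_measurable => // x y xy.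
  apply: slope_nonincreasing; [|exact: cm|].
  + by rewrite /c le_max lexx.
  + by rewrite /c ge_max ab /= ge_min lexx.
- exists (`|p a| + `|p b|); split; first exact: num_real.
  move=> M hM x; rewrite /= in_itv /= => /andP[ax xb].
  have h1 : p x <= p a by exact: slope_nonincreasing.
  have h2 : p b <= p x by exact: slope_nonincreasing.
  have := ler_norm (p a); have := ler_norm (- p b); rewrite normrN => *.
  have := normr_ge0 (p a); have := normr_ge0 (p b) => *.
  by rewrite ler_norml; apply/andP; split; lra.
Qed.

End SupergradientIntegral.

(** On a single interval the integral and the increment both lie between [p b * (b - a)] and
    [p a * (b - a)]. Under bisection these bounds telescope in [p] while the lengths halve, which
    gains a factor 2 at each step. *)
Lemma Rintegral_slope_err (phi p : R -> R) n a b : a <= b ->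
  (forall x y, a <= x <= b -> a <= y <= b -> phi y <= phi x + p x * (y - x)) ->
  `|\int[mu]_(x in `[a, b]) p x - (phi b - phi a)| <=
    (p a - p b) * (b - a) / 2 ^+ n.
Proof.
elim: n a b => [|n IH] a b ab h.
  have ip := slope_integrable _ _ _ _ h.
  have cst_int r : \int[mu]_(x in `[a, b]) r = r * (b - a).
    rewrite Rintegral_cst//= lebesgue_measure_itv /= lte_fin.
    case: ltgtP ab => [ab _|//|-> _]; first by rewrite -EFinD.
    by rewrite subrr.
  have icst r : mu.-integrable `[a, b] (EFin \o (fun=> r)).
    apply: (slope_integrable (fun x => r * x)) => x y _ _; lra.
  have u : \int[mu]_(x in `[a, b]) p x <= p a * (b - a).
    rewrite -cst_int; apply: le_Rintegral => // x; rewrite /= in_itv /= => /andP[ax xb].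
    by apply: (slope_nonincreasing _ _ _ _ h).
  have l : p b * (b - a) <= \int[mu]_(x in `[a, b]) p x.
    rewrite -cst_int; apply: le_Rintegral => // x; rewrite /= in_itv /= => /andP[ax xb].
    by apply: (slope_nonincreasing _ _ _ _ h).
  have h1 : phi b <= phi a + p a * (b - a) by apply: h; lra.
  have h2 : phi a <= phi b + p b * (a - b) by apply: h; lra.
  rewrite expr0 divr1 ler_norml; move: u l h1 h2.
  by move: (Rintegral _ _ _) => I; clear; lra.
pose m := (a + b) / 2.
have am : a <= m by rewrite /m; lra.
have mb : m <= b by rewrite /m; lra.
have ha x y : a <= x <= m -> a <= y <= m -> phi y <= phi x + p x * (y - x).
  by move=> *; apply: h; lra.
have hb x y : m <= x <= b -> m <= y <= b -> phi y <= phi x + p x * (y - x).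
  by move=> *; apply: h; lra.
have -> : \int[mu]_(x in `[a, b]) p x =
    \int[mu]_(x in `[a, m]) p x + \int[mu]_(x in `[m, b]) p x.
  have <- : \int[mu]_(x in `]m, b]) p x = \int[mu]_(x in `[m, b]) p x.
    apply: Rintegral_itv_obnd_cbnd; apply: integrableS (slope_integrable _ _ _ _ hb) => //.
    by apply: subset_itvr; rewrite bnd_simp.
  rewrite -(@Rintegral_itvB _ p (BLeft a) (BRight b) m) ?bnd_simp//.
    by rewrite addrC subrK.
  exact: slope_integrable h.
have := IH _ _ am ha; have := IH _ _ mb hb.
set I1 := Rintegral _ _ _; set I2 := Rintegral _ _ _.
have -> : b - m = (b - a) / 2 by rewrite /m; lra.
have -> : m - a = (b - a) / 2 by rewrite /m; lra.
have -> : (p a - p b) * (b - a) / 2 ^+ n.+1 =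
    (p a - p m) * ((b - a) / 2) / 2 ^+ n + (p m - p b) * ((b - a) / 2) / 2 ^+ n.
  by rewrite exprS; field; rewrite expf_eq0 /=; lra.
move=> e1 e2; apply: le_trans (lerD e2 e1); apply: le_trans (ler_normD _ _).
by rewrite le_eqVlt; apply/orP; left; apply/eqP; congr `|_|; ring.
Qed.

(** The fundamental theorem of calculus for a concave function, with an arbitrary selection [p] of
    supergradients in place of a derivative. *)
Lemma Rintegral_slope (phi p : R -> R) a b : a <= b ->
  (forall x y, a <= x <= b -> a <= y <= b -> phi y <= phi x + p x * (y - x)) ->
  \int[mu]_(x in `[a, b]) p x = phi b - phi a.
Proof.
move=> ab h; apply/eqP; rewrite -subr_eq0 -normr_le0 leNgt; apply/negP.
set e := `|_| => e0.
pose C := (p a - p b) * (b - a).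
have C0 : 0 <= C.
  by apply: mulr_ge0; rewrite subr_ge0//; apply: (slope_nonincreasing _ _ _ _ h).
have := Rintegral_slope_err _ _ (Num.bound (C / e)) _ _ ab h.
rewrite -/e -/C; apply/negP; rewrite -ltNge ltr_pdivrMr ?exprn_gt0//.
rewrite mulrC -ltr_pdivrMr//.
apply: lt_trans (archi_boundP _) _; first by rewrite divr_ge0// ltW.
by rewrite -natrX ltr_nat ltn_expl.
Qed.

End Slices.

Section RightSlope.
Context {R : realType}.
Variables (I : R -> Prop) (phi : R -> R) (rho : R).
Hypothesis rho0 : 0 < rho.
Hypothesis Irho : forall h, `|h| < rho -> I h.
Hypothesis phic : forall s t l, 0 <= l <= 1 -> I s -> I t ->
  I (l * s + (1 - l) * t) /\
  l * phi s + (1 - l) * phi t <= phi (l * s + (1 - l) * t).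

(** For concave [phi] the quotient does not increase with [h], so the supremum of this set is the
    right derivative at 0. *)
Definition slopes_right := [set d | exists h, [/\ 0 < h, I h & d = (phi h - phi 0) / h]].

Let cross h k : 0 < h -> I h -> 0 < k -> I (- k) ->
  (phi h - phi 0) / h <= (phi 0 - phi (- k)) / k.
Proof.
move=> h0 Ih k0 Ik; pose l := k / (h + k).
have l01 : 0 <= l <= 1 by rewrite /l divr_ge0 ?ler_pdivrMr; lra.
have [] := phic _ _ _ l01 Ih Ik.
have hk : h + k != 0 by rewrite gt_eqF// addr_gt0.
have -> : l * h + (1 - l) * - k = 0 by rewrite /l; field.
move=> _ H; rewrite ler_pdivrMr// mulrAC ler_pdivlMr//; move: H.
have hk0 : 0 < h + k by rewrite addr_gt0.
rewrite -(ler_pM2r hk0).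
have -> : (l * phi h + (1 - l) * phi (- k)) * (h + k) = k * phi h + h * phi (- k).
  by rewrite /l; field.
by move=> ?; lra.
Qed.

Let half_in : I (rho / 2) /\ I (- (rho / 2)).
Proof.
by split; apply: Irho; rewrite ?normrN gtr0_norm; move: rho0; lra.
Qed.

Let sr_ub k : 0 < k -> I (- k) -> ubound slopes_right ((phi 0 - phi (- k)) / k).
Proof. by move=> k0 Ik _ [h [h0 Ih ->]]; exact: cross. Qed.

Let sr_nonempty : slopes_right !=set0.
Proof.
by exists ((phi (rho / 2) - phi 0) / (rho / 2)), (rho / 2); split => //;
  [move: rho0; lra|case: half_in].
Qed.

Let sr_has_sup : has_sup slopes_right.
Proof.
split => //; exists ((phi 0 - phi (- (rho / 2))) / (rho / 2)).
by apply: sr_ub; [move: rho0; lra|case: half_in].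
Qed.

Lemma right_slope_le h : 0 < h -> I h -> phi h <= phi 0 + sup slopes_right * h.
Proof.
move=> h0 Ih; rewrite -lerBlDl -ler_pdivrMr//.
by apply: ub_le_sup; [case: sr_has_sup|exists h].
Qed.

Lemma right_slope_left h : 0 < h -> I (- h) -> phi (- h) <= phi 0 - sup slopes_right * h.
Proof.
move=> h0 Ih; have : sup slopes_right <= (phi 0 - phi (- h)) / h.
  by apply: ge_sup => //; exact: sr_ub.
by rewrite ler_pdivlMr//; lra.
Qed.

Lemma right_slope_approx e : 0 < e -> exists2 d, 0 < d & forall h, 0 < h -> h < d ->
  I h /\ phi 0 + (sup slopes_right - e) * h <= phi h.
Proof.
move=> e0; have [_ [h [h0 Ih ->]] lt] := sup_adherent e0 sr_has_sup.
exists h => // k k0 kh; pose l := k / h.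
have l01 : 0 <= l <= 1 by rewrite /l divr_ge0 ?ler_pdivrMr; lra.
have I0 : I 0 by apply: Irho; rewrite normr0.
have [] := phic _ _ _ l01 Ih I0.
have -> : l * h + (1 - l) * 0 = k by rewrite /l mulr0 addr0 divfK// gt_eqF.
move=> Ik le; split => //; apply: le_trans le.
have -> : l * phi h + (1 - l) * phi 0 = phi 0 + (phi h - phi 0) / h * k.
  by rewrite /l; field; rewrite gt_eqF.
by rewrite lerD2l ler_pM2r// ltW.
Qed.

End RightSlope.

(** * Null sets of the plane through their sections *)

Section NullSets.
Context {R : realType}.
Local Notation mu := (@lebesgue_measure R).

(** The intervals []r y, l y[] are pairwise disjoint, so the choice of a rational in each is
    injective. *)
Lemma countable_gaps (E : set R) (r l : R -> R) :
  (forall y, E y -> r y < l y) ->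
  (forall y z, E y -> E z -> y < z -> l z <= r y) -> countable E.
Proof.
move=> rl lr.
have H y : exists q : rat, E y -> r y < ratr q < l y.
  have [Ey|nE] := pselect (E y); last by exists 0.
  have [q] := rat_in_itvoo (rl y Ey); rewrite in_itv /= => hq.
  by exists q.
have [q hq] := choice H.
apply/countable_injP; exists (fun y => pickle (q y)) => y z /set_mem Ey /set_mem Ez.
move=> /(pcan_inj pickleK) e.
have /andP[y1 y2] := hq _ Ey; have /andP[z1 z2] := hq _ Ez.
have [yz|zy|//] := ltgtP y z.
- have := lr _ _ Ey Ez yz; rewrite e in y1 y2; lra.
- have := lr _ _ Ez Ey zy; rewrite e in y1 y2; lra.
Qed.

(** Openness is expressed by boxes and the sigma-algebra is the product one: the set is the union of
    the rational boxes that it contains. *)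
Lemma open_prod_measurable (A : set (R * R)) :
  (forall a b, A (a, b) -> inner (fun a b => A (a, b)) a b) -> measurable A.
Proof.
move=> hA.
pose box (a b c : rat) : set (R * R) :=
  `]ratr a - ratr c, ratr a + ratr c[ `*` `]ratr b - ratr c, ratr b + ratr c[.
have -> : A = \bigcup_a \bigcup_b \bigcup_c
    (if `[< box a b c `<=` A >] then box a b c else set0).
  apply/seteqP; split => [[x y] Axy|[x y] [a _ [b _ [c _]]]]; last first.
    by case: asboolP => // sA /sA.
  have [r r0 hr] := hA _ _ Axy.
  have [c] := @rat_in_itvoo _ (r / 4) (r / 2) ltac:(lra).
  rewrite in_itv /= => /andP[c1 c2].
  have [a] := @rat_in_itvoo _ (x - ratr c) (x + ratr c) ltac:(lra).
  rewrite in_itv /= => /andP[a1 a2].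
  have [b] := @rat_in_itvoo _ (y - ratr c) (y + ratr c) ltac:(lra).
  rewrite in_itv /= => /andP[b1 b2].
  exists a => //; exists b => //; exists c => //.
  case: asboolP => [_|[]].
    by split => /=; rewrite in_itv /=; apply/andP; split; lra.
  move=> [s t] [/=]; rewrite !in_itv /= => /andP[? ?] /andP[? ?].
  by apply: hr; rewrite ltr_norml; apply/andP; split; lra.
apply: bigcupT_measurable_rat => a; apply: bigcupT_measurable_rat => b.
apply: bigcupT_measurable_rat => c; case: asboolP => // _.
by apply: measurableX.
Qed.

Lemma null_ysections (N : set (R * R)) : measurable N ->
  (forall y, mu (ysection N y) = 0%E) -> (mu \x mu)%E N = 0%E.
Proof.
move=> mN h.
rewrite (@product_measure_unique _ _ _ _ _ _ _ (mu \x^ mu)%E)//; last first.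
  by move=> A B mA mB; exact: product_measure2E.
rewrite [LHS](_ : _ = \int[mu]_y mu (ysection N y))%E//.
by rewrite integral0_eq// => y _ /=.
Qed.

Lemma null_xsections (N : set (R * R)) (A : set R) : measurable N -> mu A = 0%E ->
  measurable A -> (forall x, ~ A x -> mu (xsection N x) = 0%E) -> (mu \x mu)%E N = 0%E.
Proof.
move=> mN A0 mA h; rewrite [LHS](_ : _ = \int[mu]_x mu (xsection N x))%E//.
rewrite (@ae_eq_integral _ _ _ mu setT (cst 0%E))//=.
- by rewrite integral0.
- exact: measurable_fun_xsection.
- exists A; split => // x /=; apply: contra_notP => nA _.
  exact: h.
Qed.

Lemma null_section1 (N : set (R * R)) : measurable N -> (mu \x mu)%E N = 0%E ->
  exists A : set R, [/\ measurable A, mu A = 0%E &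
    forall x, ~ A x -> mu (xsection N x) = 0%E].
Proof.
move=> mN h; have mf := measurable_fun_xsection mu mN.
have H0 : (\int[mu]_x `|mu (xsection N x)|)%E = 0%E.
  by rewrite -[RHS]h; apply: eq_integral => x _; rewrite gee0_abs.
have [A [mA A0 sub]] := (ae_eq_integral_abs mu measurableT mf).1 H0.
by exists A; split => // x; apply: contra_notP => hx; apply: sub => /(_ I).
Qed.

Lemma null_section2 (N : set (R * R)) : measurable N -> (mu \x mu)%E N = 0%E ->
  exists A : set R, [/\ measurable A, mu A = 0%E &
    forall y, ~ A y -> mu (ysection N y) = 0%E].
Proof.
move=> mN; rewrite (@product_measure_unique _ _ _ _ _ _ _ (mu \x^ mu)%E)//; last first.
  by move=> A B mA mB; exact: product_measure2E.
move=> h; have mf := measurable_fun_ysection mu mN.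
have H0 : (\int[mu]_x `|mu (ysection N x)|)%E = 0%E.
  by rewrite -[RHS]h; apply: eq_integral => x _; rewrite gee0_abs.
have [A [mA A0 sub]] := (ae_eq_integral_abs mu measurableT mf).1 H0.
by exists A; split => // x; apply: contra_notP => hx; apply: sub => /(_ I).
Qed.

End NullSets.

(** * Measurability and almost everywhere differentiability *)

Section DirectionalDerivative.
Context {R : realType}.
Implicit Types (S : R -> R -> Prop) (U : R -> R -> R).
Local Notation mu := (@lebesgue_measure R).

(** Quantitative lower semicontinuity: [(a', b')] lies at the fraction [m / r] of a segment from
    [(a, b)] to a point of the box, where [U] is at least 0, while [U a b] is at most [M]. *)
Lemma ccv2_lower S U M a b r m a' b' : cvx2 S -> ccv2 S U ->
  (forall x y, S x y -> 0 <= U x y <= M) ->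
  box_in S a b r -> 0 < m <= r -> `|a' - a| < m -> `|b' - b| < m ->
  U a b - M * (m / r) <= U a' b'.
Proof.
move=> cS cU UM hr /andP[m0 mr] am bm; have r0 : 0 < r by lra.
pose t := m / r; have t01 : 0 <= t <= 1.
  by rewrite /t ler_pdivrMr// mul1r mr andbT divr_ge0// ltW.
have t0 : 0 < t by rewrite divr_gt0.
pose x := a + (a' - a) / t; pose y := b + (b' - b) / t.
have Sxy : S x y.
  have rE : r = m / t by rewrite /t; field; rewrite !gt_eqF.
  by apply: hr; rewrite /x /y addrC addKr normrM normfV (gtr0_norm t0) rE
    ltr_pM2r// invr_gt0.
have Sab : S a b by apply: hr; rewrite subrr normr0.
have := cU _ _ _ _ _ t01 Sxy Sab.
have -> : t * x + (1 - t) * a = a' by rewrite /x; field; rewrite gt_eqF.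
have -> : t * y + (1 - t) * b = b' by rewrite /y; field; rewrite gt_eqF.
have /andP[u0 _] := UM _ _ Sxy; have /andP[_ u1] := UM _ _ Sab.
have := mulr_ge0 (ltW t0) u0.
have := ler_wpM2l (ltW t0) u1.
rewrite -/t; lra.
Qed.

(** The right derivative along [(v1, v2)]. For concave [U] it exists at every inner point, so no
    null set has to be removed before slices are formed. *)
Definition dder S U v1 v2 a b :=
  sup (slopes_right (fun h => S (a + h * v1) (b + h * v2))
                    (fun h => U (a + h * v1) (b + h * v2))).

Section AtInnerPoint.
Variables (S : R -> R -> Prop) (U : R -> R -> R) (v1 v2 a b : R).
Hypotheses (cS : cvx2 S) (cU : ccv2 S U) (iS : inner S a b).
Hypothesis (v1le : `|v1| <= 1) (v2le : `|v2| <= 1).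

Let hyp : exists2 rho, 0 < rho & forall h, `|h| < rho -> S (a + h * v1) (b + h * v2).
Proof.
have [r r0 hr] := iS; exists r => // h hh.
by apply: hr; rewrite addrC addKr normrM; apply: le_lt_trans hh;
   rewrite -[leRHS]mulr1 ler_wpM2l.
Qed.

Let cc s t l : 0 <= l <= 1 -> S (a + s * v1) (b + s * v2) ->
  S (a + t * v1) (b + t * v2) ->
  S (a + (l * s + (1 - l) * t) * v1) (b + (l * s + (1 - l) * t) * v2) /\
  l * U (a + s * v1) (b + s * v2) + (1 - l) * U (a + t * v1) (b + t * v2) <=
    U (a + (l * s + (1 - l) * t) * v1) (b + (l * s + (1 - l) * t) * v2).
Proof.
move=> l01 s1 s2; have := cS _ _ _ _ _ l01 s1 s2; have := cU _ _ _ _ _ l01 s1 s2.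
have E x (w : R) : l * (x + s * w) + (1 - l) * (x + t * w) = x + (l * s + (1 - l) * t) * w.
  by ring.
by rewrite !E.
Qed.

Lemma dder_le h : 0 < h -> S (a + h * v1) (b + h * v2) ->
  U (a + h * v1) (b + h * v2) <= U a b + dder S U v1 v2 a b * h.
Proof.
have [r r0 hr] := hyp => h0 Sh.
by have := right_slope_le _ _ _ r0 hr cc _ h0 Sh; rewrite /= !mul0r !addr0.
Qed.

Lemma dder_left h : 0 < h -> S (a - h * v1) (b - h * v2) ->
  U (a - h * v1) (b - h * v2) <= U a b - dder S U v1 v2 a b * h.
Proof.
have [r r0 hr] := hyp => h0 Sh.
have Sh' : S (a + - h * v1) (b + - h * v2) by rewrite !mulNr.
by have := right_slope_left _ _ _ r0 hr cc _ h0 Sh'; rewrite /= !mul0r !addr0 !mulNr.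
Qed.

Lemma dder_approx e : 0 < e -> exists2 d, 0 < d & forall h, 0 < h -> h < d ->
  S (a + h * v1) (b + h * v2) /\
  U a b + (dder S U v1 v2 a b - e) * h <= U (a + h * v1) (b + h * v2).
Proof.
have [r r0 hr] := hyp => e0.
have [d d0 hd] := right_slope_approx _ _ _ r0 hr cc _ e0.
by exists d => // h h0 h1; have := hd _ h0 h1; rewrite /= !mul0r !addr0.
Qed.

Lemma dder_le_bound c : (exists2 d, 0 < d & forall h, 0 < h -> h < d ->
    U (a + h * v1) (b + h * v2) <= U a b + c * h) -> dder S U v1 v2 a b <= c.
Proof.
move=> [d d0 hd]; rewrite leNgt; apply/negP => lt.
have e0 : 0 < (dder S U v1 v2 a b - c) / 2 by lra.
have [d' d'0 hd'] := dder_approx _ e0.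
pose h := Num.min d d' / 2.
have m0 : 0 < Num.min d d' by rewrite lt_min d0.
have ml : Num.min d d' <= d by rewrite ge_min lexx.
have mr : Num.min d d' <= d' by rewrite ge_min lexx orbT.
have hd0 : h < d by rewrite /h; lra.
have hd1 : h < d' by rewrite /h; lra.
have h0 : 0 < h by rewrite /h; lra.
have h1 := hd h h0 hd0; have [_ h2] := hd' h h0 hd1.
by have := le_trans h2 h1; rewrite lerD2l ler_pM2r// => ?; lra.
Qed.

End AtInnerPoint.

Lemma dderN S U v1 v2 a b : cvx2 S -> ccv2 S U -> inner S a b ->
  `|v1| <= 1 -> `|v2| <= 1 -> dder S U (- v1) (- v2) a b <= - dder S U v1 v2 a b.
Proof.
move=> cS cU iS h1 h2; apply: dder_le_bound; rewrite ?normrN//.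
have [r r0 hr] := iS; exists r => // h h0 hh.
have E x w : x + h * - w = x - h * w by rewrite mulrN.
rewrite !E mulNr; apply: dder_left => //.
apply: hr; rewrite addrC addKr normrN normrM gtr0_norm//; apply: le_lt_trans hh;
   by rewrite -[leRHS]mulr1 ler_wpM2l// ltW.
Qed.

End DirectionalDerivative.

Section Gradient.
Context {R : realType}.
Local Notation mu := (@lebesgue_measure R).

Definition cur T (F : R * R -> T) a b := F (a, b).

Definition core (S : set (R * R)) : set (R * R) := [set y | inner (cur _ S) y.1 y.2].

Variables (S : set (R * R)) (u : R * R -> R) (M : R).
Hypotheses (cS : cvx2 (cur _ S)) (cu : ccv2 (cur _ S) (cur _ u)).
Hypothesis uM : forall x y, cur _ S x y -> 0 <= cur _ u x y <= M.

Let O := core S.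

Lemma box_core (a b r : R) : box_in (cur _ S) a b r -> forall a' b', `|a' - a| < r -> 
  `|b' - b| < r -> O (a', b').
Proof.
move=> hr a' b' ha hb.
pose m := Num.min (r - `|a' - a|) (r - `|b' - b|).
exists m; first by rewrite lt_min; apply/andP; split; rewrite subr_gt0.
move=> x y; rewrite !lt_min => /andP[h1 h2] /andP[h3 h4]; apply: hr.
- by have := ler_normD (x - a') (a' - a); rewrite addrA subrK; move: h1 => /=; lra.
- by have := ler_normD (y - b') (b' - b); rewrite addrA subrK; move: h4 => /=; lra.
Qed.

Lemma core_open (a b : R) : O (a, b) -> inner (cur _ O) a b.
Proof. by move=> [r r0 hr]; exists r => // a' b' *; exact: (box_core _ _ _ hr). Qed.

Lemma core_measurable : measurable O.
Proof. by apply: open_prod_measurable => a b; exact: core_open. Qed.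

(** By [ccv2_lower] the superlevel sets of [u] in the core are open. *)
Lemma core_fun_measurable : measurable_fun O u.
Proof.
apply: (measurability (@RGenOInfty.G R)) => [|/= _ [_] [c] -> <-].
  exact: RGenOInfty.measurableE.
apply: open_prod_measurable => a b [] [r r0 hr]; rewrite /= in_itv /= andbT => cu'.
have M0 : 0 <= M.
  have : cur _ S a b by apply: hr; rewrite subrr normr0.
  by move=> /uM /andP[]; exact: le_trans.
(* With this [d] one has [M * d < u (a, b) - c], so the loss in [ccv2_lower] leaves the value above
   [c]. *)
pose d := (u (a, b) - c) / (M + (u (a, b) - c)).
have d0 : 0 < d by rewrite divr_gt0//; lra.
have d1 : d <= 1 by rewrite /d ler_pdivrMr; lra.
have m0 : 0 < d * r <= r by rewrite mulr_gt0//= -[leRHS]mul1r ler_pM2r.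
exists (d * r); first by case/andP: m0.
move=> x y xm ym; split; first by apply: (box_core _ _ _ hr); lra.
rewrite /= in_itv /= andbT.
apply: (lt_le_trans _ (ccv2_lower _ _ _ _ _ _ _ x y cS cu uM hr m0 xm ym)).
rewrite /cur mulfK ?gt_eqF//.
suff : M * d < u (a, b) - c by lra.
by rewrite /d mulrA ltr_pdivrMr; nra.
Qed.

Lemma dder_measurable (v1 v2 : R) : `|v1| <= 1 -> `|v2| <= 1 ->
  measurable_fun O (fun y => dder (cur _ S) (cur _ u) v1 v2 y.1 y.2).
Proof.
move=> v1le v2le.
(* Extension by 0 makes the translates of [u] measurable on the whole plane; near a given point of
   the core the quotients with step [1 / (n + 1)] see only values of [u] once [n] is large. *)
pose w := (u \_ O) : R * R -> R.
have mw : measurable_fun setT w.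
  by apply/(measurable_restrictT _ core_measurable); exact: core_fun_measurable.
pose g (n : nat) (y : R * R) : R :=
  n.+1%:R * (w (y.1 + n.+1%:R^-1 * v1, y.2 + n.+1%:R^-1 * v2) - w y).
have mg n : measurable_fun O (g n).
  apply: measurable_funTS; apply: measurable_funM; first exact: measurable_cst.
  apply: measurable_funB => //; apply: (measurableT_comp mw).
  apply/measurable_fun_pairP; split => /=;
    apply: measurable_funD; try exact: measurable_cst.
  - exact: measurable_fst.
  - exact: measurable_snd.
apply: (measurable_fun_cvg mg) => -[a b] Oab /=.
apply/cvgrPdist_lt => e e0.
have iS : inner (cur _ S) a b := Oab.
have [d d0 hd] := dder_approx _ _ _ _ _ _ cS cu iS v1le v2le (e / 2) ltac:(lra).
have [r r0 hr] := Oab.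
have m0 : 0 < Num.min d r by rewrite lt_min d0.
near=> n.
have hm : n.+1%:R^-1 < Num.min d r.
  by near: n; exact: (near_infty_natSinv_lt (PosNum m0)).
move: hm; set h : R := n.+1%:R^-1; have h0 : 0 < h by rewrite invr_gt0.
 rewrite lt_min => /andP[hd1 hr1].
have Oh : O (a + h * v1, b + h * v2).
  by apply: (box_core _ _ _ hr); rewrite addrC addKr normrM gtr0_norm//;
    apply: le_lt_trans hr1; rewrite -[leRHS]mulr1 ler_wpM2l// ltW.
have [Sh lo] := hd _ h0 hd1.
have hi := dder_le _ _ _ _ _ _ cS cu iS v1le v2le _ h0 Sh.
rewrite /g /= /w !patchE !mem_set//.
move: lo hi; rewrite /cur; set D := dder _ _ _ _ _ _.
set A := u (a, b); set B := u (_, _) => lo hi.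
have nE : n.+1%:R = h^-1 by rewrite invrK.
rewrite nE; have -> : D - h^-1 * (B - A) = (A + D * h - B) / h by field; rewrite gt_eqF.
have eh : 0 < e * h by rewrite mulr_gt0.
by rewrite ger0_norm ?ltr_pdivrMr ?divr_ge0 ?(ltW h0)//; lra.
Unshelve. all: end_near.
Qed.

End Gradient.

Section Gradient.
Context {R : realType}.
Local Notation mu := (@lebesgue_measure R).

Lemma open_inner (A : set (plane R)) (a b : R) : open A -> A (a, b) ->
  inner (cur _ A) a b.
Proof.
rewrite openE => /[apply]; rewrite /interior -nbhs_ballE => -[r /= r0 hr].
exists r => // a' b' ha hb; apply: hr; split => /=.
- by rewrite -ball_normE /= distrC.
- by rewrite -ball_normE /= distrC.
Qed.

Variables (S : set (R * R)) (u : R * R -> R) (M : R).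
Hypotheses (cS : cvx2 (cur _ S)) (cu : ccv2 (cur _ S) (cur _ u)).
Hypothesis uM : forall x y, cur _ S x y -> 0 <= cur _ u x y <= M.

Let O := core S.
Local Notation D v1 v2 := (dder (cur _ S) (cur _ u) v1 v2).

Lemma is_derive_dder (a b v1 v2 : R) : O (a, b) -> `|v1| <= 1 -> `|v2| <= 1 ->
  D v1 v2 a b = - D (- v1) (- v2) a b ->
  is_derive ((a, b) : plane R) ((v1, v2) : plane R) (u : plane R -> R^o) (D v1 v2 a b).
Proof.
move=> Oab v1le v2le e.
have iS : inner (cur _ S) a b := Oab.
have v1le' : `|- v1| <= 1 by rewrite normrN.
have v2le' : `|- v2| <= 1 by rewrite normrN.
suff H : (fun h : R => h^-1 *: (((u : plane R -> R^o) \o shift ((a, b) : plane R))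
    (h *: ((v1, v2) : plane R)) - u (a, b) : R^o)) @ 0^' --> (D v1 v2 a b : R^o).
  by split; [apply/cvg_ex; eexists; exact: H | exact: cvg_lim H].
apply/cvgrPdist_le => eps e0.
have [d1 d10 hd1] := dder_approx _ _ _ _ _ _ cS cu iS v1le v2le _ e0.
have [d2 d20 hd2] := dder_approx _ _ _ _ _ _ cS cu iS v1le' v2le' _ e0.
have m0 : 0 < Num.min d1 d2 by rewrite lt_min d10.
near=> h.
have hn0 : h != 0 by near: h; exact: nbhs_dnbhs_neq.
have : `|h| < Num.min d1 d2.
  by near: h; exact: (@dnbhs0_lt _ R^o).
rewrite lt_min => /andP[h1 h2] /=.
have -> : (h *: ((v1, v2) : plane R) + ((a, b) : plane R)) = (a + h * v1, b + h * v2) :> R * R.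
  by rewrite [a + _]addrC [b + _]addrC.
change (`|D v1 v2 a b - h^-1 * (u (a + h * v1, b + h * v2) - u (a, b))| <= eps).
move: hn0; rewrite neq_lt => /orP[hn|hp].
- rewrite ltr0_norm// in h1 h2.
  have k0 : 0 < - h by lra.
  have [Sk lo] := hd2 (- h) k0 h2.
  have hi := dder_le _ _ _ _ _ _ cS cu iS v1le' v2le' _ k0 Sk.
  move: lo hi; rewrite !mulrNN /cur -[D (-v1) (-v2) a b]opprK -e.
  set A := u (a, b); set B := u (_, _); set d := D _ _ _ _ => lo hi.
  have -> : d - h^-1 * (B - A) = (B - A - d * h) / (- h) by field; rewrite lt_eqF.
  by rewrite normrM normfV (gtr0_norm k0) ler_pdivrMr// ler_norml; lra.
- rewrite gtr0_norm// in h1 h2.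
  have [Sk lo] := hd1 h hp h1.
  have hi := dder_le _ _ _ _ _ _ cS cu iS v1le v2le _ hp Sk.
  move: lo hi; rewrite /cur.
  set A := u (a, b); set B := u (_, _); set d := D _ _ _ _ => lo hi.
  have -> : d - h^-1 * (B - A) = (A + d * h - B) / h by field; rewrite gt_eqF.
  by rewrite normrM normfV (gtr0_norm hp) ler_pdivrMr// ler_norml; lra.
Unshelve. all: end_near.
Qed.

Definition grad1 (y : R * R) := D 1 0 y.1 y.2.
Definition grad2 (y : R * R) := D 0 1 y.1 y.2.

Lemma measurable_grad1 : measurable_fun O grad1.
Proof. by apply: dder_measurable cS cu uM _ _ _ _; rewrite ?normr1 ?normr0. Qed.

Lemma measurable_grad2 : measurable_fun O grad2.
Proof. by apply: dder_measurable cS cu uM _ _ _ _; rewrite ?normr1 ?normr0. Qed.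

Let n1 : `|1 : R| <= 1. Proof. by rewrite normr1. Qed.
Let n0 : `|0 : R| <= 1. Proof. by rewrite normr0. Qed.

(** The right derivative serves to the left as well, being at most the left derivative. The bound
    holds at every point of the core, so the slopes can be integrated on every slice. *)
Lemma grad1_slice (a b a' : R) : O (a, b) -> S (a', b) ->
  u (a', b) <= u (a, b) + grad1 (a, b) * (a' - a).
Proof.
move=> Oab Sa'; rewrite /grad1 /=.
have [lt|lt|->] := ltgtP a a'; last by rewrite subrr mulr0 addr0.
- have := dder_le _ _ _ _ _ _ cS cu Oab n1 n0 (a' - a).
  rewrite mulr1 mulr0 addr0 [a + _]addrC subrK /cur; apply => //; lra.
- have := dder_left _ _ _ _ _ _ cS cu Oab n1 n0 (a - a').
  rewrite mulr1 mulr0 subr0 subKr /cur -mulrN opprB; apply => //; lra.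
Qed.

Lemma grad2_slice (a b b' : R) : O (a, b) -> S (a, b') ->
  u (a, b') <= u (a, b) + grad2 (a, b) * (b' - b).
Proof.
move=> Oab Sa'; rewrite /grad2 /=.
have [lt|lt|->] := ltgtP b b'; last by rewrite subrr mulr0 addr0.
- have := dder_le _ _ _ _ _ _ cS cu Oab n0 n1 (b' - b).
  rewrite mulr1 mulr0 addr0 [b + _]addrC subrK /cur; apply => //; lra.
- have := dder_left _ _ _ _ _ _ cS cu Oab n0 n1 (b - b').
  rewrite mulr1 mulr0 subr0 subKr /cur -mulrN opprB; apply => //; lra.
Qed.

Let gap1 := [set y : R * R | O y /\ D 1 0 y.1 y.2 < - D (-1) (-0) y.1 y.2].
Let gap2 := [set y : R * R | O y /\ D 0 1 y.1 y.2 < - D (-0) (-1) y.1 y.2].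

Let measurable_gap v1 v2 : `|v1| <= 1 -> `|v2| <= 1 ->
  measurable [set y : R * R | O y /\ D v1 v2 y.1 y.2 < - D (- v1) (- v2) y.1 y.2].
Proof.
move=> h1 h2.
have mf : measurable_fun O (fun y : R * R => - D (- v1) (- v2) y.1 y.2 - D v1 v2 y.1 y.2).
  apply: measurable_funB; last exact: (dder_measurable S u M).
  by apply: measurable_funN; apply: (dder_measurable S u M) => //; rewrite normrN.
have -> : [set y : R * R | O y /\ D v1 v2 y.1 y.2 < - D (- v1) (- v2) y.1 y.2] =
    O `&` (fun y : R * R => - D (- v1) (- v2) y.1 y.2 - D v1 v2 y.1 y.2) @^-1` `]0, +oo[.
  by apply/seteqP; split => y /= [Oy]; rewrite in_itv /= andbT subr_gt0.
by apply: mf; [exact: core_measurable|exact: measurable_itv].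
Qed.

(** Along a horizontal line the left derivative at a point is at most the right derivative at any
    earlier point. So the gaps between the two are disjoint intervals, and only countably many
    points of the line have one. *)
Let null_gap1 : (mu \x mu)%E gap1 = 0%E.
Proof.
apply: null_ysections; first exact: measurable_gap.
move=> b; apply: countable_lebesgue_measure0.
apply: (@countable_gaps _ _ (fun a => D 1 0 a b) (fun a => - D (-1) (-0) a b)).
  by move=> a; rewrite /ysection /= inE => -[].
move=> y z; rewrite /ysection /= !inE => -[Oy _] [Oz _] yz.
have h1 := grad1_slice y b z Oy (inner_sub _ _ _ Oz).
have n1' : `|(-1) : R| <= 1 by rewrite normrN1.
have n0' : `|(- 0) : R| <= 1 by rewrite normrN normr0.
have := dder_le _ _ _ _ _ _ cS cu Oz n1' n0' (z - y).
rewrite mulrN1 opprB (addrC z (y - z)) subrK oppr0 mulr0 addr0 /cur subr_gt0.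
move=> /(_ yz (inner_sub _ _ _ Oy)) h2.
move: h1 h2; rewrite /grad1 /=; set A := u _; set B := u _ => h1 h2.
rewrite -(@ler_pM2r _ (z - y)) ?subr_gt0//; lra.
Qed.

Let null_gap2 : (mu \x mu)%E gap2 = 0%E.
Proof.
apply: (null_xsections _ set0) => //; first exact: measurable_gap.
move=> a _; apply: countable_lebesgue_measure0.
apply: (@countable_gaps _ _ (fun b => D 0 1 a b) (fun b => - D (-0) (-1) a b)).
  by move=> b; rewrite /xsection /= inE => -[].
move=> y z; rewrite /xsection /= !inE => -[Oy _] [Oz _] yz.
have h1 := grad2_slice a y z Oy (inner_sub _ _ _ Oz).
have n1' : `|(-1) : R| <= 1 by rewrite normrN1.
have n0' : `|(- 0) : R| <= 1 by rewrite normrN normr0.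
have := dder_le _ _ _ _ _ _ cS cu Oz n0' n1' (z - y).
rewrite mulrN1 opprB (addrC z (y - z)) subrK oppr0 mulr0 addr0 /cur subr_gt0.
move=> /(_ yz (inner_sub _ _ _ Oy)) h2.
move: h1 h2; rewrite /grad2 /=; set A := u _; set B := u _ => h1 h2.
rewrite -(@ler_pM2r _ (z - y)) ?subr_gt0//; lra.
Qed.

(** Off the two gap sets the one-sided partial derivatives agree. Every supergradient lies between
    them componentwise, hence is unique, and one exists at each interior point. *)
Lemma ae_gradient : exists N : set (R * R), [/\ measurable N, (mu \x mu)%E N = 0%E &
  forall a b, O (a, b) -> ~ N (a, b) ->
  [/\ is_derive ((a, b) : plane R) ((1, 0) : plane R) (u : plane R -> R^o) (grad1 (a, b)),
      is_derive ((a, b) : plane R) ((0, 1) : plane R) (u : plane R -> R^o) (grad2 (a, b)),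
      sgrad (cur _ S) (cur _ u) a b (grad1 (a, b)) (grad2 (a, b)) &
      forall p q, sgrad (cur _ S) (cur _ u) a b p q ->
        p = grad1 (a, b) /\ q = grad2 (a, b)]].
Proof.
exists (gap1 `|` gap2); split.
- by apply: measurableU; exact: measurable_gap.
- apply/eqP; rewrite eq_le measure_ge0 andbT.
  have H : ((mu \x mu) (gap1 `|` gap2) <= (mu \x mu) gap1 + (mu \x mu) gap2)%E.
    by apply: measureU2; exact: measurable_gap.
  by apply: (le_trans H); rewrite null_gap1 null_gap2 adde0.
move=> a b Oab nN.
have iS : inner (cur _ S) a b := Oab.
have e1 : D 1 0 a b = - D (-1) (-0) a b.
  apply/eqP; rewrite eq_le; apply/andP; split.
    by rewrite lerNr; apply: dderN.
  by rewrite leNgt; apply/negP => lt; apply: nN; left.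
have e2 : D 0 1 a b = - D (-0) (-1) a b.
  apply/eqP; rewrite eq_le; apply/andP; split.
    by rewrite lerNr; apply: dderN.
  by rewrite leNgt; apply/negP => lt; apply: nN; right.
suff uniq p q : sgrad (cur _ S) (cur _ u) a b p q ->
    p = grad1 (a, b) /\ q = grad2 (a, b).
  split; [exact: is_derive_dder|exact: is_derive_dder| |exact: uniq].
  by have [p [q hpq]] := sgrad_exists _ _ _ _ cS cu iS; have [<- <-] := uniq _ _ hpq.
move=> hpq; have [r r0 hr] := iS.
have in1 s : `|s| < r -> cur _ S (a + s) b.
  by move=> sr; apply: hr; rewrite ?subrr ?normr0// addrC addKr.
have in2 s : `|s| < r -> cur _ S a (b + s).
  by move=> sr; apply: hr; rewrite ?subrr ?normr0// addrC addKr.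
have n1' : `|(-1) : R| <= 1 by rewrite normrN1.
have n0' : `|(- 0) : R| <= 1 by rewrite normrN normr0.
suff [-> ->] : grad1 (a, b) = p /\ grad2 (a, b) = q by [].
split.
- apply/eqP; rewrite eq_le; apply/andP; split.
    apply: dder_le_bound => //; exists r => // h h0 hh.
    have := hpq _ _ (in1 h ltac:(by rewrite gtr0_norm)).
    by rewrite mulr0 mulr1 subrr mulr0 !addr0 [a + h - a]addrC addKr.
  rewrite /grad1 /= e1 lerNr.
  apply: dder_le_bound => //; exists r => // h h0 hh.
  have := hpq _ _ (in1 (- h) ltac:(by rewrite normrN gtr0_norm)).
  by rewrite oppr0 mulr0 mulrN1 subrr mulr0 !addr0 [a - h - a]addrC addKr mulrN mulNr.
- apply/eqP; rewrite eq_le; apply/andP; split.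
    apply: dder_le_bound => //; exists r => // h h0 hh.
    have := hpq _ _ (in2 h ltac:(by rewrite gtr0_norm)).
    by rewrite mulr0 mulr1 subrr mulr0 !addr0 [b + h - b]addrC addKr.
  rewrite /grad2 /= e2 lerNr.
  apply: dder_le_bound => //; exists r => // h h0 hh.
  have := hpq _ _ (in2 (- h) ltac:(by rewrite normrN gtr0_norm)).
  by rewrite oppr0 mulr0 mulrN1 subrr mulr0 !addr0 [b - h - b]addrC addKr mulrN mulNr.
Qed.

End Gradient.

(** * Resistance as an integral over slices *)

Section NonMeasurable.
Local Open Scope ereal_scope.
Context d (T : measurableType d) (R : realType) (mu : {measure set T -> \bar R}).
Import HBNNSimple.

(** The integral of a nonnegative function is a supremum over the simple functions below it, so
    monotonicity holds without measurability. *)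
Lemma le_integral_nonneg (D : set T) (f g : T -> \bar R) :
  (forall x, D x -> 0 <= f x) -> (forall x, D x -> f x <= g x) ->
  \int[mu]_(x in D) f x <= \int[mu]_(x in D) g x.
Proof.
move=> f0 fg.
have g0 x : D x -> 0 <= g x by move=> Dx; apply: le_trans (f0 _ Dx) (fg _ Dx).
rewrite !ge0_integralE//; apply: ereal_sup_le => _ [h hf <-].
exists h => // x; apply: le_trans (hf x) _; exact: lee_restrict.
Qed.

(* The integrand [f] may fail to be measurable on the null set [N]. *)
Lemma integral_eq_off_null (D N : set T) (f g : T -> \bar R) :
  measurable D -> measurable N -> mu N = 0 ->
  (forall x, D x -> 0 <= f x) -> (forall x, D x -> 0 <= g x) ->
  measurable_fun D g -> (forall x, D x -> ~ N x -> f x = g x) ->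
  \int[mu]_(x in D) f x = \int[mu]_(x in D) g x.
Proof.
move=> mD mN N0 f0 g0 mg fg; apply/eqP; rewrite eq_le; apply/andP; split; last first.
  rewrite (ge0_negligible_integral mN mD)//.
  rewrite [leLHS](eq_integral f); last first.
    by move=> x; rewrite inE => -[Dx nNx]; rewrite fg.
  rewrite [leLHS]integral_mkcond [leRHS]integral_mkcond.
  apply: le_integral_nonneg => x _.
    by rewrite patchE; case: ifPn => //; rewrite inE => -[/f0].
  rewrite !patchE; case: ifPn => [|_]; first by rewrite inE => -[Dx _]; rewrite mem_set.
  by case: ifPn => //; rewrite inE => /f0.
rewrite ge0_integralE//; apply: ge_ereal_sup => _ [h hf <-].
have -> : sintegral mu h = \int[mu]_x (h x)%:E.
  by rewrite integral_nnsfun// patch_setT.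
have mh : measurable_fun [set: T] (fun x => (h x)%:E) by exact/measurable_EFinP.
rewrite (@ge0_negligible_integral _ _ _ mu setT N)//; last first.
  by move=> x _; rewrite lee_fin.
rewrite [leLHS]integral_mkcond [leRHS]integral_mkcond.
apply: le_integral_nonneg => x _.
  by rewrite patchE; case: ifPn => // _; rewrite lee_fin.
have g0' : 0 <= (g \_ D) x by apply: erestrict_ge0.
rewrite [leLHS]patchE; case: ifPn => //; rewrite inE => -[_ nNx].
apply: le_trans (hf x) _; rewrite !patchE; case: ifPn => //.
by rewrite inE => Dx; rewrite fg.
Qed.

End NonMeasurable.

Section BoundaryNull.
Context {R : realType}.
Local Notation mu := (@lebesgue_measure R).

(** [A] has at most one point on each side of [b0], so the side is an injective code. *)
Lemma countable_sign (A : set R) (b0 : R) :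
  (forall x, A x -> x != b0) ->
  (forall x y, A x -> A y -> b0 < x -> x < y -> False) ->
  (forall x y, A x -> A y -> x < y -> y < b0 -> False) -> countable A.
Proof.
move=> h0 h1 h2; apply/countable_injP; exists (fun x => (b0 < x)%R : nat).
move=> x y /set_mem Ax /set_mem Ay.
have /eqP nx := h0 _ Ax; have /eqP ny := h0 _ Ay.
case: (ltgtP b0 x) => [bx|xb|/esym /nx]; last by [].
- case: (ltgtP b0 y) => [by'|yb|/esym /ny] //.
  by have [xy|yx|//] := ltgtP x y; [case: (h1 x y)|case: (h1 y x)].
- case: (ltgtP b0 y) => [by'|yb|/esym /ny] //.
  by have [xy|yx|//] := ltgtP x y; [case: (h2 x y)|case: (h2 y x)].
Qed.

(** A segment from a core point to a point of [S] lies in the core except perhaps for its far end.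
    Hence a vertical line through the core meets the difference in at most two points, and at most
    two vertical lines meet [S] without meeting the core. *)
Lemma null_boundary (S : set (R * R)) : cvx2 (cur _ S) -> core S !=set0 ->
  measurable S -> (mu \x mu)%E (S `\` core S) = 0%E.
Proof.
move=> cS [[a0 b0] core0] mS.
have mN : measurable (S `\` core S) by apply: measurableD => //; exact: core_measurable.
have between (p q : R * R) (t : R) : core S p -> S q -> 0 < t <= 1 ->
    core S (t * p.1 + (1 - t) * q.1, t * p.2 + (1 - t) * q.2).
  by case: p q => [p1 p2] [q1 q2] cp Sq t01; apply: inner_conv.
pose A := [set x | (exists b, S (x, b)) /\ forall b, ~ core S (x, b)].
have cA : countable A.
  apply: (@countable_sign _ a0) => [x [_ hx]|x y [_ nx] [[b Sb] _] ax xy|y x [[b Sb] _] [_ nx] yx xa].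
  - by apply/eqP => xa; apply: (hx b0); rewrite xa.
  - pose t := (y - x) / (y - a0).
    have ya : 0 < y - a0 by lra.
    have t01 : 0 < t <= 1 by rewrite /t divr_gt0 ?ler_pdivrMr; lra.
    have := between _ _ _ core0 Sb t01 => /=.
    have -> : t * a0 + (1 - t) * y = x by rewrite /t; field; rewrite gt_eqF.
    exact: nx.
  - pose t := (x - y) / (a0 - y).
    have ya : 0 < a0 - y by lra.
    have t01 : 0 < t <= 1 by rewrite /t divr_gt0 ?ler_pdivrMr; lra.
    have := between _ _ _ core0 Sb t01 => /=.
    have -> : t * a0 + (1 - t) * y = x by rewrite /t; field; rewrite gt_eqF.
    exact: nx.
apply: (null_xsections _ A) => //.
- exact: countable_lebesgue_measure0.
- by apply: countable_measurable.
move=> x nAx; apply: countable_lebesgue_measure0.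
have [[c Cc]|nC] := pselect (exists b, core S (x, b)); last first.
  have -> : xsection (S `\` core S) x = set0; last exact: countable0.
  apply/seteqP; split => // b; rewrite /xsection /= inE => -[Sb _].
  by apply: nAx; split; [exists b|move=> b' ?; apply: nC; exists b'].
have step (y z : R) : S (x, z) -> y != z -> (z < y <= c) || (c <= y < z) -> core S (x, y).
  move=> Sz yz h; pose t := (z - y) / (z - c).
  have zc : z - c != 0 by apply/eqP => ?; case/orP: h => h; lra.
  have t01 : 0 < t <= 1.
    case/orP: h => h.
    - rewrite /t -mulrNN -invrN divr_gt0 ?ler_pdivrMr; lra.
    - rewrite /t divr_gt0 ?ler_pdivrMr; lra.
  have := between _ _ _ Cc Sz t01 => /=.
  have -> : t * c + (1 - t) * z = y by rewrite /t; field.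
  by have -> : t * x + (1 - t) * x = x by ring.
apply: (@countable_sign _ c); rewrite /xsection /=.
- by move=> y; rewrite inE => -[Sy ny]; apply/eqP => yc; apply: ny; rewrite yc.
- move=> y z; rewrite !inE => -[Sy ny] [Sz nz] cy yz; apply: ny.
  by apply: (step _ z) => //; rewrite ?lt_eqF// yz (ltW cy) orbT.
- move=> y z; rewrite !inE => -[Sy ny] [Sz nz] yz zc; apply: nz.
  by apply: (step _ y) => //; rewrite ?gt_eqF// yz (ltW zc).
Qed.

End BoundaryNull.

Section Resistance.
Context {R : realType}.
Local Notation mu := (@lebesgue_measure R).

Definition slope_density (p q : R) : R := (1 + p ^+ 2 + q ^+ 2)^-1.

Lemma slope_density_bound p q : 0 < slope_density p q <= 1.
Proof.
have h : 1 <= 1 + p ^+ 2 + q ^+ 2 by have := sqr_ge0 p; have := sqr_ge0 q; lra.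
by rewrite /slope_density invr_gt0 invf_le1 ?h; lra.
Qed.

Variables (S : set (R * R)) (u : R * R -> R) (M : R).
Hypotheses (cS : cvx2 (cur _ S)) (cu : ccv2 (cur _ S) (cur _ u)).
Hypothesis uM : forall x y, cur _ S x y -> 0 <= cur _ u x y <= M.
Hypotheses (core0 : core S !=set0) (mS : measurable S).

Definition density (y : R * R) := slope_density (grad1 S u y) (grad2 S u y).

Lemma measurable_density : measurable_fun (core S) density.
Proof.
(* The denominator is at least 1, and there the inverse agrees with this function, which is monotone
   on the whole line and so measurable. *)
pose c (x : R) := (Num.max x 1)^-1.
have mc : measurable_fun setT c.
  apply: nonincreasing_measurable => // x y xy.
  have m1 z : 0 < Num.max z 1 :> R by rewrite lt_max ltr01 orbT.
  by rewrite lef_pV2 ?posrE// ge_max !le_max lexx xy orbT.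
apply: (@eq_measurable_fun _ _ _ _ _
    (c \o (fun y => 1 + grad1 S u y ^+ 2 + grad2 S u y ^+ 2))).
  move=> y _; rewrite /c /density /slope_density /=; congr (_^-1).
  by apply/max_idPl; have := sqr_ge0 (grad1 S u y); have := sqr_ge0 (grad2 S u y); lra.
apply: measurableT_comp => //; apply: measurable_funD; first apply: measurable_funD => //.
- by apply: measurable_funX; exact: measurable_grad1 cS cu uM.
- by apply: measurable_funX; exact: measurable_grad2 cS cu uM.
Qed.

(** The derivatives in [resistance] are conventional values where [u] has no gradient. The integrand
    is exchanged for a measurable one off a null set that contains these points and the part of [S]
    outside the core. *)
Lemma resistance_core :
  resistance S u = (\int[mu \x mu]_(y in core S) (density y)%:E)%E.
Proof.
have mO := core_measurable S.
have [N [mN N0 hN]] := ae_gradient S u M cS cu uM.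
have mB : measurable (S `\` core S) by exact: measurableD.
have B0 := null_boundary _ cS core0 mS.
have coreS : core S `<=` S by move=> [a b]; exact: inner_sub.
pose g := (fun y => (density y)%:E) \_ (core S).
transitivity (\int[mu \x mu]_(y in S) g y)%E.
  apply: (@integral_eq_off_null _ _ _ (mu \x mu)%E S (N `|` (S `\` core S))) => //.
  - exact: measurableU.
  - apply/eqP; rewrite eq_le measure_ge0 andbT.
    have H : ((mu \x mu) (N `|` (S `\` core S)) <=
        (mu \x mu) N + (mu \x mu) (S `\` core S))%E by exact: measureU2.
    by apply: (le_trans H); rewrite N0 B0 adde0.
  - move=> y _; rewrite lee_fin.
    have [+ _] := andP (slope_density_bound ('D_((1, 0) : plane R) (u : plane R -> R^o) y)
      ('D_((0, 1) : plane R) (u : plane R -> R^o) y)).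
    by rewrite /slope_density /sqnorm_grad addrA; exact: ltW.
  - move=> y _; apply: erestrict_ge0 => z _.
    by rewrite lee_fin; case/andP: (slope_density_bound (grad1 S u z) (grad2 S u z)) => /ltW.
  - have mg : measurable_fun (core S) (fun y => (density y)%:E).
      by apply/measurable_EFinP; exact: measurable_density.
    by apply: measurable_funTS; exact: (measurable_restrictT _ mO).1 mg.
  move=> [a b] Sab nN.
  have Cab : core S (a, b) by apply: contrapT => nC; apply: nN; right.
  have nNab : ~ N (a, b) by move=> ?; apply: nN; left.
  have [[_ d1] [_ d2] _ _] := hN _ _ Cab nNab.
  by rewrite /g patchE mem_set// /sqnorm_grad d1 d2 /density /slope_density addrA.
rewrite [LHS]integral_mkcond [RHS]integral_mkcond; apply: eq_integral => y _.
rewrite !patchE; case: ifPn => //; rewrite notin_setE => nSy.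
by rewrite memNset// => /coreS.
Qed.

End Resistance.

(** * Fubini for bounded functions of bounded support *)

Section Tame.
Context {R : realType}.
Local Notation mu := (@lebesgue_measure R).
Local Notation mu2 := (mu \x mu)%E.

(** Such functions are integrable on the plane and on every line parallel to an axis, so slices can
    be compared without exceptional ones. *)
Definition tame (K : R * R -> R) := [/\ measurable_fun setT K,
  exists C, forall y, `|K y| <= C &
  exists B, forall y, K y != 0 -> `|y.1| <= B /\ `|y.2| <= B].

Lemma bounded_support_integrable d (T : measurableType d)
    (m : {measure set T -> \bar R}) (D : set T) (K : T -> R) C :
  measurable D -> (m D < +oo)%E -> measurable_fun setT K ->
  (forall y, `|K y| <= C) -> (forall y, K y != 0 -> D y) ->
  m.-integrable setT (EFin \o K).
Proof.
move=> mD fD mK bK sK.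
have iD : m.-integrable D (EFin \o K).
  apply: measurable_bounded_integrable => //; first exact: measurable_funTS.
  exists C; split; first exact: num_real.
  by move=> c Cc y _; apply: le_trans (bK y) (ltW Cc).
rewrite (_ : EFin \o K = (EFin \o K) \_ D); first exact: (integrable_mkcond _ mD).1 iD.
apply/funext => y; rewrite patchE; case: ifPn => //; rewrite notin_setE => nD.
by rewrite /=; have [->//|/sK] := eqVneq (K y) 0.
Qed.

Lemma le_integral_ae d (T : measurableType d) (m : {measure set T -> \bar R})
    (e : T -> R) (F : T -> \bar R) (A : set T) :
  m.-integrable setT (EFin \o e) -> m.-integrable setT F ->
  measurable A -> m A = 0%E -> (forall x, ~ A x -> ((e x)%:E <= F x)%E) ->
  ((\int[m]_x e x)%:E <= \int[m]_x F x)%E.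
Proof.
move=> ie iF mA A0 h.
rewrite /Rintegral fineK; last exact: integrable_fin_num.
rewrite (negligible_integral mA measurableT ie A0).
rewrite (negligible_integral mA measurableT iF A0).
have mD : measurable (setT `\` A) by exact: measurableD.
apply: le_integral => //.
- exact: integrableS ie.
- exact: integrableS iF.
- by move=> x; rewrite inE => -[_ nA]; exact: h.
Qed.

Lemma integrable_fubini_snd d1 d2 (T1 : measurableType d1) (T2 : measurableType d2)
    (m1 : {sigma_finite_measure set T1 -> \bar R})
    (m2 : {sigma_finite_measure set T2 -> \bar R}) (f : T1 * T2 -> \bar R) :
  (m1 \x m2)%E.-integrable setT f -> m2.-integrable setT (fubini_G m1 f).
Proof.
move=> iK; have mf : measurable_fun setT f by exact: measurable_int iK.
have mG := measurable_fubini_G iK.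
apply/integrableP; split => //.
apply: le_lt_trans ((integrable21ltyP _ _ mf).1 iK).
apply: ge0_le_integral => //.
- exact: measurableT_comp.
- have ma : measurable_fun setT (abse \o f) by exact: measurableT_comp.
  by apply: (measurable_fun_fubini_tonelli_G (abse \o f)) => // z; exact: abse_ge0.
- move=> y _; apply: le_abse_integral => //.
  exact: (measurableT_comp mf (pair2_measurable y)).
Qed.

Lemma itv_finite (B : R) : (mu `[(- B)%R, B] < +oo)%E.
Proof.
rewrite /= lebesgue_measure_itv /= lte_fin; case: ifP => _; last exact: ltry.
by rewrite -EFinD ltry.
Qed.

Section Fixed.
Variable K : R * R -> R.
Hypothesis tK : tame K.

Lemma tame_integrable : mu2.-integrable setT (EFin \o K).
Proof.
have [mK [C bK] [B sK]] := tK.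
apply: (@bounded_support_integrable _ _ mu2 (`[- B, B] `*` `[- B, B]) K C) => //.
- exact: measurableX.
- have E : mu2 (`[(- B)%R, B] `*` `[(- B)%R, B]) = (mu `[(- B)%R, B] * mu `[(- B)%R, B])%E.
    by apply: product_measure1E; exact: measurable_itv.
  apply: le_lt_trans (_ : mu `[(- B)%R, B] * mu `[(- B)%R, B] < +oo)%E.
    by rewrite -E.
  by apply: lte_mul_pinfty => //; rewrite ?ge0_fin_numE ?itv_finite.
- by move=> y /sK; rewrite !ler_norml => -[h1 h2]; split; rewrite /= in_itv.
Qed.

Lemma tame_section1 x : mu.-integrable setT (EFin \o (fun y => K (x, y))).
Proof.
have [mK [C bK] [B sK]] := tK.
apply: (@bounded_support_integrable _ _ mu `[- B, B] _ C) => //.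
- exact: itv_finite.
- exact: (measurableT_comp mK (pair1_measurable x)).
- by move=> y /sK; rewrite !ler_norml => -[h1 h2]; rewrite /= in_itv.
Qed.

Lemma tame_section2 y : mu.-integrable setT (EFin \o (fun x => K (x, y))).
Proof.
have [mK [C bK] [B sK]] := tK.
apply: (@bounded_support_integrable _ _ mu `[- B, B] _ C) => //.
- exact: itv_finite.
- exact: (measurableT_comp mK (pair2_measurable y)).
- by move=> x /sK; rewrite !ler_norml => -[h1 h2]; rewrite /= in_itv.
Qed.

Lemma tame_ge1 (e : R -> R) (A : set R) :
  mu.-integrable setT (EFin \o e) -> measurable A -> mu A = 0%E ->
  (forall x, ~ A x -> e x <= \int[mu]_y K (x, y)) ->
  \int[mu]_x e x <= \int[mu2]_z K z.
Proof.
move=> ie mA A0 h; have iK := tame_integrable.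
rewrite -lee_fin [X in (_ <= X)%E](_ : _ = \int[mu2]_z (K z)%:E)%E; last first.
  by rewrite /Rintegral fineK//; exact: (integrable_fin_num measurableT iK).
rewrite -(@integral12_prod_meas1 _ _ _ _ _ mu mu (EFin \o K))//.
apply: (le_integral_ae _ _ mu _ _ A) => //; first exact: integrable_fubini_F.
move=> x nA; have := h x nA; rewrite -lee_fin /Rintegral fineK//.
exact: (integrable_fin_num measurableT (tame_section1 x)).
Qed.

Lemma tame_integrable_slices2 : mu.-integrable setT (fubini_G mu (EFin \o K)).
Proof. exact: integrable_fubini_snd tame_integrable. Qed.

Lemma tame_ge2 (e : R -> R) (A : set R) :
  mu.-integrable setT (EFin \o e) -> measurable A -> mu A = 0%E ->
  (forall y, ~ A y -> e y <= \int[mu]_x K (x, y)) ->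
  \int[mu]_y e y <= \int[mu2]_z K z.
Proof.
move=> ie mA A0 h; have iK := tame_integrable.
rewrite -lee_fin [X in (_ <= X)%E](_ : _ = \int[mu2]_z (K z)%:E)%E; last first.
  by rewrite /Rintegral fineK//; exact: (integrable_fin_num measurableT iK).
rewrite -(@integral21_prod_meas1 _ _ _ _ _ mu mu (EFin \o K))//.
apply: (le_integral_ae _ _ mu _ _ A) => //; first exact: tame_integrable_slices2.
move=> y nA; have := h y nA; rewrite -lee_fin /Rintegral fineK//.
exact: (integrable_fin_num measurableT (tame_section2 y)).
Qed.

End Fixed.

Definition bounded_set2 (S : set (R * R)) :=
  exists B, forall y, S y -> `|y.1| <= B /\ `|y.2| <= B.

Lemma tame_restrict (D : set (R * R)) (f : R * R -> R) C :
  measurable D -> bounded_set2 D -> measurable_fun D f ->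
  (forall y, D y -> `|f y| <= C) -> tame (f \_ D).
Proof.
move=> mD [B hB] mf hC; split.
- exact/(measurable_restrictT _ mD).
- exists `|C| => y; rewrite patchE; case: ifPn => [|_]; last by rewrite normr0.
  by rewrite inE => /hC h; apply: le_trans h (ler_norm _).
- by exists B => y; rewrite patchE; case: ifPn => [|_ /eqP//]; rewrite inE => /hB.
Qed.

(* [N] collects the points at which the gradient of [u] or [w] is undefined. *)
Lemma resistance_gap (S N : set (R * R)) (u w : R * R -> R) (M : R) :
  cvx2 (cur _ S) -> core S !=set0 -> measurable S -> bounded_set2 S ->
  ccv2 (cur _ S) (cur _ u) -> ccv2 (cur _ S) (cur _ w) ->
  (forall x y, cur _ S x y -> 0 <= cur _ u x y <= M) ->
  (forall x y, cur _ S x y -> 0 <= cur _ w x y <= M) ->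
  measurable N -> mu2 N = 0%E ->
  (resistance S u <= resistance S w)%E ->
  let k := (fun y => density S u y - density S w y) \_ (core S `\` N) in
  tame k /\ \int[mu2]_z k z <= 0.
Proof.
move=> cS c0 mS bS cu cw uM wM mN N0 le /=.
have mO := core_measurable S.
have coreS : core S `<=` S by move=> [a b]; exact: inner_sub.
have bO : bounded_set2 (core S) by case: bS => B hB; exists B => y /coreS /hB.
have mDN : measurable (core S `\` N) by exact: measurableD.
have bDN : bounded_set2 (core S `\` N) by case: bO => B hB; exists B => y [/hB].
have mdu : measurable_fun (core S) (density S u) by exact: measurable_density cS cu uM.
have mdw : measurable_fun (core S) (density S w) by exact: measurable_density cS cw wM.
have dB (f : R * R -> R) y : `|density S f y| <= 1.
  have /andP[h1 h2] := slope_density_bound (grad1 S f y) (grad2 S f y).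
  by rewrite gtr0_norm.
have sub : core S `\` N `<=` core S by move=> y [].
have dsub f : measurable_fun (core S) (density S f) -> tame (density S f \_ (core S `\` N)).
  by move=> mf; apply: (@tame_restrict _ _ 1) => //; exact: measurable_funS mO sub mf.
have tu := dsub _ mdu; have tw := dsub _ mdw.
have tk : tame ((fun y => density S u y - density S w y) \_ (core S `\` N)).
  apply: (@tame_restrict _ _ 2) => //.
    apply: measurable_funB; [exact: measurable_funS mO sub mdu|].
    exact: measurable_funS mO sub mdw.
  move=> y _; apply: le_trans (ler_normB _ _) _.
  by have := dB u y; have := dB w y; lra.
split => //.
have resE f : measurable_fun (core S) (density S f) ->
    ccv2 (cur _ S) (cur _ f) -> (forall x y, cur _ S x y -> 0 <= cur _ f x y <= M) ->
    (resistance S f = (\int[mu2]_z (density S f \_ (core S `\` N)) z)%:E)%E.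
  move=> mf cf fM; rewrite (resistance_core S f M)//.
  have tf := dsub _ mf.
  have mff : measurable_fun (core S) (fun y => (density S f y)%:E).
    by apply/measurable_EFinP.
  rewrite /Rintegral fineK; last first.
    exact: (integrable_fin_num measurableT (tame_integrable _ tf)).
  have pos y : core S y -> (0 <= (density S f y)%:E)%E.
    by rewrite lee_fin; case/andP: (slope_density_bound (grad1 S f y) (grad2 S f y)) => /ltW.
  rewrite (@ge0_negligible_integral _ _ R mu2 (core S) N (fun y => (density S f y)%:E)
    mN mO mff pos N0).
  rewrite [LHS]integral_mkcond; apply: eq_integral => y _ /=.
  by rewrite !patchE; case: ifPn.
move: le; rewrite (resE u)// (resE w)// lee_fin => le.
have -> : (fun y => density S u y - density S w y) \_ (core S `\` N) =
    (fun y => (density S u \_ (core S `\` N)) y - (density S w \_ (core S `\` N)) y).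
  by apply/funext => y; rewrite !patchE; case: ifPn => //; rewrite subr0.
rewrite RintegralB ?subr_le0//; exact: tame_integrable.
Qed.

End Tame.

(** * Integrals of slope differences along one slice *)

Section SliceIntegrals.
Context {R : realType}.
Local Notation mu := (@lebesgue_measure R).

Lemma Rintegral_ge2 (k f1 f2 : R -> R) (D1 D2 E : set R) :
  mu.-integrable setT (EFin \o k) -> measurable D1 -> measurable D2 ->
  mu.-integrable D1 (EFin \o f1) -> mu.-integrable D2 (EFin \o f2) ->
  measurable E -> mu E = 0%E ->
  (forall x, ~ E x -> (f1 \_ D1) x + (f2 \_ D2) x <= k x) ->
  \int[mu]_(x in D1) f1 x + \int[mu]_(x in D2) f2 x <= \int[mu]_x k x.
Proof.
move=> ik mD1 mD2 i1 i2 mE E0 h.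
have r1 : mu.-integrable setT (EFin \o (f1 \_ D1)).
  rewrite (_ : _ \o _ = (EFin \o f1) \_ D1); first exact: ((@integrable_mkcond _ _ R mu D1 (EFin \o f1) mD1).1 i1).
  by apply/funext => x; rewrite /= !patchE; case: ifP.
have r2 : mu.-integrable setT (EFin \o (f2 \_ D2)).
  rewrite (_ : _ \o _ = (EFin \o f2) \_ D2); first exact: ((@integrable_mkcond _ _ R mu D2 (EFin \o f2) mD2).1 i2).
  by apply/funext => x; rewrite /= !patchE; case: ifP.
rewrite [X in X + _]Rintegral_mkcond [X in _ + X]Rintegral_mkcond -RintegralD//.
rewrite -lee_fin [X in (_ <= X)%E](_ : _ = \int[mu]_z (k z)%:E)%E; last first.
  by rewrite /Rintegral fineK//; exact: (integrable_fin_num measurableT ik).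
apply: (le_integral_ae _ _ mu _ _ E) => //.
rewrite (_ : _ \o _ = (EFin \o (f1 \_ D1)) \+ (EFin \o (f2 \_ D2)))%E; last first.
  by apply/funext => x.
exact: integrableD.
Qed.

Lemma Rintegral_itv_cst (a b c : R) : a <= b -> \int[mu]_(x in `[a, b]) c = c * (b - a).
Proof.
move=> ab; rewrite Rintegral_cst//= lebesgue_measure_itv /= lte_fin.
case: ltgtP ab => [ab _|//|-> _]; first by rewrite -EFinD.
by rewrite subrr.
Qed.

Lemma integrable_itv_cst (a b c : R) : mu.-integrable `[a, b] (EFin \o (fun=> c)).
Proof. by apply: (slope_integrable (fun x => c * x)) => x y _ _; lra. Qed.

Section AffineSlopes.
Variables (phi chi p q : R -> R) (a b al be : R).
Hypothesis ab : a <= b.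
Hypothesis hp : forall x y, a <= x <= b -> a <= y <= b -> phi y <= phi x + p x * (y - x).
Hypothesis hq : forall x y, a <= x <= b -> a <= y <= b -> chi y <= chi x + q x * (y - x).

Lemma integrable_slope_diff :
  mu.-integrable `[a, b] (EFin \o (fun x => al * (p x - q x) + be)).
Proof.
have ip := slope_integrable _ _ _ _ hp; have iq := slope_integrable _ _ _ _ hq.
rewrite (_ : _ \o _ = (fun x => (al%:E * ((p x)%:E - (q x)%:E)))
   \+ (EFin \o (fun=> be)))%E; last by apply/funext => x /=; rewrite EFinD EFinM EFinB.
apply: integrableD => //; last exact: integrable_itv_cst.
by apply: integrableZl => //; exact: integrableB.
Qed.

Lemma Rintegral_slope_diff : \int[mu]_(x in `[a, b]) (al * (p x - q x) + be) =
  al * ((phi b - chi b) - (phi a - chi a)) + be * (b - a).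
Proof.
have ip := slope_integrable _ _ _ _ hp; have iq := slope_integrable _ _ _ _ hq.
have ipq : mu.-integrable `[a, b] (EFin \o (fun x => p x - q x)).
  rewrite (_ : _ \o _ = (EFin \o p) \- (EFin \o q))%E; first exact: integrableB.
  by apply/funext.
rewrite RintegralD//; last 2 first.
- rewrite (_ : _ \o _ = (fun x => al%:E * (p x - q x)%R%:E)%E); last first.
    by apply/funext => x /=; rewrite EFinM.
  exact: integrableZl.
- exact: integrable_itv_cst.
rewrite RintegralZl// RintegralB// Rintegral_itv_cst//.
rewrite (Rintegral_slope phi p)// (Rintegral_slope chi q)//.
by congr (_ + _); congr (_ * _); ring.
Qed.

End AffineSlopes.

(** The slope difference [p - q] integrates to 0 over [[r1, r2]], so a common coefficient would give
    nothing. With [a1] before [r0] and [a2] after it the integral is [a1 - a2] times the gap between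
    the two functions at [r0]. *)
Lemma slice_cut (k phi chi p q : R -> R) (E : set R) (r1 r0 r2 a1 a2 be : R) :
  mu.-integrable setT (EFin \o k) -> measurable E -> mu E = 0%E ->
  r1 <= r0 <= r2 ->
  (forall x y, r1 <= x <= r2 -> r1 <= y <= r2 -> phi y <= phi x + p x * (y - x)) ->
  (forall x y, r1 <= x <= r2 -> r1 <= y <= r2 -> chi y <= chi x + q x * (y - x)) ->
  phi r1 = chi r1 -> phi r2 = chi r2 ->
  (forall r, ~ E r -> ~~ (r1 <= r <= r2) -> 0 <= k r) ->
  (forall r, ~ E r -> r1 <= r <= r0 -> a1 * (p r - q r) - be <= k r) ->
  (forall r, ~ E r -> r0 <= r <= r2 -> a2 * (p r - q r) - be <= k r) ->
  (a1 - a2) * (phi r0 - chi r0) - be * (r2 - r1) <= \int[mu]_x k x.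
Proof.
move=> ik mE E0 /andP[r10 r02] hp hq e1 e2 k0 k1 k2.
have hp1 x y : r1 <= x <= r0 -> r1 <= y <= r0 -> phi y <= phi x + p x * (y - x).
  by move=> *; apply: hp; lra.
have hq1 x y : r1 <= x <= r0 -> r1 <= y <= r0 -> chi y <= chi x + q x * (y - x).
  by move=> *; apply: hq; lra.
have hp2 x y : r0 <= x <= r2 -> r0 <= y <= r2 -> phi y <= phi x + p x * (y - x).
  by move=> *; apply: hp; lra.
have hq2 x y : r0 <= x <= r2 -> r0 <= y <= r2 -> chi y <= chi x + q x * (y - x).
  by move=> *; apply: hq; lra.
have := @Rintegral_ge2 k (fun x => a1 * (p x - q x) + - be) (fun x => a2 * (p x - q x) + - be)
  `[r1, r0] `[r0, r2] (E `|` [set r0]) ik.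
rewrite (Rintegral_slope_diff phi chi)// (Rintegral_slope_diff phi chi)// e1 e2.
move=> H; apply: le_trans (H _ _ _ _ _ _ _) => //.
- by rewrite le_eqVlt; apply/orP; left; apply/eqP; ring.
- exact: (integrable_slope_diff phi chi).
- exact: (integrable_slope_diff phi chi).
- by apply: measurableU => //; exact: measurable_set1.
- apply/eqP; rewrite eq_le measure_ge0 andbT.
  have U : (mu (E `|` [set r0]) <= mu E + mu [set r0])%E.
    by apply: measureU2 => //; exact: measurable_set1.
  by apply: (le_trans U); rewrite E0 lebesgue_measure_set1 adde0.
move=> x nE'; have nE : ~ E x by move=> ?; apply: nE'; left.
have xr0 : x != r0 by apply/eqP => ?; apply: nE'; right.
rewrite !patchE !mem_setE !in_itv /=.
have [c1|c1] := boolP (r1 <= x <= r0).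
  have -> : (r0 <= x <= r2) = false.
    by apply/negbTE/negP => c2; move/eqP: xr0; apply; lra.
  by rewrite addr0; exact: k1.
have [c2|c2] := boolP (r0 <= x <= r2); first by rewrite add0r; exact: k2.
rewrite addr0; apply: k0 => //; apply/negP => c3.
by case/orP: (le_total x r0) => h; [move/negP: c1|move/negP: c2]; apply; lra.
Qed.

(** The slopes are controlled only in the open interval, where the gap between the two functions
    vanishes linearly at both ends. The interval is shrunk by [t] at each end, and [- C <= k] is
    used on the two strips left over. *)
Lemma slice_balance (k phi chi p q : R -> R) (E : set R) (al be C c : R) :
  mu.-integrable setT (EFin \o k) -> measurable E -> mu E = 0%E ->
  al < be -> 0 <= C -> 0 <= c ->
  (forall x y, al < x < be -> al < y < be -> phi y <= phi x + p x * (y - x)) ->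
  (forall x y, al < x < be -> al < y < be -> chi y <= chi x + q x * (y - x)) ->
  (forall x, al < x < be -> `|phi x - chi x| <= c * (x - al)) ->
  (forall x, al < x < be -> `|phi x - chi x| <= c * (be - x)) ->
  (forall r, ~ E r -> ~~ (al < r < be) -> 0 <= k r) ->
  (forall r, ~ E r -> al < r < be -> k r = p r - q r /\ - C <= k r) ->
  0 <= \int[mu]_x k x.
Proof.
move=> ik mE E0 ab C0 c0 hp hq h1 h2 kout kin.
apply/ler_addgt0Pr => e e0.
pose t := Num.min ((be - al) / 3) (e / (2 * C + 2 * c + 1)).
have D0 : 0 < 2 * C + 2 * c + 1 by lra.
have t0 : 0 < t by rewrite lt_min !divr_gt0//; lra.
have t1 : t <= (be - al) / 3 by rewrite /t ge_min lexx.
have t2 : t * (2 * C + 2 * c + 1) <= e.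
  by rewrite -ler_pdivlMr// /t ge_min lexx orbT.
have hp' x y : al + t <= x <= be - t -> al + t <= y <= be - t ->
  phi y <= phi x + p x * (y - x) by move=> *; apply: hp; lra.
have hq' x y : al + t <= x <= be - t -> al + t <= y <= be - t ->
  chi y <= chi x + q x * (y - x) by move=> *; apply: hq; lra.
have ab' : al + t <= be - t by lra.
(* The constant [- C] on the whole interval is compensated by [+ C] on the shrunk one: the sum is
   [k] inside and [- C] on the strips. *)
have := @Rintegral_ge2 k (fun x => 1 * (p x - q x) + C) (fun x => - C)
  `[al + t, be - t] `[al, be] (E `|` [set al; be]) ik.
rewrite (Rintegral_slope_diff phi chi)// Rintegral_itv_cst ?(ltW ab)// => H.
have {}H : 1 * (phi (be - t) - chi (be - t) - (phi (al + t) - chi (al + t))) +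
    C * (be - t - (al + t)) + - C * (be - al) <= \int[mu]_x k x.
  apply: H => //.
  - exact: (integrable_slope_diff phi chi).
  - exact: integrable_itv_cst.
  - by apply: measurableU => //; apply: measurableU; exact: measurable_set1.
  - apply/eqP; rewrite eq_le measure_ge0 andbT.
    have m2 : measurable [set al; be] by apply: measurableU; exact: measurable_set1.
    have U : (mu (E `|` [set al; be]) <= mu E + mu [set al; be])%E by exact: measureU2.
    apply: (le_trans U); rewrite E0 add0e.
    have U2 : (mu [set al; be] <= mu [set al] + mu [set be])%E.
      by apply: measureU2; exact: measurable_set1.
    by apply: (le_trans U2); rewrite !lebesgue_measure_set1 adde0.
  move=> x nE'; have nE : ~ E x by move=> ?; apply: nE'; left.
  have xa : x <> al by move=> ?; apply: nE'; right; left.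
  have xb : x <> be by move=> ?; apply: nE'; right; right.
  rewrite !patchE !mem_setE !in_itv /= mul1r.
  have [i|i] := boolP (al <= x <= be); last first.
    have -> : (al + t <= x <= be - t) = false.
      by apply/negbTE/negP => j; move/negP: i; apply; lra.
    rewrite addr0; apply: kout => //; apply/negP => j; move/negP: i; apply; lra.
  have i' : al < x < be.
    by case/andP: i => i1 i2; rewrite !lt_def i1 i2 !andbT; apply/andP; split;
      apply/eqP => // /esym.
  have [<- lo] := kin x nE i'.
  case: ifP => _; first lra.
  by rewrite (_ : point = 0 :> R)// add0r.
have i1 : al < be - t < be by lra.
have i2 : al < al + t < be by lra.
have := h2 _ i1; have := h1 _ i2; rewrite !ler_norml => /andP[j1 j2] /andP[j3 j4].
have E1 : c * (al + t - al) = c * t by ring.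
have E2 : c * (be - (be - t)) = c * t by ring.
rewrite E1 in j1 j2; rewrite E2 in j3 j4.
have E3 : C * (be - t - (al + t)) + - C * (be - al) = - (2 * (t * C)) by ring.
rewrite mul1r -addrA E3 in H.
have E4 : t * (2 * C + 2 * c + 1) = 2 * (t * C) + 2 * (c * t) + t by ring.
rewrite E4 in t2; lra.
Qed.

End SliceIntegrals.

(** * Cutting along the edge *)

Section Lorentz.
Context {R : realType}.

Lemma slope_density_lipschitz (c X Y e : R) : 0 <= X -> c = 1 + e ^+ 2 ->
  `|(1 + Y ^+ 2 + X)^-1 - (c + X)^-1| <= `|Y ^+ 2 - e ^+ 2|.
Proof.
move=> X0 ->; have Y0 := sqr_ge0 Y; have e0 := sqr_ge0 e.
have h1 : 0 < 1 + Y ^+ 2 + X by lra.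
have h2 : 0 < 1 + e ^+ 2 + X by lra.
have -> : (1 + Y ^+ 2 + X)^-1 - (1 + e ^+ 2 + X)^-1 =
    (e ^+ 2 - Y ^+ 2) / ((1 + Y ^+ 2 + X) * (1 + e ^+ 2 + X)).
  by field; rewrite !gt_eqF.
rewrite normrM normfV distrC ler_piMr// (gtr0_norm (mulr_gt0 h1 h2)).
rewrite invf_le1 ?mulr_gt0//; nra.
Qed.

Lemma lorentz_tangent (T T0 : R) :
  (1 + T ^+ 2)^-1 = (1 + T0 ^+ 2)^-1 - 2 * T0 * (T - T0) / (1 + T0 ^+ 2) ^+ 2 +
    (T - T0) ^+ 2 * (2 * T0 * T + T0 ^+ 2 - 1) / ((1 + T ^+ 2) * (1 + T0 ^+ 2) ^+ 2).
Proof.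
have h1 : 0 < 1 + T ^+ 2 by have := sqr_ge0 T; lra.
have h2 : 0 < 1 + T0 ^+ 2 by have := sqr_ge0 T0; lra.
by field; rewrite !gt_eqF.
Qed.

Lemma lorentz_growth (T0 T1 T2 : R) : T2 < T0 < T1 ->
  0 < 2 * T0 * T1 + T0 ^+ 2 - 1 -> 0 < 2 * T0 * T2 + T0 ^+ 2 - 1 ->
  exists c eps : R, [/\ 0 < c, 0 < eps & forall T, T2 - eps <= T <= T1 + eps ->
    (1 + T0 ^+ 2)^-1 - 2 * T0 * (T - T0) / (1 + T0 ^+ 2) ^+ 2 + c * (T - T0) ^+ 2 <=
    (1 + T ^+ 2)^-1].
Proof.
move=> T210 h1 h2.
(* The factor [2 * T0 * T + T0 ^+ 2 - 1] is affine in [T], so [m] is its minimum over [[T2, T1]];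
   [eps] is chosen so that at least [m / 2] remains on the larger interval. *)
pose m := Num.min (2 * T0 * T1 + T0 ^+ 2 - 1) (2 * T0 * T2 + T0 ^+ 2 - 1).
have m0 : 0 < m by rewrite lt_min h1.
have m1 : m <= 2 * T0 * T1 + T0 ^+ 2 - 1 by rewrite ge_min lexx.
have m2 : m <= 2 * T0 * T2 + T0 ^+ 2 - 1 by rewrite ge_min lexx orbT.
have a0 : 0 < 1 + 4 * `|T0| by have := normr_ge0 T0; lra.
pose eps := Num.min 1 (m / (1 + 4 * `|T0|)).
have e0 : 0 < eps by rewrite lt_min ltr01 divr_gt0.
have e1 : eps <= 1 by rewrite ge_min lexx.
have e2 : eps * (1 + 4 * `|T0|) <= m.
  by rewrite -ler_pdivlMr// ge_min lexx orbT.
pose Q := 1 + (`|T1| + `|T2| + 1) ^+ 2.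
have Q0 : 0 < Q by rewrite /Q; have := sqr_ge0 (`|T1| + `|T2| + 1); lra.
have s0 : 0 < 1 + T0 ^+ 2 by have := sqr_ge0 T0; lra.
have s2 : 0 < (1 + T0 ^+ 2) ^+ 2 by rewrite exprn_gt0.
exists (m / 2 / (Q * (1 + T0 ^+ 2) ^+ 2)), eps; split => //.
  by rewrite !divr_gt0// mulr_gt0.
move=> T /andP[Tl Tu].
have sT : 0 < 1 + T ^+ 2 by have := sqr_ge0 T; lra.
rewrite [leRHS](lorentz_tangent T T0) lerD2l [leLHS]mulrC -[leRHS]mulrA.
apply: ler_wpM2l; first exact: sqr_ge0.
have lin : m / 2 <= 2 * T0 * T + T0 ^+ 2 - 1.
  have n0 : 0 <= `|T0| by [].
  have en : 2 * (eps * `|T0|) <= m / 2 by nra.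
  case: (lerP 0 T0) => T0s.
  - rewrite (ger0_norm T0s) in en; nra.
  - rewrite (ltr0_norm T0s) in en; nra.
have TQ : 1 + T ^+ 2 <= Q.
  have Tn : `|T| <= `|T1| + `|T2| + 1.
    have := ler_norm T1; have := ler_norm (- T2); rewrite normrN.
    have := ler_norm T2; have := ler_norm (- T1); rewrite normrN.
    have := normr_ge0 T1; have := normr_ge0 T2.
    by rewrite ler_norml => *; lra.
  have S0 : 0 <= `|T1| + `|T2| + 1 by apply: le_trans Tn.
  by rewrite /Q lerD2l -[leLHS]real_normK ?num_real// ler_pXn2r// nnegrE.
apply: ler_pM => //.
- by rewrite divr_ge0// ltW.
- by rewrite invr_ge0 mulr_ge0// ltW.
- by rewrite lef_pV2 ?posrE ?mulr_gt0// ler_pM2r.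
Qed.

(* In the orthonormal frame [d = (n2, - n1)], [n = (n1, n2)] the gradients of the
   planes through the edge are [e d + kappa T n]. *)
Lemma slope_density_growth (n1 n2 e kappa T0 T1 T2 : R) :
  n1 ^+ 2 + n2 ^+ 2 = 1 -> n2 != 0 -> 0 < kappa -> kappa ^+ 2 = 1 + e ^+ 2 ->
  T2 < T0 < T1 ->
  0 < 2 * T0 * T1 + T0 ^+ 2 - 1 -> 0 < 2 * T0 * T2 + T0 ^+ 2 - 1 ->
  let q1 := e * n2 + kappa * T0 * n1 in let q2 := - e * n1 + kappa * T0 * n2 in
  exists A c C eps0 : R, [/\ 0 < c, 0 <= C, 0 < eps0 & forall eps G1 G2,
    0 < eps <= eps0 ->
    `|G1 * n2 - G2 * n1 - e| <= eps ->
    kappa * T2 - eps <= G1 * n1 + G2 * n2 <= kappa * T1 + eps ->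
    slope_density q1 q2 + A * (G2 - q2) + c * (G2 - q2) ^+ 2 - C * eps <=
      slope_density G1 G2].
Proof.
move=> nn n20 k0 kE T210 h1 h2 q1 q2.
have [c2 [e2 [c20 e20 hg]]] := lorentz_growth _ _ _ T210 h1 h2.
have s0 : 0 < 1 + T0 ^+ 2 by have := sqr_ge0 T0; lra.
pose B := - (2 * T0) / (kappa ^+ 3 * (1 + T0 ^+ 2) ^+ 2).
pose c := c2 / kappa ^+ 4.
have c0 : 0 < c by rewrite divr_gt0// exprn_gt0.
(* Slices control only the second component [G2]. Near the segment of gradients the two components
   are tied together, and the slope along [n] turns into a slope in [G2] after division by [n2]. *)
pose A := B / n2.
pose C := `|A| + c + (2 * `|e| + 1).
exists A, (c / 2), C, (Num.min 1 (kappa * e2)); split.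
- by rewrite divr_gt0.
- by rewrite /C; have := normr_ge0 A; have := normr_ge0 e; lra.
- by rewrite lt_min ltr01 mulr_gt0.
move=> eps G1 G2 /andP[eps0]; rewrite le_min => /andP[eps1 epsk].
set Y := G1 * n2 - G2 * n1; set X := G1 * n1 + G2 * n2 => hY hX.
have GE : G1 ^+ 2 + G2 ^+ 2 = Y ^+ 2 + X ^+ 2.
  transitivity ((G1 ^+ 2 + G2 ^+ 2) * (n1 ^+ 2 + n2 ^+ 2)); first by rewrite nn mulr1.
  by rewrite /X /Y; ring.
have qE : q1 ^+ 2 + q2 ^+ 2 = e ^+ 2 + (kappa * T0) ^+ 2.
  transitivity ((e ^+ 2 + (kappa * T0) ^+ 2) * (n1 ^+ 2 + n2 ^+ 2)); last by rewrite nn mulr1.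
  by rewrite /q1 /q2; ring.
have G2E : G2 - q2 = - (Y - e) * n1 + (X - kappa * T0) * n2.
  transitivity (G2 * (n1 ^+ 2 + n2 ^+ 2) - q2); first by rewrite nn mulr1.
  by rewrite /X /Y /q2; ring.
pose T := X / kappa.
have XE : X = kappa * T by rewrite /T mulrC divfK// gt_eqF.
have T_in : T2 - e2 <= T <= T1 + e2.
  by move: hX; rewrite XE => /andP[x1 x2]; apply/andP; split;
    rewrite -(ler_pM2l k0) ?mulrBr ?mulrDr; lra.
have fG : (kappa ^+ 2)^-1 * (1 + T ^+ 2)^-1 - (2 * `|e| + 1) * eps <= slope_density G1 G2.
  have := @slope_density_lipschitz (1 + e ^+ 2) (X ^+ 2) Y e (sqr_ge0 X) erefl.
  have -> : slope_density G1 G2 = (1 + Y ^+ 2 + X ^+ 2)^-1.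
    by rewrite /slope_density -addrA GE addrA.
  have -> : (1 + e ^+ 2 + X ^+ 2)^-1 = (kappa ^+ 2)^-1 * (1 + T ^+ 2)^-1.
    by rewrite -invfM mulrDr mulr1 -kE XE exprMn.
  have : `|Y ^+ 2 - e ^+ 2| <= (2 * `|e| + 1) * eps.
    rewrite subr_sqr normrM mulrC ler_pM//.
    have -> : Y + e = (Y - e) + (e + e) by ring.
    apply: le_trans (ler_normD _ _) _; have := ler_normD e e; lra.
  by move=> a1 /le_trans /(_ a1); rewrite ler_norml; lra.
apply: le_trans fG.
have := hg T T_in; rewrite -(@ler_pM2l _ (kappa ^+ 2)^-1) ?invr_gt0 ?exprn_gt0//.
have fq : slope_density q1 q2 = (kappa ^+ 2)^-1 * (1 + T0 ^+ 2)^-1.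
  by rewrite /slope_density -addrA qE addrA -kE -invfM mulrDr mulr1 exprMn.
set z := X - kappa * T0.
have zE : T - T0 = z / kappa by rewrite /z XE; field; rewrite gt_eqF.
have -> : (kappa ^+ 2)^-1 * ((1 + T0 ^+ 2)^-1 - 2 * T0 * (T - T0) / (1 + T0 ^+ 2) ^+ 2 +
    c2 * (T - T0) ^+ 2) = slope_density q1 q2 + B * z + c * z ^+ 2.
  by rewrite fq zE /B /c; field; rewrite !gt_eqF.
move=> hle.
suff : A * (G2 - q2) + c / 2 * (G2 - q2) ^+ 2 - (`|A| + c) * eps <= B * z + c * z ^+ 2.
  by rewrite /C; lra.
have n1le : `|n1| <= 1.
  by rewrite -(@ler_pXn2r _ 2) ?nnegrE// expr1n real_normK ?num_real//; have := sqr_ge0 n2; lra.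
have n2le : n2 ^+ 2 <= 1 by have := sqr_ge0 n1; lra.
set y := (Y - e) * n1.
have yle : `|y| <= eps by rewrite /y normrM -[eps]mulr1 ler_pM.
have -> : G2 - q2 = n2 * z - y by rewrite G2E -/z /y; ring.
have lin : A * (n2 * z - y) <= B * z + `|A| * eps.
  have -> : A * (n2 * z - y) = B * z - A * y by rewrite /A; field.
  rewrite lerD2l; apply: le_trans (ler_norm _) _; rewrite normrN normrM ler_wpM2l//.
have quad : c / 2 * (n2 * z - y) ^+ 2 <= c * z ^+ 2 + c * eps.
  have y2 : y ^+ 2 <= eps.
    by rewrite -real_normK ?num_real// expr2 -[leRHS]mul1r ler_pM// (le_trans yle).
  have z2 : (n2 * z) ^+ 2 <= z ^+ 2 by rewrite exprMn -[leRHS]mul1r ler_wpM2r ?sqr_ge0.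
  have : (n2 * z - y) ^+ 2 <= 2 * (z ^+ 2 + eps).
    have := sqr_ge0 (n2 * z + y).
    have -> : (n2 * z + y) ^+ 2 = 2 * (n2 * z) ^+ 2 + 2 * y ^+ 2 - (n2 * z - y) ^+ 2 by ring.
    lra.
  move=> hh; have := ler_wpM2l (ltW c0) hh; lra.
by lra.
Qed.

End Lorentz.

Section CutGeometry.
Context {R : realType}.
Variables (S : R -> R -> Prop) (U : R -> R -> R) (M a b rho B : R).
Variables (n1 n2 e kappa T0 T1 T2 : R).
Hypotheses (cS : cvx2 S) (cU : ccv2 S U).
Hypothesis UM : forall x y, S x y -> 0 <= U x y <= M.
Hypotheses (rho0 : 0 < rho) (hbox : box_in S a b rho) (U0 : 0 < U a b).
Hypothesis hB : forall x y, S x y -> `|x| <= B /\ `|y| <= B.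
Hypotheses (nn : n1 ^+ 2 + n2 ^+ 2 = 1) (n20 : n2 != 0).
Hypotheses (k0 : 0 < kappa) (T20 : T2 < T0) (T01 : T0 < T1).

Definition ridge_gx T := e * n2 + kappa * T * n1.
Definition ridge_gy T := - e * n1 + kappa * T * n2.
Local Notation gx := ridge_gx.
Local Notation gy := ridge_gy.

Hypothesis R1 : forall s r, S s r -> U s r <= U a b + gx T1 * (s - a) + gy T1 * (r - b).
Hypothesis R2 : forall s r, S s r -> U s r <= U a b + gx T2 * (s - a) + gy T2 * (r - b).
Hypothesis R3 : forall v1 v2 eps, 0 < eps -> exists2 h0, 0 < h0 &
  forall h, 0 < h -> h < h0 ->
  U a b + h * (Num.min (gx T1 * v1 + gy T1 * v2) (gx T2 * v1 + gy T2 * v2) - eps) <=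
    U (a + h * v1) (b + h * v2).

Definition cut_plane s r := U a b + gx T0 * (s - a) + gy T0 * (r - b).
Local Notation P := cut_plane.
Let nv s r := n1 * (s - a) + n2 * (r - b).
Let q1 := gx T0.
Let q2 := gy T0.
Definition cut_K := M + (`|gx T0| + `|gy T0|) * (2 * B).
Local Notation K := cut_K.
(** With the factor [t], this is the width in the second coordinate of a strip around the projected
    edge that contains the cut region. *)
Definition cut_width :=
  2 * (K / (kappa * Num.min (T0 - T2) (T1 - T0))) / `|n2|.
Local Notation W2 := cut_width.
Let W := K / (kappa * Num.min (T0 - T2) (T1 - T0)).

Definition cut_region t s r := S s r /\ (1 - t) * P s r < U s r.

Let Sab : S a b.
Proof. by apply: hbox; rewrite subrr normr0. Qed.

Let M0 : 0 < M.
Proof. by have /andP[_] := UM _ _ Sab; exact: lt_le_trans. Qed.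

Let P_le s r : S s r -> P s r <= K.
Proof.
move=> Ssr; have [x1 x2] := hB _ _ Ssr; have [y1 y2] := hB _ _ Sab.
have /andP[_ uM] := UM _ _ Sab.
have bd c z z' : `|z| <= B -> `|z'| <= B -> c * (z - z') <= `|c| * (2 * B).
  move=> hz hz'; apply: le_trans (ler_norm _) _; rewrite normrM ler_wpM2l//.
  by apply: le_trans (ler_normB _ _) _; lra.
have := bd (gx T0) _ _ x1 y1; have := bd (gy T0) _ _ x2 y2.
by rewrite /cut_plane /cut_K mulrDl; lra.
Qed.

Let K0 : 0 < K.
Proof.
apply: lt_le_trans (P_le _ _ Sab).
by rewrite /cut_plane !subrr !mulr0 !addr0.
Qed.

Let m0 : 0 < Num.min (T0 - T2) (T1 - T0).
Proof. by rewrite lt_min !subr_gt0 T20. Qed.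

Let W0 : 0 < W. Proof. by rewrite /W divr_gt0// mulr_gt0. Qed.

Lemma cut_width_gt0 : 0 < W2.
Proof. by apply: divr_gt0; [exact: mulr_gt0|rewrite normr_gt0]. Qed.

Let P_minus T s r : P s r - (U a b + gx T * (s - a) + gy T * (r - b)) =
  kappa * ((T0 - T) * nv s r).
Proof. by rewrite /cut_plane /ridge_gx /ridge_gy /nv; ring. Qed.

Let gap1 s r : S s r -> kappa * ((T0 - T1) * nv s r) <= P s r - U s r.
Proof. by move=> /R1; have := P_minus T1 s r; lra. Qed.

Let gap2 s r : S s r -> kappa * ((T0 - T2) * nv s r) <= P s r - U s r.
Proof. by move=> /R2; have := P_minus T2 s r; lra. Qed.

Lemma cut_plane_ge s r : S s r -> U s r <= P s r.
Proof.
move=> Ssr; rewrite -subr_ge0; have [nv0|nv0] := lerP 0 (nv s r).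
- by apply: le_trans (gap2 _ _ Ssr); rewrite mulr_ge0 ?mulr_ge0 ?subr_ge0 ?(ltW T20)// ltW.
- apply: le_trans (gap1 _ _ Ssr); rewrite mulr_ge0 ?(ltW k0)//.
  by rewrite mulr_le0 ?subr_le0 ?(ltW T01)// ltW.
Qed.

(** In the region [P - U] is less than [t * K], whereas the face on the side of the point forces it
    to be at least a multiple of the distance from the projected edge. *)
Lemma cut_region_narrow t s r : 0 < t -> cut_region t s r -> `|nv s r| < t * W.
Proof.
move=> t0 [Ssr lt].
have lt' : P s r - U s r < t * K.
  by have := ler_wpM2l (ltW t0) (P_le _ _ Ssr); lra.
have ml : Num.min (T0 - T2) (T1 - T0) <= T0 - T2 by rewrite ge_min lexx.
have mr : Num.min (T0 - T2) (T1 - T0) <= T1 - T0 by rewrite ge_min lexx orbT.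
rewrite /W mulrA ltr_pdivlMr ?mulr_gt0//; apply: le_lt_trans lt'.
rewrite mulrCA; have [nv0|nv0] := lerP 0 (nv s r).
- rewrite ger0_norm//; apply: le_trans (gap2 _ _ Ssr); rewrite ler_pM2l//.
  by rewrite mulrC ler_wpM2r.
- rewrite ltr0_norm//; apply: le_trans (gap1 _ _ Ssr); rewrite ler_pM2l//.
  rewrite mulrC -[leRHS]mulrNN ler_wpM2r ?oppr_ge0 ?(ltW nv0)//; lra.
Qed.

Definition ridge_line s := b - n1 / n2 * (s - a).

Let nvE s r : nv s r = n2 * (r - ridge_line s).
Proof. by rewrite /nv /ridge_line; field. Qed.

Lemma cut_region_near_line t s r : 0 < t -> cut_region t s r ->
  `|r - ridge_line s| < t * W2 / 2.
Proof.
move=> t0 /(cut_region_narrow _ _ _ t0).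
have n0 : 0 < `|n2| by rewrite normr_gt0.
have -> : t * W2 / 2 = t * W / `|n2| by rewrite /cut_width -/W; field; rewrite normr_eq0.
by rewrite nvE normrM ltr_pdivlMr// mulrC.
Qed.

Lemma cut_region_cvx t : cvx2 (cut_region t).
Proof.
move=> s r s' r' l l01 [h1 h2] [h3 h4]; split; first exact: cS.
apply: lt_le_trans (cU _ _ _ _ _ l01 h1 h3).
have -> : (1 - t) * P (l * s + (1 - l) * s') (l * r + (1 - l) * r') =
  l * ((1 - t) * P s r) + (1 - l) * ((1 - t) * P s' r') by rewrite /cut_plane; ring.
have /andP[l0 l1] := l01; have [->|ln0] := eqVneq l 0; first by rewrite !mul0r !add0r subr0 !mul1r.
apply: ltr_leD; first by rewrite ltr_pM2l// lt_def ln0.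
by rewrite ler_wpM2l ?subr_ge0// ltW.
Qed.

Let near_edge t delta sg ta s r : 0 < t -> 0 < delta < 1 -> cut_region t sg ta ->
  s = delta * a + (1 - delta) * sg -> `|nv s r| <= t * W ->
  `|r - (delta * b + (1 - delta) * ta)| <= t * W2.
Proof.
move=> t0 /andP[d0 d1] cr -> hs.
have h2 := cut_region_narrow _ _ _ t0 cr.
have n0 : 0 < `|n2| by rewrite normr_gt0.
rewrite /cut_width -/W mulrA ler_pdivlMr// -normrM.
have -> : (r - (delta * b + (1 - delta) * ta)) * n2 =
  nv (delta * a + (1 - delta) * sg) r - (1 - delta) * nv sg ta by rewrite /nv; ring.
apply: le_trans (ler_normB _ _) _.
rewrite normrM (gtr0_norm (_ : 0 < 1 - delta)) ?subr_gt0//.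
have : (1 - delta) * `|nv sg ta| <= `|nv sg ta|.
  by rewrite ler_piMl//; lra.
lra.
Qed.

(** The homothety of ratio [delta] centred at a region point carries the box of radius [rho] around
    the apex to one of radius [delta * rho], which is wider than the strip when [t] is small. So,
    away from the ends of the cut, the whole strip is interior to [S]. *)
Lemma cut_region_inner t delta sg ta s r : 0 < t -> 0 < delta < 1 ->
  t * W2 < delta * rho -> cut_region t sg ta ->
  s = delta * a + (1 - delta) * sg -> `|nv s r| <= t * W -> inner S s r.
Proof.
move=> t0 d01 small cr sE hs.
have h := near_edge _ _ _ _ _ _ t0 d01 cr sE hs.
have d01' : 0 < delta <= 1 by case/andP: d01 => -> /ltW.
have hb := box_conv _ _ _ _ _ _ _ cS d01' hbox cr.1; rewrite -sE in hb.
set r' := _ * b + _ in h hb.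
exists (delta * rho - t * W2); first by rewrite subr_gt0.
have w0 := mulr_gt0 t0 cut_width_gt0.
move=> x y hx hy; apply: hb; first by lra.
have := ler_normD (y - r) (r - r'); rewrite addrA subrK; lra.
Qed.

Lemma cut_region_inner_line t delta sg ta s r : 0 < t -> 0 < delta < 1 ->
  t * W2 < delta * rho -> cut_region t sg ta ->
  s = delta * a + (1 - delta) * sg -> `|r - ridge_line s| <= t * W2 / 2 -> inner S s r.
Proof.
move=> t0 d01 small cr sE h; apply: (cut_region_inner _ _ _ _ _ _ t0 d01 small cr sE).
have n0 : 0 < `|n2| by rewrite normr_gt0.
have -> : t * W = `|n2| * (t * W2 / 2) by rewrite /cut_width -/W; field; rewrite normr_eq0.
by rewrite nvE normrM ler_pM2l.
Qed.

(** Up to an error of order [t], the point [(s, r)] combines the apex [(a, b)], with weight [delta],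
    and a region point. When the apex moves by [h] along [(v1, v2)], the bound [R3] and concavity
    bound [U] from below at [(s, r)] moved by [delta * h]. Since [U <= P] at [(s, r)], this bounds
    the increment there, hence the supergradient. The step [h] depends on [eps] only, so the error
    of order [t / (delta * h)] is small with [t]. *)
Let direction v1 v2 delta eps : 0 < delta < 1 -> 0 < eps ->
  exists2 t0, 0 < t0 & forall t, 0 < t -> t < t0 ->
  forall sg ta s r G1 G2, cut_region t sg ta -> s = delta * a + (1 - delta) * sg ->
  cut_region t s r -> sgrad S U s r G1 G2 ->
  Num.min (gx T1 * v1 + gy T1 * v2) (gx T2 * v1 + gy T2 * v2) - eps <= G1 * v1 + G2 * v2.
Proof.
move=> d01 eps0; have /andP[d0 d1] := d01.
set mv := Num.min _ _.
have [h0 h00 hh] := R3 v1 v2 _ (divr_gt0 eps0 (ltr0Sn _ 1)).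
have D0 : 0 < 2 * (1 + `|v1| + `|v2|) by have := normr_ge0 v1; have := normr_ge0 v2; lra.
pose h := Num.min h0 (rho / (2 * (1 + `|v1| + `|v2|))) / 2.
have mn0 : 0 < Num.min h0 (rho / (2 * (1 + `|v1| + `|v2|))) by rewrite lt_min h00 divr_gt0.
have h_gt0 : 0 < h by rewrite divr_gt0.
have mnl : Num.min h0 (rho / (2 * (1 + `|v1| + `|v2|))) <= h0 by rewrite ge_min lexx.
have mnr : Num.min h0 (rho / (2 * (1 + `|v1| + `|v2|))) <= rho / (2 * (1 + `|v1| + `|v2|)).
  by rewrite ge_min lexx orbT.
have hlt : h < h0 by rewrite /h; lra.
have hr : h * (1 + `|v1| + `|v2|) <= rho / 2.
  have : 2 * h <= rho / (2 * (1 + `|v1| + `|v2|)) by rewrite /h; lra.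
  by rewrite ler_pdivlMr//; have := rho0; nra.
have hv1 : `|h * v1| <= rho / 2.
  rewrite normrM gtr0_norm//; have := normr_ge0 v2; have := normr_ge0 v1; nra.
have hv2 : `|h * v2| <= rho / 2.
  rewrite normrM gtr0_norm//; have := normr_ge0 v2; have := normr_ge0 v1; nra.
have w0 := cut_width_gt0.
(* The three terms stem from the lowering of [P] to [(1 - t) * P], from the variation of [P] between
   [r] and [r'], and from the loss in [ccv2_lower] when the moved apex is shifted by [e']. *)
pose C := K + `|q2| * W2 + 4 * M * W2 / rho.
have C0 : 0 < C.
  have : 0 < 4 * M * W2 / rho.
    by apply: divr_gt0 => //; apply: mulr_gt0 => //; exact: mulr_gt0.
  have : 0 <= `|q2| * W2 by rewrite mulr_ge0// ltW.
  by rewrite /C; have := K0; lra.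
pose t0 := Num.min (delta * rho / (4 * W2)) (delta * h * eps / (2 * C)).
exists t0.
  by rewrite lt_min; apply/andP; split; apply: divr_gt0 => //; do ?apply: mulr_gt0 => //.
have p1 : 0 < 4 * W2 by rewrite mulr_gt0.
have p2 : 0 < 2 * C by rewrite mulr_gt0.
move=> t tp; rewrite /t0 lt_min (ltr_pdivlMr _ _ p1) (ltr_pdivlMr _ _ p2).
move=> /andP[tl1 tl2] sg ta s r G1 G2 cr sE crs sgr.
have ne := near_edge _ _ _ _ _ _ tp d01 cr sE (ltW (cut_region_narrow _ _ _ tp crs)).
set r' := _ * b + _ in ne.
(* With this shift of the second coordinate the combination is exactly
   [(s + delta * h * v1, r + delta * h * v2)]. *)
pose e' := (r - r') / delta.
pose m := 2 * (t * W2) / delta.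
have tW := mulr_gt0 tp w0.
have mp : 0 < m by rewrite /m divr_gt0// mulr_gt0.
have ml : m <= rho / 2 by rewrite /m ler_pdivrMr//; lra.
have e'm : `|e'| < m.
  rewrite /e' normrM normfV (gtr0_norm d0) /m ltr_pM2r ?invr_gt0//.
  by apply: le_lt_trans ne _; rewrite ltr_pMl// ltr1n.
have bx : box_in S (a + h * v1) (b + h * v2) (rho / 2).
  move=> x y hx hy; apply: hbox.
  - have := ler_normD (x - (a + h * v1)) (h * v1).
    have -> : x - (a + h * v1) + h * v1 = x - a by ring.
    by move=> /le_lt_trans; apply; rewrite [ltRHS]splitr ltr_leD.
  - have := ler_normD (y - (b + h * v2)) (h * v2).
    have -> : y - (b + h * v2) + h * v2 = y - b by ring.
    by move=> /le_lt_trans; apply; rewrite [ltRHS]splitr ltr_leD.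
have mm : 0 < m <= rho / 2 by rewrite mp.
have low := ccv2_lower _ _ _ _ _ _ _ (a + h * v1) (b + h * v2 + e') cS cU UM bx mm.
have {}low := low ltac:(by rewrite subrr normr0) ltac:(by rewrite addrC addKr).
have Sz : S (a + h * v1) (b + h * v2 + e').
  apply: bx; first by rewrite subrr normr0 divr_gt0.
  by rewrite addrC addKr; exact: lt_le_trans e'm ml.
have d01' : 0 <= delta <= 1 by rewrite !ltW.
have Sy := cS _ _ _ _ _ d01' Sz cr.1.
have cc := cU _ _ _ _ _ d01' Sz cr.1.
have E1 : delta * (a + h * v1) + (1 - delta) * sg = s + delta * h * v1 by rewrite sE; ring.
have E2 : delta * (b + h * v2 + e') + (1 - delta) * ta = r + delta * h * v2.
  by rewrite /e' /r'; field; rewrite gt_eqF.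
rewrite E1 E2 in Sy cc.
have := sgr _ _ Sy; have Ps := cut_plane_ge _ _ crs.1.
have [Sst lts] := cr.
have tK := ler_wpM2l (ltW tp) (P_le _ _ Sst).
have PE : delta * U a b + (1 - delta) * P sg ta = P s r - q2 * (r - r').
  by rewrite /cut_plane /r' sE -/q1 -/q2; ring.
have qr : q2 * (r - r') <= `|q2| * (t * W2).
  by apply: le_trans (ler_norm _) _; rewrite normrM ler_wpM2l.
have hhv := hh h h_gt0 hlt; rewrite -/mv in hhv.
have E3 : delta * (M * (m / (rho / 2))) = t * (4 * M * W2 / rho).
  by rewrite /m; field; rewrite !gt_eqF.
have i1 := ler_wpM2l (ltW d0) (le_trans (lerB hhv (lexx (M * (m / (rho / 2))))) low).
have i2 : (1 - delta) * (P sg ta - t * K) <= (1 - delta) * U sg ta.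
  rewrite ler_wpM2l ?subr_ge0 ?(ltW d1)//; apply: le_trans (ltW lts).
  by rewrite [leRHS]mulrBl mul1r lerD2l lerN2.
have i3 : (1 - delta) * (t * K) <= t * K.
  by rewrite ler_piMl ?gerBl ?(ltW d0)// mulr_ge0// ltW.
have dh : 0 < delta * h by rewrite mulr_gt0.
move=> sg1; rewrite -(ler_pM2l dh).
have E4 : s + delta * h * v1 - s = delta * h * v1 by ring.
have E5 : r + delta * h * v2 - r = delta * h * v2 by ring.
rewrite E4 E5 in sg1.
have tC : t * C = t * K + `|q2| * (t * W2) + t * (4 * M * W2 / rho) by rewrite /C; ring.
have tl2' : t * C <= delta * h * eps / 2.
  by rewrite ler_pdivlMr// (_ : t * C * 2 = t * (2 * C)); [exact: ltW|ring].
rewrite mulrDr mulrBr in i1.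
have E6 : delta * (h * (mv - eps / 2)) = delta * h * mv - delta * h * eps / 2 by ring.
have E7 : delta * h * (mv - eps) = delta * h * mv - delta * h * eps by ring.
have E8 : delta * h * (G1 * v1 + G2 * v2) = G1 * (delta * h * v1) + G2 * (delta * h * v2) by ring.
rewrite E7 E8; lra.
Qed.

(** Four directions suffice. Both face gradients have component [e] along the edge, so [(n2, - n1)]
    and its opposite confine that component to a neighbourhood of [e]; the directions [n] and [- n]
    yield the two ends of the segment. *)
Lemma cut_gradients delta eps : 0 < delta < 1 -> 0 < eps ->
  exists2 t0, 0 < t0 & forall t, 0 < t -> t < t0 ->
  forall sg ta s r G1 G2, cut_region t sg ta -> s = delta * a + (1 - delta) * sg ->
  cut_region t s r -> sgrad S U s r G1 G2 ->
  `|G1 * n2 - G2 * n1 - e| <= eps /\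
  kappa * T2 - eps <= G1 * n1 + G2 * n2 <= kappa * T1 + eps.
Proof.
move=> d01 eps0.
have [t1 t10 H1] := direction n2 (- n1) _ _ d01 eps0.
have [t2 t20 H2] := direction (- n2) n1 _ _ d01 eps0.
have [t3 t30 H3] := direction n1 n2 _ _ d01 eps0.
have [t4 t40 H4] := direction (- n1) (- n2) _ _ d01 eps0.
exists (Num.min (Num.min t1 t2) (Num.min t3 t4)); first by rewrite !lt_min t10 t20 t30.
move=> t tp; rewrite !lt_min => /andP[/andP[l1 l2] /andP[l3 l4]] sg ta s r G1 G2 c1 sE c2 sgr.
have gd T : gx T * n2 - gy T * n1 = e.
  by rewrite -[RHS]mulr1 -nn /ridge_gx /ridge_gy; ring.
have gn T : gx T * n1 + gy T * n2 = kappa * T.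
  by rewrite -[RHS]mulr1 -nn /ridge_gx /ridge_gy; ring.
have T12 : kappa * T2 <= kappa * T1 by rewrite ler_pM2l// ltW// (lt_trans T20).
have := H1 _ tp l1 _ _ _ _ _ _ c1 sE c2 sgr.
have := H2 _ tp l2 _ _ _ _ _ _ c1 sE c2 sgr.
have := H3 _ tp l3 _ _ _ _ _ _ c1 sE c2 sgr.
have := H4 _ tp l4 _ _ _ _ _ _ c1 sE c2 sgr.
rewrite !mulrN -!opprD !gd !gn.
have gdN T : - (gx T * n2) + gy T * n1 = - e by rewrite -(gd T); ring.
rewrite !gdN !minxx (min_idPr T12).
have -> : Num.min (- (kappa * T1)) (- (kappa * T2)) = - (kappa * T1).
  by apply/min_idPl; rewrite lerN2.
move=> a4 a3 a2 a1; split; last by apply/andP; split; lra.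
by rewrite ler_norml; apply/andP; split; lra.
Qed.

End CutGeometry.

(** * Gain and loss of the cut on one slice *)

Section SliceData.
Context {R : realType}.
Local Notation mu := (@lebesgue_measure R).

Lemma slope_density_scale (t q1 q2 : R) : 0 < t < 1 ->
  slope_density ((1 - t) * q1) ((1 - t) * q2) <=
  slope_density q1 q2 + 2 * t * (q1 ^+ 2 + q2 ^+ 2).
Proof.
move=> /andP[t0 t1]; set Q := q1 ^+ 2 + q2 ^+ 2.
have Q0 : 0 <= Q by rewrite addr_ge0 ?sqr_ge0.
have E1 : slope_density q1 q2 = (1 + Q)^-1 by rewrite /slope_density addrA.
have E2 : slope_density ((1 - t) * q1) ((1 - t) * q2) = (1 + (1 - t) ^+ 2 * Q)^-1.
  by rewrite /slope_density -addrA !exprMn -mulrDr.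
have s0 : 0 <= (1 - t) ^+ 2 * Q by rewrite mulr_ge0 ?sqr_ge0.
have p1 : 0 < 1 + Q by lra.
have p2 : 0 < 1 + (1 - t) ^+ 2 * Q by lra.
rewrite E1 E2 -lerBlDl.
have -> : (1 + (1 - t) ^+ 2 * Q)^-1 - (1 + Q)^-1 =
    (2 * t * Q - t ^+ 2 * Q) / ((1 + (1 - t) ^+ 2 * Q) * (1 + Q)).
  by field; rewrite !gt_eqF.
have t2 : 0 <= t ^+ 2 * Q by rewrite mulr_ge0 ?sqr_ge0.
have tt : t ^+ 2 * Q <= t * Q.
  by rewrite ler_wpM2r// expr2 ler_piMl// ltW.
apply: (@le_trans _ _ (2 * t * Q - t ^+ 2 * Q)); last by lra.
rewrite ler_piMr//; first by lra.
rewrite invf_le1 ?mulr_gt0//.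
by have := mulr_ge0 s0 Q0; lra.
Qed.

(** Slice integrals evaluate only linear functions of [G2], so the square is replaced by a tangent
    line of free slope [c * eta]. Half of the square is given up to absorb the shift from [q2] to
    [(1 - t) * q2]. *)
Lemma cut_density_gain (q1 q2 A c C eps t eta G1 G2 : R) :
  0 < t < 1 -> 0 < c -> 0 <= eta ->
  slope_density q1 q2 + A * (G2 - q2) + c * (G2 - q2) ^+ 2 - C * eps <=
    slope_density G1 G2 ->
  (A + c * eta) * (G2 - (1 - t) * q2) -
    (c * eta ^+ 2 / 2 + C * eps +
      t * (`|A * q2| + c * q2 ^+ 2 + 2 * (q1 ^+ 2 + q2 ^+ 2))) <=
  slope_density G1 G2 - slope_density ((1 - t) * q1) ((1 - t) * q2).
Proof.
move=> t01 c0 eta0 h; have sc := slope_density_scale t q1 q2 t01.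
have /andP[t0 t1] := t01.
set Dl := G2 - (1 - t) * q2.
have hD : G2 - q2 = Dl - t * q2 by rewrite /Dl; ring.
rewrite hD in h.
have sq : Dl * eta - eta ^+ 2 / 2 - t * q2 ^+ 2 <= (Dl - t * q2) ^+ 2.
  have h1 := sqr_ge0 (Dl - 2 * (t * q2)).
  have h2 := sqr_ge0 (Dl - eta).
  have h3 : t ^+ 2 * q2 ^+ 2 <= t * q2 ^+ 2.
    by rewrite ler_wpM2r ?sqr_ge0// expr2 ler_piMl// ltW.
  have E1 : (Dl - 2 * (t * q2)) ^+ 2 =
    2 * (Dl - t * q2) ^+ 2 - Dl ^+ 2 + 2 * (t ^+ 2 * q2 ^+ 2) by ring.
  have E2 : (Dl - eta) ^+ 2 = Dl ^+ 2 - 2 * (Dl * eta) + eta ^+ 2 by ring.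
  lra.
have sq' := ler_wpM2l (ltW c0) sq.
have At : - (t * `|A * q2|) <= - (A * (t * q2)).
  by rewrite lerN2 mulrCA ler_wpM2l ?ler_norm// ltW.
have E3 : c * (Dl * eta - eta ^+ 2 / 2 - t * q2 ^+ 2) =
  c * eta * Dl - c * eta ^+ 2 / 2 - t * (c * q2 ^+ 2) by ring.
rewrite E3 in sq'.
have E4 : A * (Dl - t * q2) = A * Dl - A * (t * q2) by ring.
rewrite E4 in h.
lra.
Qed.

(* [k] is the slice at abscissa [s] of the difference of the densities of [U] and
   [V], whose slopes in the direction of the slice are [pu] and [pv]. *)
Definition slice_data (S : R -> R -> Prop) (U V : R -> R -> R) (s : R)
    (k : R -> R) (E : set R) (pu pv : R -> R) : Prop :=
  [/\ mu.-integrable setT (EFin \o k), measurable E /\ mu E = 0%E,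
      forall r r', inner S s r -> S s r' ->
        U s r' <= U s r + pu r * (r' - r) /\ V s r' <= V s r + pv r * (r' - r),
      forall r, ~ E r -> ~ inner S s r -> k r = 0 &
      forall r, ~ E r -> inner S s r -> exists pu1 pv1,
        [/\ k r = slope_density pu1 (pu r) - slope_density pv1 (pv r),
            sgrad S U s r pu1 (pu r) &
            forall p q, sgrad S V s r p q -> p = pv1 /\ q = pv r]].

Section CutSlices.
Variables (S : R -> R -> Prop) (U : R -> R -> R) (a b q1 q2 t : R) (line : R -> R).
Let P s r := U a b + q1 * (s - a) + q2 * (r - b).
Let V s r := Num.min (U s r) ((1 - t) * P s r).
Let cr s r := S s r /\ (1 - t) * P s r < U s r.
Variable h : R.
Hypothesis t01 : 0 < t < 1.
Hypothesis h0 : 0 < h.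
Hypothesis near_line : forall s r, cr s r -> `|r - line s| < h.

Variables (s : R) (k : R -> R) (E : set R) (pu pv : R -> R).
Hypothesis sd : slice_data S U V s k E pu pv.

(** Where the cut is active the plane touches [V] from above, so its gradient is that of [V]. Where
    it is not, a supergradient of [U] is one of [V], so the two densities agree. *)
Let in_cut r : ~ E r -> inner S s r -> cr s r -> exists pu1,
  [/\ sgrad S U s r pu1 (pu r), pv r = (1 - t) * q2 &
   k r = slope_density pu1 (pu r) - slope_density ((1 - t) * q1) ((1 - t) * q2)].
Proof.
have [_ _ _ _ hk] := sd => nE iS [Ssr lt].
have [pu1 [pv1 [kE sU uV]]] := hk r nE iS.
have [|e1 e2] := uV ((1 - t) * q1) ((1 - t) * q2).
  move=> s' r' _; have -> : V s r = (1 - t) * P s r by apply/min_idPr; exact: ltW.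
  by rewrite /V ge_min /P; apply/orP; right; lra.
by exists pu1; rewrite kE -e1 -e2.
Qed.

Let off_cut r : ~ E r -> inner S s r -> ~ cr s r -> k r = 0 /\ pu r = pv r.
Proof.
have [_ _ _ _ hk] := sd => nE iS ncr.
have [pu1 [pv1 [kE sU uV]]] := hk r nE iS.
have le : U s r <= (1 - t) * P s r.
  by rewrite leNgt; apply/negP => lt; apply: ncr; split => //; exact: inner_sub.
have [|e1 e2] := uV pu1 (pu r).
  move=> s' r' S'; have -> : V s r = U s r by apply/min_idPl.
  by apply: le_trans (sU _ _ S'); rewrite /V ge_min lexx.
by rewrite kE -e1 -e2 subrr.
Qed.

Let outside r : ~ E r -> ~~ (line s - h <= r <= line s + h) -> k r = 0.
Proof.
move=> nE out; have [_ _ _ kz _] := sd.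
have [iS|niS] := pselect (inner S s r); last exact: kz.
have [//|c] := pselect (k r = 0).
have [cs|ncs] := pselect (cr s r); last by have [] := off_cut r nE iS ncs.
by have := near_line _ _ cs; rewrite ltr_norml => ?; move/negP: out => out; exfalso; apply: out; lra.
Qed.

(** Densities lie between 0 and 1, and the two densities agree outside a strip of width [2 * h]. *)
Lemma cut_slice_crude : - (2 * h) <= \int[mu]_r k r.
Proof.
have [ik [mE E0] _ kz _] := sd.
have ml : line s - h <= line s <= line s + h by have := h0; lra.
have k1 r : ~ E r -> -1 <= k r.
  move=> nE; have [iS|niS] := pselect (inner S s r); last by rewrite kz//; lra.
  have [cs|ncs] := pselect (cr s r); last by have [-> _] := off_cut r nE iS ncs; lra.
  have [pu1 [_ _ ->]] := in_cut r nE iS cs.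
  have /andP[b1 _] := slope_density_bound pu1 (pu r).
  by have /andP[_ b2] := slope_density_bound ((1 - t) * q1) ((1 - t) * q2); lra.
have := @slice_cut _ k (cst 0) (cst 0) (cst 0) (cst 0) E (line s - h) (line s) (line s + h)
  0 0 1 ik mE E0 ml.
have -> : (0 - 0) * (cst 0 (line s) - cst 0 (line s)) - 1 * (line s + h - (line s - h)) =
  - (2 * h) by rewrite /cst /=; ring.
apply => //.
- by move=> *; rewrite /cst mul0r addr0.
- by move=> *; rewrite /cst mul0r addr0.
- by move=> r nE /(outside r nE) ->.
- by move=> r nE _; rewrite mul0r sub0r; exact: k1.
- by move=> r nE _; rewrite mul0r sub0r; exact: k1.
Qed.

Lemma cut_slice_empty : (forall r, ~ cr s r) -> 0 <= \int[mu]_r k r.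
Proof.
move=> nc; have [ik [mE E0] _ kz _] := sd.
have k1 r : ~ E r -> k r = 0.
  move=> nE; have [iS|niS] := pselect (inner S s r); last exact: kz.
  by have [] := off_cut r nE iS (nc r).
have := @slice_cut _ k (cst 0) (cst 0) (cst 0) (cst 0) E 0 0 0 0 0 0 ik mE E0.
rewrite !subrr !mul0r subrr lexx; apply => //.
- by move=> *; rewrite /cst mul0r addr0.
- by move=> *; rewrite /cst mul0r addr0.
- by move=> r nE _; rewrite k1.
- by move=> r nE _; rewrite k1// subr0 mul0r.
- by move=> r nE _; rewrite k1// subr0 mul0r.
Qed.

Variables (A c C eps eta : R).
Hypotheses (c0 : 0 < c) (C0 : 0 <= C) (e0 : 0 < eps) (eta0 : 0 <= eta).
Hypothesis band : forall r, line s - h <= r <= line s + h -> inner S s r.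
Hypothesis growth : forall r G1 G2, cr s r -> sgrad S U s r G1 G2 ->
  slope_density q1 q2 + A * (G2 - q2) + c * (G2 - q2) ^+ 2 - C * eps <=
    slope_density G1 G2.

(** The slope gets the coefficient [A + c * eta] before [r0] and [A] after it, so that [slice_cut]
    yields [c * eta] times the height of the cut at [r0]. Off the region the slopes agree, and both
    bounds are trivial. *)
Lemma cut_slice_good r0 : line s - h <= r0 <= line s + h ->
  c * eta * (U s r0 - V s r0) -
   (c * eta ^+ 2 / 2 + C * eps +
      t * (`|A * q2| + c * q2 ^+ 2 + 2 * (q1 ^+ 2 + q2 ^+ 2))) * (2 * h) <=
  \int[mu]_r k r.
Proof.
move=> r0in; have [ik [mE E0] sel kz _] := sd.
set be := (X in _ - X * _).
have be0 : 0 <= c * eta ^+ 2 / 2 + C * eps.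
  by rewrite addr_ge0// ?mulr_ge0 ?sqr_ge0 ?(ltW c0) ?(ltW e0)//; lra.
have be0' : 0 <= t * (`|A * q2| + c * q2 ^+ 2 + 2 * (q1 ^+ 2 + q2 ^+ 2)).
  have := sqr_ge0 q1; have := sqr_ge0 q2; have := mulr_ge0 (ltW c0) (sqr_ge0 q2).
  have := normr_ge0 (A * q2); have /andP[t0 _] := t01 => *.
  by apply: mulr_ge0; [exact: ltW|lra].
have gain et r : (et = 0) \/ (et = eta) -> ~ E r -> line s - h <= r <= line s + h ->
    (A + c * et) * (pu r - pv r) - be <= k r.
  move=> het nE hr; have iS := band _ hr.
  have et0 : 0 <= et by case: het => ->.
  have [cs|ncs] := pselect (cr s r); last first.
    by have [-> ->] := off_cut r nE iS ncs; rewrite subrr mulr0 /be; lra.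
  have [pu1 [sU -> ->]] := in_cut r nE iS cs.
  have := cut_density_gain q1 q2 A c C eps t et _ _ t01 c0 et0 (growth _ _ _ cs sU).
  apply: le_trans; rewrite lerD2l lerN2 /be !lerD2r.
  have : et ^+ 2 <= eta ^+ 2.
    by case: het => -> //; rewrite expr0n /= sqr_ge0.
  by move=> /(ler_wpM2l (ltW c0)); lra.
have VU r : ~ cr s r -> S s r -> U s r = V s r.
  move=> nc Ss; apply/esym/min_idPl; rewrite leNgt; apply/negP => lt.
  exact: nc.
have e1 : U s (line s - h) = V s (line s - h).
  apply: VU; last by apply: inner_sub; apply: band; rewrite ?lexx ?andbT /=; move: h0; lra.
  by move=> /near_line; rewrite addrAC subrr add0r normrN gtr0_norm// ltxx.
have e2 : U s (line s + h) = V s (line s + h).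
  apply: VU; last by apply: inner_sub; apply: band; rewrite ?lexx ?andbT /=; move: h0; lra.
  by move=> /near_line; rewrite addrAC subrr add0r gtr0_norm// ltxx.
have := @slice_cut _ k (U s) (V s) pu pv E (line s - h) r0 (line s + h)
  (A + c * eta) (A + c * 0) be ik mE E0 r0in.
have -> : (A + c * eta - (A + c * 0)) * (U s r0 - V s r0) -
    be * (line s + h - (line s - h)) = c * eta * (U s r0 - V s r0) - be * (2 * h) by ring.
apply => //.
- by move=> x y hx hy; have [] := sel x y (band _ hx) (inner_sub _ _ _ (band _ hy)).
- by move=> x y hx hy; have [] := sel x y (band _ hx) (inner_sub _ _ _ (band _ hy)).
- by move=> r nE /(outside r nE) ->.
- by move=> r nE hr; apply: gain => //; [right|move: hr r0in; lra].
- move=> r nE hr; apply: gain => //; [by left|move: hr r0in; lra].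
Qed.

End CutSlices.

End SliceData.

Section StepFunctions.
Context {R : realType}.
Local Notation mu := (@lebesgue_measure R).

Lemma step_integrable (c x y : R) (b1 b2 : bool) : x < y ->
  mu.-integrable setT (EFin \o ((fun=> c) \_ [set` Interval (BSide b1 x) (BSide b2 y)])).
Proof.
move=> xy; set I := [set` _].
have mI : measurable I by exact: measurable_itv.
have fI : (mu I < +oo)%E by rewrite /= lebesgue_measure_itv /= lte_fin xy -EFinD ltry.
rewrite (_ : _ \o _ = (EFin \o (fun=> c)) \_ I); last first.
  by apply/funext => z; rewrite /= !patchE; case: ifP.
apply: ((@integrable_mkcond _ _ R mu I (EFin \o (fun=> c)) mI).1 _).
apply: measurable_bounded_integrable => //.
by exists `|c|; split; [exact: num_real|move=> z hz v _; exact: ltW].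
Qed.

Lemma step_integral (c x y : R) (b1 b2 : bool) : x < y ->
  \int[mu]_z ((fun=> c) \_ [set` Interval (BSide b1 x) (BSide b2 y)]) z = c * (y - x).
Proof.
move=> xy; rewrite -Rintegral_mkcond Rintegral_cst//=.
by rewrite lebesgue_measure_itv /= lte_fin xy -EFinD.
Qed.

End StepFunctions.

(** * Choice of the cut *)

Section CutComparison.
Context {R : realType}.
Local Notation mu := (@lebesgue_measure R).
Variables (S : R -> R -> Prop) (U : R -> R -> R) (M a b rho B : R).
Variables (n1 n2 e kappa T0 T1 T2 : R).
Hypotheses (cS : cvx2 S) (cU : ccv2 S U).
Hypothesis UM : forall x y, S x y -> 0 <= U x y <= M.
Hypotheses (rho0 : 0 < rho) (hbox : box_in S a b rho) (U0 : 0 < U a b).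
Hypothesis hB : forall x y, S x y -> `|x| <= B /\ `|y| <= B.
Hypotheses (nn : n1 ^+ 2 + n2 ^+ 2 = 1) (n20 : n2 != 0).
Hypotheses (k0 : 0 < kappa) (kE : kappa ^+ 2 = 1 + e ^+ 2) (T20 : T2 < T0) (T01 : T0 < T1).
Hypotheses (L1 : 0 < 2 * T0 * T1 + T0 ^+ 2 - 1) (L2 : 0 < 2 * T0 * T2 + T0 ^+ 2 - 1).
Local Notation gx := (ridge_gx n1 n2 e kappa).
Local Notation gy := (ridge_gy n1 n2 e kappa).
Hypothesis R1 : forall s r, S s r -> U s r <= U a b + gx T1 * (s - a) + gy T1 * (r - b).
Hypothesis R2 : forall s r, S s r -> U s r <= U a b + gx T2 * (s - a) + gy T2 * (r - b).
Hypothesis R3 : forall v1 v2 eps, 0 < eps -> exists2 h0, 0 < h0 &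
  forall h, 0 < h -> h < h0 ->
  U a b + h * (Num.min (gx T1 * v1 + gy T1 * v2) (gx T2 * v1 + gy T2 * v2) - eps) <=
    U (a + h * v1) (b + h * v2).
Local Notation P := (cut_plane U a b n1 n2 e kappa T0).
Local Notation W := (cut_width M B n1 n2 e kappa T0 T1 T2).
Local Notation line := (ridge_line a b n1 n2).
Local Notation cr := (cut_region S U a b n1 n2 e kappa T0).

(** At the apex [U] exceeds [(1 - t) * P] by [t * U a b > 0], and [R3] limits how fast this excess
    decreases. So the region extends to both sides of the abscissa [a]. *)
Lemma cut_crossing t v : 0 < t -> `|v| = 1 -> exists2 h, 0 < h & cr t (a + h * v) b.
Proof.
move=> t0 v1; have [h0 h00 hh] := R3 v 0 1 ltr01.
set m := Num.min _ _ in hh.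
pose c := m - 1 - (1 - t) * (gx T0 * v).
have D0 : 0 < `|c| + 1 by have := normr_ge0 c; lra.
have tU : 0 < t * U a b by rewrite mulr_gt0.
pose h := Num.min (Num.min h0 rho) (t * U a b / (`|c| + 1)) / 2.
have mp : 0 < Num.min (Num.min h0 rho) (t * U a b / (`|c| + 1)).
  by rewrite !lt_min h00 rho0 divr_gt0.
have hp : 0 < h by rewrite divr_gt0.
have : h < Num.min (Num.min h0 rho) (t * U a b / (`|c| + 1)) by rewrite /h; lra.
rewrite !lt_min => /andP[/andP[hl hr]]; rewrite ltr_pdivlMr// => hc.
exists h => //; split.
  apply: hbox; last by rewrite subrr normr0.
  by rewrite addrC addKr normrM v1 mulr1 gtr0_norm.
have := hh h hp hl; rewrite mulr0 addr0.
apply: lt_le_trans; rewrite /cut_plane subrr mulr0 addr0.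
have -> : a + h * v - a = h * v by ring.
have : - (h * `|c|) <= h * c.
  by rewrite -mulrN ler_wpM2l ?(ltW hp)// lerNl -normrN ler_norm.
have -> : h * c = h * (m - 1) - (1 - t) * (gx T0 * (h * v)) by rewrite /c; ring.
rewrite mulrDr mulr1 in hc; lra.
Qed.

Lemma cut_abscissae t s :
  (exists sg ta, cr t sg ta /\ sg <= s) -> (exists sg ta, cr t sg ta /\ s <= sg) ->
  exists ta, cr t s ta.
Proof.
move=> [s1 [r1 [c1 h1]]] [s2 [r2 [c2 h2]]].
have [e12|ne] := eqVneq s1 s2.
  by exists r1; have -> : s = s1 by apply/eqP; rewrite eq_le h1 e12 h2.
have s12 : 0 < s2 - s1 by rewrite subr_gt0 lt_neqAle ne (le_trans h1).
pose l := (s2 - s) / (s2 - s1).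
have l01 : 0 <= l <= 1 by rewrite /l divr_ge0 ?ler_pdivrMr; lra.
exists (l * r1 + (1 - l) * r2).
have := cut_region_cvx S U a b n1 n2 e kappa T0 cS cU t _ _ _ _ _ l01 c1 c2.
by have -> : l * s1 + (1 - l) * s2 = s by rewrite /l; field; rewrite gt_eqF.
Qed.

End CutComparison.

(** The abscissas of the cut fill an interval around [a], divided into zones by contraction towards
    [a]: in the inner half each slice gains, further out a slice loses little, and in the end zones,
    a fraction [delta] of the length, the crude bound is used. The result concerns arbitrary slices
    and their lower bound [ee], so that it also applies with the coordinates exchanged. *)
Lemma cut_comparison (R : realType) (S : R -> R -> Prop) (U : R -> R -> R)
    (M a b rho B n1 n2 e kappa T0 T1 T2 : R)
    (gx := ridge_gx n1 n2 e kappa) (gy := ridge_gy n1 n2 e kappa)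
    (P := cut_plane U a b n1 n2 e kappa T0)
    (mu := @lebesgue_measure R) :
  cvx2 S -> ccv2 S U -> (forall x y, S x y -> 0 <= U x y <= M) ->
  0 < rho -> box_in S a b rho -> 0 < U a b ->
  (forall x y, S x y -> `|x| <= B /\ `|y| <= B) ->
  n1 ^+ 2 + n2 ^+ 2 = 1 -> n2 != 0 -> 0 < kappa -> kappa ^+ 2 = 1 + e ^+ 2 ->
  T2 < T0 -> T0 < T1 ->
  0 < 2 * T0 * T1 + T0 ^+ 2 - 1 -> 0 < 2 * T0 * T2 + T0 ^+ 2 - 1 ->
  (forall s r, S s r -> U s r <= U a b + gx T1 * (s - a) + gy T1 * (r - b)) ->
  (forall s r, S s r -> U s r <= U a b + gx T2 * (s - a) + gy T2 * (r - b)) ->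
  (forall v1 v2 eps, 0 < eps -> exists2 h0, 0 < h0 & forall h, 0 < h -> h < h0 ->
     U a b + h * (Num.min (gx T1 * v1 + gy T1 * v2) (gx T2 * v1 + gy T2 * v2) - eps) <=
       U (a + h * v1) (b + h * v2)) ->
  exists t, 0 < t < 1 /\ exists ee : R -> R,
  [/\ mu.-integrable setT (EFin \o ee), 0 < \int[mu]_s ee s &
  forall s k E pu pv,
    slice_data S U (fun s r => Num.min (U s r) ((1 - t) * P s r)) s k E pu pv ->
    ee s <= \int[mu]_r k r].
Proof.
move=> cS cU UM rho0 hbox U0 hB nn n20 k0 kE T20 T01 L1 L2 R1 R2 R3.
pose W := cut_width M B n1 n2 e kappa T0 T1 T2.
pose line := ridge_line a b n1 n2.
pose cr := cut_region S U a b n1 n2 e kappa T0.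
have Sab : S a b by apply: hbox; rewrite subrr normr0.
have Pab : P a b = U a b by rewrite /P /cut_plane !subrr !mulr0 !addr0.
have cross t v : 0 < t -> `|v| = 1 -> exists2 h, 0 < h & cr t (a + h * v) b.
  exact: (cut_crossing S U a b rho n1 n2 e kappa T0 T1 T2).
have half0 : 0 <= 1 / 2 :> R by rewrite divr_ge0.
have half01 : 0 <= (1 / 2 : R) <= 1 by rewrite half0 ler_pdivrMr// mul1r ler1n.
have T012 : T2 < T0 < T1 by rewrite T20.
have [A [c [C [eps0 [c0 C0 eps00 growth]]]]] :=
  slope_density_growth _ _ _ _ _ _ _ nn n20 k0 kE T012 L1 L2.
have w0 : 0 < W by exact: (cut_width_gt0 S U M a b rho B _ _ _ _ _ _ _ UM rho0 hbox U0 hB n20 k0 T20 T01).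
(* Gains and losses of a slice are measured in units of [t * c3]; the factor 16 makes the gain
   [4 * (t * c3)] and the quadratic loss [2 * (t * c3)] for the [eta] chosen below. *)
pose c3 := c * U a b ^+ 2 / (16 * W).
have w16 : 0 < 16 * W by clear -w0; lra.
have c30 : 0 < c3 by rewrite divr_gt0// mulr_gt0// exprn_gt0.
pose C7 := `|A * gy T0| + c * gy T0 ^+ 2 + 2 * (gx T0 ^+ 2 + gy T0 ^+ 2).
have C70 : 0 <= C7.
  rewrite /C7; have := normr_ge0 (A * gy T0); have := mulr_ge0 (ltW c0) (sqr_ge0 (gy T0)).
  by have := sqr_ge0 (gx T0); have := sqr_ge0 (gy T0); clear; lra.
pose eps := Num.min eps0 (c3 / (16 * W * (C + 1))).
have d1 : 0 < 16 * W * (C + 1) by rewrite mulr_gt0//; clear -C0; lra.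
have epsp : 0 < eps by rewrite lt_min eps00 divr_gt0.
have epsl : eps <= eps0 by rewrite ge_min lexx.
have epsW : W * (C * eps) <= c3 / 16.
  have : eps * (16 * W * (C + 1)) <= c3.
    by rewrite -ler_pdivlMr// /eps ge_min lexx orbT.
  have : 0 <= eps * W by rewrite mulr_ge0// ltW.
  have -> : eps * (16 * W * (C + 1)) = 16 * (W * (C * eps)) + 16 * (eps * W) by ring.
  clear; lra.
(* The bound [1 / 2] puts the inner zone inside the middle one; the other bound keeps [delta * W],
   the share of the end zones, at most [c3 / 8]. *)
pose delta := Num.min (1 / 2) (c3 / (8 * W)).
have d2 : 0 < 8 * W by clear -w0; lra.
have deltap : 0 < delta by rewrite lt_min; apply/andP; split; apply: divr_gt0.
have deltal : delta <= 1 / 2 by rewrite ge_min lexx.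
have deltaW : delta * (8 * W) <= c3 by rewrite -ler_pdivlMr// /delta ge_min lexx orbT.
have d01 : 0 < delta < 1 by rewrite deltap /=; clear -deltal; lra.
have [t0 t00 grads] := cut_gradients S U M a b rho B _ _ _ _ _ _ _ cS cU UM rho0 hbox U0 hB
  nn n20 k0 T20 T01 R1 R2 R3 _ _ d01 epsp.
have d3 : 0 < 16 * W * (C7 + 1) by apply: mulr_gt0 => //; exact: ltr_wpDl.
(* The four bounds serve the gradient estimate, the sign of [1 - t], the inclusion of the strip in
   [S], and the error terms collected in [C7]. *)
pose t := Num.min (Num.min t0 1) (Num.min (delta * rho / W) (c3 / (16 * W * (C7 + 1)))) / 2.
have mp : 0 < Num.min (Num.min t0 1) (Num.min (delta * rho / W) (c3 / (16 * W * (C7 + 1)))).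
  rewrite !lt_min t00 ltr01 /=; apply/andP; split; apply: divr_gt0 => //.
  exact: mulr_gt0.
have tp : 0 < t by rewrite divr_gt0.
have : t < Num.min (Num.min t0 1) (Num.min (delta * rho / W) (c3 / (16 * W * (C7 + 1)))).
  by rewrite /t; clear -mp; lra.
rewrite !lt_min => /andP[/andP[tt0 t1] /andP[]]; rewrite ltr_pdivlMr// ltr_pdivlMr// => tW tC.
have t01 : 0 < t < 1 by rewrite tp.
have tC7 : W * (t * C7) <= c3 / 16.
  have : 0 <= t * W by rewrite mulr_ge0// ltW.
  have E : t * (16 * W * (C7 + 1)) = 16 * (W * (t * C7)) + 16 * (t * W) by ring.
  rewrite E in tC; clear -tC; lra.
exists t; split => //.
pose Sg := [set s | exists r, cr t s r].
have SgB s : Sg s -> - B <= s <= B by move=> [r [/hB[+ _] _]]; rewrite ler_norml.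
have Sgn : Sg !=set0.
  by have [h h0 hc] := cross t 1 tp (normr1 _); exists (a + h * 1), b.
have hsup : has_sup Sg by split => //; exists B => s /SgB /andP[].
have hinf : has_inf Sg by split => //; exists (- B) => s /SgB /andP[].
pose lo := inf Sg; pose hi := sup Sg.
have loa : lo < a.
  have [h h0 hc] := cross t (-1) tp (normrN1 _).
  apply: (@le_lt_trans _ _ (a + h * -1)); last by clear -h0; lra.
  by apply: ge_inf; [case: hinf|exists b].
have ahi : a < hi.
  have [h h0 hc] := cross t 1 tp (normr1 _).
  apply: (@lt_le_trans _ _ (a + h * 1)); first by clear -h0; lra.
  by apply: ub_le_sup; [case: hsup|exists b].
have between s : lo < s < hi -> exists r, cr t s r.
  move=> /andP[ls sh]; apply: (cut_abscissae S U a b n1 n2 e kappa T0 cS cU) => //.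
  - have sl : 0 < s - lo by rewrite subr_gt0.
    have [sg [r hr] hlt] := inf_adherent sl hinf.
    by exists sg, r; split => //; rewrite -/lo in hlt; clear -hlt; lra.
  - have sl : 0 < hi - s by rewrite subr_gt0.
    have [sg [r hr] hlt] := sup_adherent sl hsup.
    by exists sg, r; split => //; rewrite -/hi in hlt; clear -hlt; lra.
pose h := t * W / 2.
have hp : 0 < h by rewrite /h divr_gt0// mulr_gt0.
have near s r : cr t s r -> `|r - line s| < h.
  exact: (cut_region_near_line S U M a b rho B _ _ _ _ _ _ _ UM rho0 hbox hB n20 k0 T20 T01 R1 R2).
have good_abscissa s l : delta <= l < 1 ->
    l * a + (1 - l) * lo < s < l * a + (1 - l) * hi ->
    exists sg ta, cr t sg ta /\ s = l * a + (1 - l) * sg.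
  move=> /andP[dl l1] /andP[s1 s2]; have p : 0 < 1 - l by clear -l1; lra.
  have [|ta cta] := between ((s - l * a) / (1 - l)).
    by rewrite ltr_pdivlMr// ltr_pdivrMr//; clear -s1 s2; apply/andP; split; lra.
  exists ((s - l * a) / (1 - l)), ta; split => //.
  by field; rewrite gt_eqF.
have good s k E pu pv eta r0 : delta * a + (1 - delta) * lo < s < delta * a + (1 - delta) * hi ->
    slice_data S U (fun s r => Num.min (U s r) ((1 - t) * P s r)) s k E pu pv ->
    0 <= eta -> line s - h <= r0 <= line s + h ->
    c * eta * (U s r0 - Num.min (U s r0) ((1 - t) * P s r0)) -
      (c * eta ^+ 2 / 2 + C * eps + t * C7) * (t * W) <= \int[mu]_r k r.
  move=> hs sd eta0 hr0.
  have dd : delta <= delta < 1 by rewrite lexx; case/andP: d01.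
  have [sg [ta [csg sE]]] := good_abscissa s delta dd hs.
  have -> : t * W = 2 * h by rewrite /h; field.
  apply: (cut_slice_good S U a b (gx T0) (gy T0) t line h t01 hp near s k E pu pv sd) => //.
  - move=> r hr; have hr' : `|r - line s| <= t * W / 2 by rewrite ler_norml -/h; clear -hr; lra.
    exact: (cut_region_inner_line S U M a b rho B _ _ _ _ _ _ _ cS UM rho0 hbox U0 hB n20 k0
      T20 T01 R1 R2 _ _ _ _ _ _ tp d01 tW csg sE hr').
  - move=> r G1 G2 crs sgr.
    have [g1 g2] := grads t tp tt0 _ _ _ _ _ _ csg sE crs sgr.
    by apply: growth => //; rewrite epsp.
pose I0l := 1 / 2 * a + 1 / 2 * lo; pose I0r := 1 / 2 * a + 1 / 2 * hi.
pose I1l := delta * a + (1 - delta) * lo; pose I1r := delta * a + (1 - delta) * hi.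
have x0 : I0l < I0r by rewrite /I0l /I0r; clear -loa ahi; lra.
have x1 : I1l < I1r.
  rewrite /I1l /I1r ltrD2l; have p : 0 < 1 - delta by clear -deltal; lra.
  by rewrite (ltr_pM2l p); clear -loa ahi; lra.
have x2 : lo < hi by exact: lt_trans loa ahi.
(* The steps add up to [- (t * W)] in the end zones, [- (t * c3 / 8)] in the middle zone and
   [t * c3] in the inner one. *)
pose e0 := (fun=> t * (9 / 8 * c3)) \_ `]I0l, I0r[ : R -> R.
pose e1 := (fun=> t * (W - c3 / 8)) \_ `]I1l, I1r[ : R -> R.
pose e2 := (fun=> - (t * W)) \_ `[lo, hi] : R -> R.
have i0 : mu.-integrable setT (EFin \o e0) by exact: step_integrable.
have i1 : mu.-integrable setT (EFin \o e1) by exact: step_integrable.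
have i2 : mu.-integrable setT (EFin \o e2) by exact: step_integrable.
have i01 : mu.-integrable setT (EFin \o (fun x => e0 x + e1 x)).
  rewrite (_ : _ \o _ = (EFin \o e0) \+ (EFin \o e1))%E; last exact/funext.
  exact: integrableD.
exists (fun x => e0 x + e1 x + e2 x); split.
- rewrite (_ : _ \o _ = (EFin \o (fun x => e0 x + e1 x)%R) \+ (EFin \o e2))%E; last exact/funext.
  exact: integrableD.
- rewrite RintegralD// RintegralD// !step_integral//.
  have -> : I0r - I0l = (hi - lo) / 2 by rewrite /I0l /I0r; clear; lra.
  have -> : I1r - I1l = (1 - delta) * (hi - lo) by rewrite /I1l /I1r; ring.
  have -> : t * (9 / 8 * c3) * ((hi - lo) / 2) + t * (W - c3 / 8) * ((1 - delta) * (hi - lo)) +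
     - (t * W) * (hi - lo) = t * (hi - lo) * (7 / 16 * c3 + delta * c3 / 8 - delta * W) by field.
  have dc : 0 < delta * c3 by rewrite mulr_gt0.
  by rewrite mulr_gt0 ?mulr_gt0 ?subr_gt0//; clear -dc deltaW c30; lra.
move=> s k E pu pv sd.
rewrite /e0 /e1 /e2 !patchE !mem_setE !in_itv /= (_ : point = 0 :> R)//.
have [s2|ns2] := boolP (lo <= s <= hi); last first.
  have -> : (I0l < s < I0r) = false.
    by apply/negbTE/negP => hs; move/negP: ns2; apply; rewrite /I0l /I0r in hs; clear -hs loa ahi; lra.
  have -> : (I1l < s < I1r) = false.
    apply/negbTE/negP => hs; move/negP: ns2; apply; rewrite /I1l /I1r in hs.
    have al : 0 < a - lo by rewrite subr_gt0.
    have ah : 0 < hi - a by rewrite subr_gt0.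
    have := mulr_gt0 deltap al; have := mulr_gt0 deltap ah; clear -hs loa ahi; lra.
  rewrite !addr0.
  apply: (cut_slice_empty S U a b (gx T0) (gy T0) t s k E pu pv sd).
  move=> r crs; move/negP: ns2; apply; apply/andP; split.
    by apply: ge_inf; [case: hinf|exists r].
  by apply: ub_le_sup; [case: hsup|exists r].
have sub01 : I0l < s < I0r -> I1l < s < I1r.
  have dl : 0 <= 1 / 2 - delta by rewrite subr_ge0.
  have al : 0 <= a - lo by rewrite subr_ge0 ltW.
  have ah : 0 <= hi - a by rewrite subr_ge0 ltW.
  have := mulr_ge0 dl al; have := mulr_ge0 dl ah.
  by rewrite /I0l /I0r /I1l /I1r; clear; lra.
have [s1|ns1] := boolP (I1l < s < I1r); last first.
  have -> : (I0l < s < I0r) = false by apply/negbTE/negP => /sub01; exact/negP.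
  rewrite !add0r.
  have := cut_slice_crude S U a b (gx T0) (gy T0) t line h hp near s k E pu pv sd.
  by have -> : 2 * h = t * W by rewrite /h; field.
have small : (C * eps + t * C7) * (t * W) <= t * (c3 / 8).
  have -> : (C * eps + t * C7) * (t * W) = t * (W * (C * eps) + W * (t * C7)) by ring.
  by rewrite ler_pM2l//; clear -epsW tC7; lra.
have [s0|ns0] := boolP (I0l < s < I0r); last first.
  have := good s k E pu pv 0 (line s) s1 sd (lexx 0) ltac:(clear -hp; lra).
  rewrite mulr0 mul0r expr0n /= mulr0 mul0r !add0r => le; apply: le_trans le; clear -small; lra.
have [|sg [ta [csg sE]]] := good_abscissa s (1 / 2) ltac:(clear -deltal; lra).
  by move: s0; rewrite /I0l /I0r; clear; lra.
(* Up to the factor [c * t], this maximizes [eta * U a b / 2 - eta ^+ 2 * W / 2]: the gain from a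
   height of [t * U a b / 2], minus the quadratic loss over the width [t * W]. *)
pose eta := U a b / (2 * W).
have W2 : 0 < 2 * W by clear -w0; lra.
have eta0 : 0 <= eta by rewrite /eta divr_ge0// ltW.
(* The cut has height [t * U a b] at the apex and positive height at [(sg, ta)]; by concavity half
   of the former remains at the midpoint. *)
pose r0 := 1 / 2 * b + (1 - 1 / 2) * ta.
have Hc : t * U a b / 2 <= U s r0 - (1 - t) * P s r0.
  have Ssg := csg.1; have lt : (1 - t) * P sg ta < U sg ta := csg.2.
  have := cU _ _ _ _ _ half01 Sab Ssg; rewrite -sE -/r0.
  have -> : (1 - t) * P s r0 = 1 / 2 * ((1 - t) * U a b) + (1 - 1 / 2) * ((1 - t) * P sg ta).
    by rewrite -Pab sE /r0 /P /cut_plane; field.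
  clear -lt; lra.
have cr0 : cr t s r0.
  split.
      by rewrite sE; exact: (cS _ _ _ _ _ half01 Sab csg.1).
  by rewrite -subr_gt0; apply: lt_le_trans Hc; rewrite divr_gt0// mulr_gt0.
have := near s r0 cr0; rewrite ltr_norml => /andP[n1' n2'].
have := good s k E pu pv eta r0 s1 sd eta0 ltac:(clear -n1' n2'; lra).
have -> : Num.min (U s r0) ((1 - t) * P s r0) = (1 - t) * P s r0.
  by apply/min_idPr; exact: ltW cr0.2.
apply: le_trans.
have ce : 0 <= c * eta by rewrite mulr_ge0// ltW.
have := ler_wpM2l ce Hc.
have -> : c * eta * (t * U a b / 2) = 4 * (t * c3) by rewrite /eta /c3; field; rewrite gt_eqF.
have -> : (c * eta ^+ 2 / 2 + C * eps + t * C7) * (t * W) =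
   2 * (t * c3) + (C * eps + t * C7) * (t * W).
  by rewrite /eta /c3; field; rewrite gt_eqF.
have tc30 := mulr_gt0 tp c30; clear -small tc30; lra.
Qed.

Section TangentPoint.
Context {R : realType}.

Lemma tangent_point_near (T m T1 T2 : R) : 0 < m ->
  m <= 2 * T * T1 + T ^+ 2 - 1 -> m <= 2 * T * T2 + T ^+ 2 - 1 ->
  `|T1| <= `|T| -> `|T2| <= `|T| ->
  exists2 eta, 0 < eta & forall T0, `|T0 - T| <= eta ->
    0 < 2 * T0 * T1 + T0 ^+ 2 - 1 /\ 0 < 2 * T0 * T2 + T0 ^+ 2 - 1.
Proof.
move=> m0 m1 m2 h1 h2; have D0 : 0 < 4 * `|T| + 2 by have := normr_ge0 T; lra.
exists (Num.min 1 (m / (4 * `|T| + 2))); first by rewrite lt_min ltr01 divr_gt0.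
move=> T0; rewrite le_min ler_pdivlMr// => /andP[e1 e2].
have aux Ti : m <= 2 * T * Ti + T ^+ 2 - 1 -> `|Ti| <= `|T| ->
    0 < 2 * T0 * Ti + T0 ^+ 2 - 1.
  move=> hm hT; set d := T0 - T in e1 e2.
  have E : 2 * T0 * Ti + T0 ^+ 2 - 1 =
    (2 * T * Ti + T ^+ 2 - 1) + d * (2 * Ti + 2 * T + d) by rewrite /d; ring.
  rewrite E.
  have b : `|d * (2 * Ti + 2 * T + d)| <= `|d| * (4 * `|T| + 1).
    rewrite normrM ler_wpM2l//; apply: le_trans (ler_normD _ _) _.
    rewrite lerD//; apply: le_trans (ler_normD _ _) _.
    by rewrite !normrM (ger0_norm (_ : 0 <= 2 :> R))//; lra.
  move: b; rewrite ler_norml => /andP[b _].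
  have E2 : `|d| * (4 * `|T| + 2) = `|d| * (4 * `|T| + 1) + `|d| by ring.
  have [d0|d0] := eqVneq d 0; first by rewrite d0 mul0r addr0; lra.
  have : 0 < `|d| by rewrite normr_gt0.
  lra.
by split; apply: aux.
Qed.

(** [T0] is taken next to the endpoint of larger absolute value, slightly inside the interval. At
    this endpoint both quantities are positive: the larger square can only help in the hypothesis,
    and [(T1 - T2) ^+ 2 >= 0] compares the two quantities. A small displacement keeps them
    positive. *)
Lemma tangent_point (T1 T2 : R) : T2 < T1 ->
  (1 < 2 * T1 * T2 + T1 ^+ 2) \/ (1 < 2 * T1 * T2 + T2 ^+ 2) ->
  exists T0, [/\ T2 < T0, T0 < T1, 0 < 2 * T0 * T1 + T0 ^+ 2 - 1 &
    0 < 2 * T0 * T2 + T0 ^+ 2 - 1].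
Proof.
move=> T21 h.
have sqn (x y : R) : (`|x| <= `|y|) = (x ^+ 2 <= y ^+ 2).
  by rewrite -[x ^+ 2]real_normK ?num_real// -[y ^+ 2]real_normK ?num_real// ler_pXn2r ?nnegrE.
have [le|lt] := lerP `|T2| `|T1|.
- have sq : T2 ^+ 2 <= T1 ^+ 2 by rewrite -sqn.
  have g : 1 < 2 * T1 * T2 + T1 ^+ 2 by case: h => h //; lra.
  have sd := sqr_ge0 (T1 - T2).
  have E : (T1 - T2) ^+ 2 = T1 ^+ 2 - 2 * T1 * T2 + T2 ^+ 2 by ring.
  have m0 : 0 < 2 * T1 * T2 + T1 ^+ 2 - 1 by lra.
  have m1 : 2 * T1 * T2 + T1 ^+ 2 - 1 <= 2 * T1 * T1 + T1 ^+ 2 - 1.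
    have -> : 2 * T1 * T1 = 2 * T1 ^+ 2 by ring.
    lra.
  have [eta eta0 he] := tangent_point_near _ _ _ _ m0 m1 (lexx _) (lexx _) le.
  pose d := Num.min eta ((T1 - T2) / 2).
  have d0 : 0 < d by rewrite lt_min eta0 divr_gt0// subr_gt0.
  have d1 : d <= eta by rewrite ge_min lexx.
  have d2 : d <= (T1 - T2) / 2 by rewrite ge_min lexx orbT.
  have [] := he (T1 - d); first by rewrite addrAC subrr add0r normrN gtr0_norm.
  by exists (T1 - d); split => //; lra.
- have le := ltW lt; have sq : T1 ^+ 2 <= T2 ^+ 2 by rewrite -sqn.
  have g : 1 < 2 * T1 * T2 + T2 ^+ 2 by case: h => h //; lra.
  have sd := sqr_ge0 (T1 - T2).
  have E : (T1 - T2) ^+ 2 = T1 ^+ 2 - 2 * T1 * T2 + T2 ^+ 2 by ring.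
  have E' : 2 * T2 * T1 = 2 * T1 * T2 by ring.
  have m0 : 0 < 2 * T2 * T1 + T2 ^+ 2 - 1 by lra.
  have m2 : 2 * T2 * T1 + T2 ^+ 2 - 1 <= 2 * T2 * T2 + T2 ^+ 2 - 1.
    have -> : 2 * T2 * T2 = 2 * T2 ^+ 2 by ring.
    lra.
  have [eta eta0 he] := tangent_point_near _ _ _ _ m0 (lexx _) m2 le (lexx _).
  pose d := Num.min eta ((T1 - T2) / 2).
  have d0 : 0 < d by rewrite lt_min eta0 divr_gt0// subr_gt0.
  have d1 : d <= eta by rewrite ge_min lexx.
  have d2 : d <= (T1 - T2) / 2 by rewrite ge_min lexx orbT.
  have [] := he (T2 + d); first by rewrite addrAC subrr add0r gtr0_norm.
  by exists (T2 + d); split => //; lra.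
Qed.

End TangentPoint.

(** * Minimality against the cut: the inequalities between the two slopes *)

Section Minimizer.
Context {R : realType}.
Local Notation mu := (@lebesgue_measure R).
Variables (S : set (R * R)) (u : R * R -> R) (M : R).
Hypotheses (cS : cvx2 (cur _ S)) (cu : ccv2 (cur _ S) (cur _ u)).
Hypothesis uM : forall x y, cur _ S x y -> 0 <= cur _ u x y <= M.
Hypotheses (core0 : core S !=set0) (mS : measurable S) (bS : bounded_set2 S).
Hypothesis umin : forall v, ccv2 (cur _ S) (cur _ v) ->
  (forall x y, cur _ S x y -> 0 <= cur _ v x y <= M) ->
  (resistance S u <= resistance S v)%E.

Lemma slope_densityC (p q : R) : slope_density p q = slope_density q p.
Proof. by rewrite /slope_density addrAC. Qed.

(** Fubini turns lower bounds for slices into a lower bound for the resistance of [u] minus that of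
    [v], which is at most 0 for a minimizer. Almost every slice meets the exceptional set of the
    gradients in a null set. *)
Lemma no_better_slices1 v (ee : R -> R) : ccv2 (cur _ S) (cur _ v) ->
  (forall x y, cur _ S x y -> 0 <= cur _ v x y <= M) ->
  mu.-integrable setT (EFin \o ee) ->
  (forall s k E pu pv, slice_data (cur _ S) (cur _ u) (cur _ v) s k E pu pv ->
     ee s <= \int[mu]_r k r) ->
  \int[mu]_s ee s <= 0.
Proof.
move=> cv vM ie h.
have [Nu [mNu Nu0 hu]] := ae_gradient S u M cS cu uM.
have [Nv [mNv Nv0 hv]] := ae_gradient S v M cS cv vM.
pose N := Nu `|` Nv.
have mN : measurable N by exact: measurableU.
have N0 : (mu \x mu)%E N = 0%E.
  apply/eqP; rewrite eq_le measure_ge0 andbT.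
  have H : ((mu \x mu) (Nu `|` Nv) <= (mu \x mu) Nu + (mu \x mu) Nv)%E by exact: measureU2.
  by apply: (le_trans H); rewrite Nu0 Nv0 adde0.
have [tk le0] := resistance_gap S N u v M cS core0 mS bS cu cv uM vM mN N0 (umin _ cv vM).
set k := _ \_ _ in tk le0.
have [A [mA A0 hA]] := null_section1 N mN N0.
apply: le_trans le0; apply: (tame_ge1 _ tk _ A) => // s nA.
apply: (h s (fun r => k (s, r)) (xsection N s) (fun r => grad2 S u (s, r)) (fun r => grad2 S v (s, r))).
split.
- exact: tame_section1.
- by split; [exact: measurable_xsection|exact: hA].
- by move=> r r' iS S'; split; [exact: grad2_slice|exact: grad2_slice].
- move=> r _ nS; rewrite /k patchE memNset// => -[cS' _]; exact: nS.
- move=> r; rewrite /xsection /= => nN iS.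
  have nN' : ~ N (s, r) by move=> hN; apply: nN; rewrite inE.
  have [_ _ s1 _] := hu _ _ iS (fun hh => nN' (or_introl hh)).
  have [_ _ _ s2] := hv _ _ iS (fun hh => nN' (or_intror hh)).
  exists (grad1 S u (s, r)), (grad1 S v (s, r)); split => //.
  by rewrite /k patchE mem_set.
Qed.

Lemma no_better_slices2 v (ee : R -> R) : ccv2 (cur _ S) (cur _ v) ->
  (forall x y, cur _ S x y -> 0 <= cur _ v x y <= M) ->
  mu.-integrable setT (EFin \o ee) ->
  (forall s k E pu pv, slice_data (swap2 _ (cur _ S)) (swap2 _ (cur _ u)) (swap2 _ (cur _ v))
     s k E pu pv -> ee s <= \int[mu]_r k r) ->
  \int[mu]_s ee s <= 0.
Proof.
move=> cv vM ie h.
have [Nu [mNu Nu0 hu]] := ae_gradient S u M cS cu uM.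
have [Nv [mNv Nv0 hv]] := ae_gradient S v M cS cv vM.
pose N := Nu `|` Nv.
have mN : measurable N by exact: measurableU.
have N0 : (mu \x mu)%E N = 0%E.
  apply/eqP; rewrite eq_le measure_ge0 andbT.
  have H : ((mu \x mu) (Nu `|` Nv) <= (mu \x mu) Nu + (mu \x mu) Nv)%E by exact: measureU2.
  by apply: (le_trans H); rewrite Nu0 Nv0 adde0.
have [tk le0] := resistance_gap S N u v M cS core0 mS bS cu cv uM vM mN N0 (umin _ cv vM).
set k := _ \_ _ in tk le0.
have [A [mA A0 hA]] := null_section2 N mN N0.
apply: le_trans le0; apply: (tame_ge2 _ tk _ A) => // s nA.
apply: (h s (fun r => k (r, s)) (ysection N s) (fun r => grad1 S u (r, s)) (fun r => grad1 S v (r, s))).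
have sw x y : inner (swap2 _ (cur _ S)) x y -> inner (cur _ S) y x.
  by move=> /inner_swap.
split.
- exact: tame_section2.
- by split; [exact: measurable_ysection|exact: hA].
- by move=> r r' /sw iS S'; split; [exact: grad1_slice|exact: grad1_slice].
- move=> r _ nS; rewrite /k patchE memNset// => -[cS' _]; apply: nS; exact: inner_swap.
- move=> r; rewrite /ysection /= => nN /sw iS.
  have nN' : ~ N (r, s) by move=> hN; apply: nN; rewrite inE.
  have [_ _ s1 _] := hu _ _ iS (fun hh => nN' (or_introl hh)).
  have [_ _ _ s2] := hv _ _ iS (fun hh => nN' (or_intror hh)).
  exists (grad2 S u (r, s)), (grad2 S v (r, s)); split => //.
  + by rewrite /k patchE mem_set// /density slope_densityC [in X in _ - X]slope_densityC.
  + by move=> x y Sxy; rewrite addrAC; exact: s1.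
  + move=> p q hpq; have [|-> ->//] := s2 q p.
    by move=> x y Sxy; rewrite addrAC; exact: hpq.
Qed.

Variables (a b n1 n2 e kappa T1 T2 : R).
Hypotheses (iab : core S (a, b)) (u0 : 0 < u (a, b)).
Hypotheses (nn : n1 ^+ 2 + n2 ^+ 2 = 1) (k0 : 0 < kappa) (kE : kappa ^+ 2 = 1 + e ^+ 2).
Hypothesis T21 : T2 < T1.
Let gx := ridge_gx n1 n2 e kappa.
Let gy := ridge_gy n1 n2 e kappa.
Hypothesis R1 : forall s r, S (s, r) -> u (s, r) <= u (a, b) + gx T1 * (s - a) + gy T1 * (r - b).
Hypothesis R2 : forall s r, S (s, r) -> u (s, r) <= u (a, b) + gx T2 * (s - a) + gy T2 * (r - b).
Hypothesis R3 : forall v1 v2 eps, 0 < eps -> exists2 h0, 0 < h0 &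
  forall h, 0 < h -> h < h0 ->
  u (a, b) + h * (Num.min (gx T1 * v1 + gy T1 * v2) (gx T2 * v1 + gy T2 * v2) - eps) <=
    u (a + h * v1, b + h * v2).

Lemma min_plane_ccv (t c p q : R) (U : R -> R -> R) (Z : R -> R -> Prop) : ccv2 Z U ->
  ccv2 Z (fun s r => Num.min (U s r) ((1 - t) * (c + p * (s - a) + q * (r - b)))).
Proof.
move=> cU s r s' r' l l01 Zs Zs'; rewrite le_min; have /andP[l0 l1] := l01.
apply/andP; split.
- apply: le_trans (cU _ _ _ _ _ l01 Zs Zs'); rewrite lerD// ler_wpM2l ?subr_ge0//;
  by rewrite ge_min lexx.
- have -> : (1 - t) * (c + p * (l * s + (1 - l) * s' - a) + q * (l * r + (1 - l) * r' - b)) =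
    l * ((1 - t) * (c + p * (s - a) + q * (r - b))) +
    (1 - l) * ((1 - t) * (c + p * (s' - a) + q * (r' - b))) by ring.
  by rewrite lerD// ler_wpM2l ?subr_ge0// ge_min lexx orbT.
Qed.

Lemma ridge_slopes : 2 * T1 * T2 + T1 ^+ 2 <= 1 /\ 2 * T1 * T2 + T2 ^+ 2 <= 1.
Proof.
suff : ~ ((1 < 2 * T1 * T2 + T1 ^+ 2) \/ (1 < 2 * T1 * T2 + T2 ^+ 2)).
  by move=> h; split; rewrite leNgt; apply/negP => lt; apply: h; [left|right].
move=> /(tangent_point _ _ T21)[T0 [T20 T01 L1 L2]].
have [B hB] := bS; have [rho rho0 hbox] := iab.
have hB' x y : cur _ S x y -> `|x| <= B /\ `|y| <= B by move=> /hB.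
have min0 t x y : 0 < t < 1 -> cur _ S x y ->
  0 <= Num.min (u (x, y)) ((1 - t) * cut_plane (cur _ u) a b n1 n2 e kappa T0 x y) <= M.
  move=> /andP[t0 t1] Sxy; have /andP[ux0 uxM] := uM _ _ Sxy.
  have ge := cut_plane_ge (cur _ S) (cur _ u) a b n1 n2 e kappa T0 T1 T2 k0 T20 T01 R1 R2 x y Sxy.
  rewrite le_min ux0 ge_min uxM orTb andbT mulr_ge0 ?subr_ge0 ?(ltW t1)//.
  exact: le_trans ux0 ge.
(* The slices have to cross the projected edge. For [n2 = 0] the lines of constant first coordinate
   are parallel to it, and the coordinates are exchanged. *)
have [n20|n20] := eqVneq n2 0; last first.
  have [t [t01 [ee [iee pos hee]]]] := cut_comparison _ (cur _ S) (cur _ u) M a b rho B n1 n2 e kappa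
    T0 T1 T2 cS cu uM rho0 hbox u0 hB' nn n20 k0 kE T20 T01 L1 L2 R1 R2 R3.
  pose v (y : R * R) := Num.min (u y) ((1 - t) * cut_plane (cur _ u) a b n1 n2 e kappa T0 y.1 y.2).
  have cv : ccv2 (cur _ S) (cur _ v) by exact: min_plane_ccv.
  have vM x y : cur _ S x y -> 0 <= cur _ v x y <= M by exact: min0.
  by have := no_better_slices1 v ee cv vM iee hee; rewrite leNgt pos.
have n10 : n1 != 0.
  by apply/eqP => n10; move: nn; rewrite n10 n20 expr0n /= addr0 => /esym/eqP; rewrite oner_eq0.
(* The exchange of coordinates reverses the orientation of the frame, whence [- e]. *)
have gE T : ridge_gx n2 n1 (- e) kappa T = gy T by rewrite /ridge_gx /gy /ridge_gy; ring.
have gE' T : ridge_gy n2 n1 (- e) kappa T = gx T by rewrite /ridge_gy /gx /ridge_gx; ring.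
have nn' : n2 ^+ 2 + n1 ^+ 2 = 1 by rewrite addrC.
have kE' : kappa ^+ 2 = 1 + (- e) ^+ 2 by rewrite sqrrN.
have [t [t01 [ee [iee pos hee]]]] := cut_comparison _ (swap2 _ (cur _ S)) (swap2 _ (cur _ u)) M b a
    rho B n2 n1 (- e) kappa T0 T1 T2 (cvx2_swap _ cS) (ccv2_swap _ _ cu)
    (fun x y => uM y x) rho0 (fun x y hx hy => hbox y x hy hx) u0
    (fun x y Sxy => let: conj p q := hB' y x Sxy in conj q p)
    nn' n10 k0 kE' T20 T01 L1 L2
    ltac:(by move=> s r Ssr; rewrite gE gE' addrAC; exact: R1)
    ltac:(by move=> s r Ssr; rewrite gE gE' addrAC; exact: R2)
    ltac:(by move=> v1 v2 eps eps0; have [h0 h00 hh] := R3 v2 v1 eps eps0; exists h0 => // h hp hl;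
          rewrite !gE !gE' ![gy _ * _ + _]addrC; exact: hh).
pose v (y : R * R) := Num.min (u y) ((1 - t) * cut_plane (cur _ u) a b n1 n2 e kappa T0 y.1 y.2).
have cv : ccv2 (cur _ S) (cur _ v) by exact: min_plane_ccv.
have vM x y : cur _ S x y -> 0 <= cur _ v x y <= M by exact: min0.
suff : \int[mu]_s ee s <= 0 by rewrite leNgt pos.
apply: (no_better_slices2 v) => // s k E pu pv sd; apply: hee.
suff <- : swap2 _ (cur _ v) = (fun s r => Num.min (swap2 _ (cur _ u) s r)
  ((1 - t) * cut_plane (swap2 _ (cur _ u)) b a n2 n1 (- e) kappa T0 s r)) by exact: sd.
apply/funext => x; apply/funext => y.
by rewrite /swap2 /cur /v /cut_plane gE gE' addrAC.
Qed.

End Minimizer.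

(** * The envelope of admissible planes *)

Section SupportLine.
Context {R : realType}.

Lemma sqr_shift_ge1 (x m : R) : x ^+ 2 < 1 -> `|m| = 1 -> 1 <= (x + 2 * m) ^+ 2.
Proof.
  move=> x1 m1'; have mm : m ^+ 2 = 1 by rewrite -real_normK ?num_real// m1' expr1n.
  have n1 : `|x| < 1 by rewrite -(@ltr_pXn2r _ 2) ?nnegrE// expr1n real_normK ?num_real.
  have xm : - `|x| <= x * m.
    by have := ler_norm (- (x * m)); rewrite normrN normrM m1' mulr1; lra.
  have n2 : `|x| ^+ 2 = x ^+ 2 by rewrite real_normK ?num_real.
  have f1 : 0 <= 1 - `|x| by rewrite subr_ge0 ltW.
  have f2 : 0 <= 3 - `|x| by lra.
  have := mulr_ge0 f1 f2.
  have -> : (1 - `|x|) * (3 - `|x|) = `|x| ^+ 2 - 4 * `|x| + 3 by ring.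
  have -> : (x + 2 * m) ^+ 2 = x ^+ 2 + 4 * (x * m) + 4 * m ^+ 2 by ring.
  by lra.
Qed.

Lemma support_line (S : R -> R -> Prop) (x c al sg : R) : cvx2 S -> inner S x c ->
  (forall z, S z c -> 0 <= sg * (z - al)) ->
  exists p, forall z1 z2, S z1 z2 -> 0 <= sg * (z1 - al) + p * (z2 - c).
Proof.
move=> cS [r r0 hr] h.
have [||||p hp] := @separating_slope R (fun b z => exists2 z1, S z1 (c + b) & z = - (sg * (z1 - al))).
- exists (r / 2), (- (sg * (x - al))); split; first by rewrite divr_gt0.
  exists x => //; apply: hr; first by rewrite subrr normr0.
  by rewrite addrC addKr gtr0_norm ?divr_gt0// ltr_pdivrMr//; lra.
- exists (- (r / 2)), (- (sg * (x - al))); split; first by rewrite oppr_lt0 divr_gt0.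
  exists x => //; apply: hr; first by rewrite subrr normr0.
  by rewrite addrC addKr normrN gtr0_norm ?divr_gt0// ltr_pdivrMr//; lra.
- by move=> z [z1]; rewrite addr0 => /h hz ->; rewrite oppr_le0.
- move=> b z b' z' b0 b'0 [z1 S1 ->] [z2 S2 ->].
  have d0 : 0 < b - b' by lra.
  pose t := b / (b - b').
  have t01 : 0 <= t <= 1.
    by rewrite /t ler_pdivrMr// mul1r; apply/andP; split; [rewrite divr_ge0// ltW|lra].
  have := cS _ _ _ _ _ t01 S2 S1.
  have -> : t * (c + b') + (1 - t) * (c + b) = c by rewrite /t; field; rewrite gt_eqF.
  move=> /h; rewrite -(pmulr_rge0 _ d0).
  have -> : (b - b') * (sg * (t * z2 + (1 - t) * z1 - al)) =
    b * (sg * (z2 - al)) - b' * (sg * (z1 - al)) by rewrite /t; field; rewrite gt_eqF.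
  by move=> ?; lra.
exists p => z1 z2 Sz.
have : - (sg * (z1 - al)) <= p * (z2 - c).
  by apply: hp; exists z1 => //; rewrite addrC subrK.
lra.
Qed.

End SupportLine.

Section Envelope.
Context {R : realType}.
Variables (S : set (R * R)) (u : R * R -> R) (M B s1 s2 : R).
Hypotheses (cS : cvx2 (cur _ S)) (cu : ccv2 (cur _ S) (cur _ u)).
Hypothesis uM : forall x y, cur _ S x y -> 0 <= cur _ u x y <= M.
Hypothesis hB : forall y, S y -> `|y.1| <= B /\ `|y.2| <= B.
Hypothesis s_small : 4 * (s1 ^+ 2 + s2 ^+ 2) < 1.

Definition allowed (p q : R) :=
  1 <= p ^+ 2 + q ^+ 2 \/ slope_density p q <= 1 - (s1 * p + s2 * q).

Definition majorant (p q c : R) := forall z, S z -> u z <= c + p * z.1 + q * z.2.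

Definition envelope_values (y : R * R) : set R :=
  [set w | exists p q c, [/\ allowed p q, majorant p q c & w = c + p * y.1 + q * y.2]].

Definition envelope (y : R * R) : R := inf (envelope_values y).

(** Cleared of denominators, both alternatives are polynomial, so the allowed gradients visibly form
    a closed set. *)
Lemma allowed_iff p q : allowed p q <->
  1 <= p ^+ 2 + q ^+ 2 \/ 1 <= (1 - (s1 * p + s2 * q)) * (1 + p ^+ 2 + q ^+ 2).
Proof.
have D0 : 0 < 1 + p ^+ 2 + q ^+ 2 by have := sqr_ge0 p; have := sqr_ge0 q; lra.
by rewrite /allowed /slope_density -ler_pdivrMr// div1r.
Qed.

(** The horizontal plane of height [M] thus competes in the infimum, which keeps the envelope below
    [M]. *)
Lemma allowed00 : allowed 0 0.
Proof. by right; rewrite /slope_density expr0n /= !mulr0 !addr0 subr0 invr1. Qed.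

Let lbv y : S y -> lbound (envelope_values y) (u y).
Proof. by move=> Sy _ [p [q [c [_ hm ->]]]]; exact: hm. Qed.

Let vM y : S y -> envelope_values y M.
Proof.
move=> _; exists 0, 0, M; split; [exact: allowed00| |by rewrite !mul0r !addr0].
by move=> [z1 z2] Sz; rewrite !mul0r !addr0; case/andP: (uM _ _ Sz).
Qed.

Lemma envelope_ge y : S y -> u y <= envelope y.
Proof.
by move=> Sy; apply: lb_le_inf; [exists M; exact: vM|exact: lbv].
Qed.

Lemma envelope_le_plane y p q c : S y -> allowed p q -> majorant p q c ->
  envelope y <= c + p * y.1 + q * y.2.
Proof. by move=> Sy hA hm; apply: ge_inf; [exists (u y); exact: lbv|exists p, q, c]. Qed.

Lemma envelope_bound x y : cur _ S x y -> 0 <= cur _ envelope x y <= M.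
Proof.
move=> Sy; apply/andP; split.
  by apply: le_trans (envelope_ge _ Sy); case/andP: (uM _ _ Sy).
by apply: ge_inf; [exists (u (x, y)); exact: lbv|exact: vM].
Qed.

Lemma envelope_ccv : ccv2 (cur _ S) (cur _ envelope).
Proof.
move=> a b a' b' t /andP[t0 t1] Sab Sab'; apply: lb_le_inf.
  by exists M; apply: vM; apply: cS => //; rewrite t0.
move=> _ [p [q [c [hA hm ->]]]] /=.
have h1 := envelope_le_plane _ _ _ _ Sab hA hm.
have h2 := envelope_le_plane _ _ _ _ Sab' hA hm.
have -> : c + p * (t * a + (1 - t) * a') + q * (t * b + (1 - t) * b') =
  t * (c + p * a + q * b) + (1 - t) * (c + p * a' + q * b') by ring.
by rewrite lerD// ler_wpM2l// subr_ge0.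
Qed.

(** If a supporting plane of [u] at [y] has a gradient shorter than 1, twice the given affine
    function is added to it: the sum still majorizes [u], and its gradient has length at least 1, so
    it is allowed. This is the quantitative form of equality on the boundary. *)
Lemma envelope_support_bound y n0 m1 m2 : core S y ->
  (forall z, S z -> 0 <= n0 + m1 * z.1 + m2 * z.2) -> `|m1| = 1 \/ `|m2| = 1 ->
  envelope y <= u y + 2 * (n0 + m1 * y.1 + m2 * y.2).
Proof.
case: y => y1 y2 Cy hn hm; have Sy : S (y1, y2) := inner_sub _ _ _ Cy.
have [p [q hpq]] := sgrad_exists _ _ _ _ cS cu Cy.
have N0 := hn _ Sy; rewrite /= in N0.
have maj : majorant p q (u (y1, y2) - p * y1 - q * y2).
  by move=> [z1 z2] Sz; have := hpq _ _ Sz; rewrite /cur /=; lra.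
have [big|small] := lerP 1 (p ^+ 2 + q ^+ 2).
  apply: le_trans (envelope_le_plane _ _ _ _ Sy (or_introl big) maj) _ => /=.
  by rewrite /=; lra.
have p1 : p ^+ 2 < 1 by have := sqr_ge0 q; lra.
have q1 : q ^+ 2 < 1 by have := sqr_ge0 p; lra.
have hA : allowed (p + 2 * m1) (q + 2 * m2).
  left; case: hm => hm.
  - by have := sqr_shift_ge1 _ _ p1 hm; have := sqr_ge0 (q + 2 * m2); lra.
  - by have := sqr_shift_ge1 _ _ q1 hm; have := sqr_ge0 (p + 2 * m1); lra.
have maj' : majorant (p + 2 * m1) (q + 2 * m2) (u (y1, y2) - p * y1 - q * y2 + 2 * n0).
  by move=> z Sz; have := maj z Sz; have := hn z Sz; lra.
by have := envelope_le_plane _ _ _ _ Sy hA maj' => /=; lra.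
Qed.

(** The majorants with allowed gradient and value at most [M] at [y] form a compact set: they are
    nonnegative on a box around [y], which bounds their gradients, and every condition is closed. *)
Lemma envelope_attained y : core S y -> exists p q c,
  [/\ allowed p q, majorant p q c & envelope y = c + p * y.1 + q * y.2].
Proof.
move=> Cy; have Sy : S y by case: y Cy => y1 y2; exact: inner_sub.
have [r r0 hr] := Cy.
have M0 : 0 <= M by case: (y) Sy => y1 y2 /uM /andP[]; exact: le_trans.
pose val (x : (R^o * R^o * R^o)%type) : R := x.2 + x.1.1 * y.1 + x.1.2 * y.2.
pose K : set ((R^o * R^o * R^o)%type) := [set x | [/\ allowed x.1.1 x.1.2, majorant x.1.1 x.1.2 x.2 & val x <= M]].
pose C1 := 2 * M / r; pose C2 := M + 2 * (C1 * B).
have sub : K `<=` (`[- C1, C1]%classic `*` `[- C1, C1]%classic) `*` `[- C2, C2]%classic.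
  move=> [[p q] c] [_ /= hm]; rewrite /val /= => hv.
  have g (z1 z2 : R) : `|z1| < r -> `|z2| < r -> 0 <= M + p * z1 + q * z2.
    move=> h1 h2; have Sz : S (y.1 + z1, y.2 + z2) by apply: hr; rewrite addrC addKr.
    have := hm _ Sz; have /andP[] := uM _ _ Sz; rewrite /cur /=; lra.
  have bd (x : R) : 0 <= M + x * (r / 2) -> 0 <= M - x * (r / 2) -> - C1 <= x <= C1.
    have -> : C1 = M / (r / 2) by rewrite /C1; field; rewrite gt_eqF.
    have r2 : 0 < r / 2 by rewrite divr_gt0.
    by move=> i1 i2; apply/andP; split; [rewrite lerNl ler_pdivlMr|rewrite ler_pdivlMr]; lra.
  have rr : `|r / 2| < r by rewrite gtr0_norm ?divr_gt0//; lra.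
  have rr' : `|- (r / 2)| < r by rewrite normrN.
  have z0 : `|0 : R| < r by rewrite normr0.
  have hp : - C1 <= p <= C1.
    apply: bd; [have := g _ _ rr z0|have := g _ _ rr' z0]; rewrite mulr0 addr0 ?mulrN//.
  have hq : - C1 <= q <= C1.
    apply: bd; [have := g _ _ z0 rr|have := g _ _ z0 rr']; rewrite mulr0 addr0 ?mulrN//.
  have [b1 b2] := hB _ Sy.
  have prod (x z : R) : - C1 <= x <= C1 -> `|z| <= B -> `|x * z| <= C1 * B.
    by move=> hx hz; rewrite normrM ler_pM// ler_norml.
  have := prod _ _ hp b1; have := prod _ _ hq b2; rewrite !ler_norml => P1 P2.
  have lo : 0 <= c + p * y.1 + q * y.2.
    by apply: le_trans (hm _ Sy); case: (y) Sy => y1 y2 /uM /andP[].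
  do !split; rewrite /= in_itv //=; rewrite /C2; lra.
have cont1 : continuous (fun x : (R^o * R^o * R^o)%type => x.1.1 : R).
  by move=> x; apply: cvg_comp; [exact: cvg_fst|exact: cvg_fst].
have cont2 : continuous (fun x : (R^o * R^o * R^o)%type => x.1.2 : R).
  by move=> x; apply: cvg_comp; [exact: cvg_fst|exact: cvg_snd].
have cont3 : continuous (fun x : (R^o * R^o * R^o)%type => x.2 : R) by move=> x; exact: cvg_snd.
have contl (a1 a2 : R) : continuous (fun x : (R^o * R^o * R^o)%type => x.2 + x.1.1 * a1 + x.1.2 * a2 : R).
  move=> x; apply: cvgD; first apply: cvgD; first exact: cont3.
  - by apply: cvgM; [exact: cont1|exact: cvg_cst].
  - by apply: cvgM; [exact: cont2|exact: cvg_cst].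
have cle (f : (R^o * R^o * R^o)%type -> R) (m : R) : continuous f -> closed [set x | m <= f x].
  by move=> cf; apply: (@preimage_closed _ _ f [set z | m <= z]) => //; exact: closed_ge.
have contq : continuous (fun x : (R^o * R^o * R^o)%type => x.1.1 ^+ 2 + x.1.2 ^+ 2 : R).
  move=> x; apply: cvgD; rewrite expr2; under eq_fun do rewrite expr2.
  - by apply: cvgM; exact: cont1.
  - by apply: cvgM; exact: cont2.
have contp : continuous (fun x : (R^o * R^o * R^o)%type =>
    (1 - (s1 * x.1.1 + s2 * x.1.2)) * (1 + (x.1.1 ^+ 2 + x.1.2 ^+ 2)) : R).
  move=> x; apply: cvgM; last by apply: cvgD; [exact: cvg_cst|exact: contq].
  apply: cvgB; first exact: cvg_cst.
  apply: cvgD; apply: cvgM; try exact: cvg_cst; [exact: cont1|exact: cont2].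
have KE : K = ([set x | 1 <= x.1.1 ^+ 2 + x.1.2 ^+ 2] `|`
     [set x | 1 <= (1 - (s1 * x.1.1 + s2 * x.1.2)) * (1 + (x.1.1 ^+ 2 + x.1.2 ^+ 2))]) `&`
     \bigcap_(z in S) [set x | u z <= x.2 + x.1.1 * z.1 + x.1.2 * z.2] `&`
     [set x | - M <= - val x].
  apply/seteqP; split => x.
  - by move=> [/allowed_iff h1 h2 h3]; split; [split|rewrite /= lerN2] => //;
      case: h1 => h1; [left|right] => //=; rewrite addrA.
  - move=> [[h1 h2]]; rewrite /= lerN2 => h3; split => //.
    by apply/allowed_iff; case: h1 => /= h1; [left|right] => //; rewrite -addrA.
have clK : closed K.
  rewrite KE; apply: closedI; first apply: closedI.
  - by apply: closedU; exact: cle.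
  - by apply: closed_bigI => z _; exact: (cle (fun x => x.2 + x.1.1 * z.1 + x.1.2 * z.2)).
  - by apply: cle => x; apply: cvgN; exact: contl.
have cK : compact K.
  apply: subclosed_compact clK _ sub; apply: compact_setX; last exact: segment_compact.
  by apply: compact_setX; exact: segment_compact.
have K0 : K !=set0.
  exists ((0, 0), M); split => /=; first exact: allowed00.
  - by move=> [z1 z2] Sz; rewrite /= !mul0r !addr0; case/andP: (uM _ _ Sz).
  - by rewrite /val /= !mul0r !addr0.
have [[[p q] c] /set_mem [h1 h2 h3] hmin] := compact_EVT_min K0 cK
  (continuous_subspaceT (contl y.1 y.2)).
exists p, q, c; split => //; apply/eqP; rewrite eq_le; apply/andP; split.
  exact: envelope_le_plane.
apply: lb_le_inf; first by exists M; exact: vM.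
move=> _ [p' [q' [c' [hA hm ->]]]].
have [le|lt] := lerP (c' + p' * y.1 + q' * y.2) M; last exact: le_trans h3 (ltW lt).
by apply: (hmin ((p', q'), c')); apply/mem_set; split.
Qed.

Lemma envelope_sgrad y p q c : S y -> allowed p q -> majorant p q c ->
  envelope y = c + p * y.1 + q * y.2 -> sgrad (cur _ S) (cur _ envelope) y.1 y.2 p q.
Proof.
case: y => y1 y2 Sy hA hm E a b Sab; rewrite /cur E /=.
by have := envelope_le_plane _ _ _ _ Sab hA hm; rewrite /=; lra.
Qed.

Lemma touching_allowed y p q c : majorant p q c -> u y = c + p * y.1 + q * y.2 ->
  sgrad (cur _ S) (cur _ u) y.1 y.2 p q.
Proof. by case: y => y1 y2 hm E a b Sab; have := hm _ Sab; rewrite /cur E /=; lra. Qed.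

Lemma not_allowed_of_lt y p q : S y -> u y < envelope y ->
  sgrad (cur _ S) (cur _ u) y.1 y.2 p q -> ~ allowed p q.
Proof.
case: y => y1 y2 Sy lt sg hA.
have hm : majorant p q (u (y1, y2) - p * y1 - q * y2).
  by move=> [z1 z2] Sz; have := sg _ _ Sz; rewrite /cur /=; lra.
by have := envelope_le_plane _ _ _ _ Sy hA hm => /=; lra.
Qed.

Lemma not_allowedP p q : ~ allowed p q ->
  p ^+ 2 + q ^+ 2 < 1 /\ 1 - (s1 * p + s2 * q) < slope_density p q.
Proof.
by move=> h; split; rewrite ltNge; apply/negP => le; apply: h; [left|right].
Qed.

(* A steeper contact plane could be tilted towards a supporting plane of [u]. *)
Lemma envelope_slope y p q c : core S y -> u y < envelope y -> allowed p q ->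
  majorant p q c -> envelope y = c + p * y.1 + q * y.2 ->
  p ^+ 2 + q ^+ 2 <= 1 /\ slope_density p q <= 1 - (s1 * p + s2 * q).
Proof.
case: y => y1 y2 Cy lt hA hm E; have Sy : S (y1, y2) := inner_sub _ _ _ Cy.
have le1 : p ^+ 2 + q ^+ 2 <= 1.
  rewrite leNgt; apply/negP => gt1.
  have [p0 [q0 h0]] := sgrad_exists _ _ _ _ cS cu Cy.
  pose c0 := u (y1, y2) - p0 * y1 - q0 * y2.
  have hm0 : majorant p0 q0 c0.
    by move=> [z1 z2] Sz; have := h0 _ _ Sz; rewrite /cur /c0 /=; lra.
  pose D := `|p * (p0 - p) + q * (q0 - q)|.
  have D00 : 0 <= D by rewrite normr_ge0.
  have D0 : 0 < 2 * D + 1 by lra.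
  (* A move by the fraction [t] towards the supporting plane lowers the squared length by at most
     [2 * t * D], so it stays at least 1. *)
  pose t := Num.min (1 / 2) ((p ^+ 2 + q ^+ 2 - 1) / (2 * D + 1)).
  have t0 : 0 < t by rewrite lt_min !divr_gt0// subr_gt0.
  have t1 : t <= 1 / 2 by rewrite ge_min lexx.
  have t2 : t * (2 * D + 1) <= p ^+ 2 + q ^+ 2 - 1.
    by rewrite -ler_pdivlMr// ge_min lexx orbT.
  have hA' : allowed (p + t * (p0 - p)) (q + t * (q0 - q)).
    left.
    have -> : (p + t * (p0 - p)) ^+ 2 + (q + t * (q0 - q)) ^+ 2 = p ^+ 2 + q ^+ 2 +
      2 * t * (p * (p0 - p) + q * (q0 - q)) + ((t * (p0 - p)) ^+ 2 + (t * (q0 - q)) ^+ 2) by ring.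
    have e1 : - (t * D) <= t * (p * (p0 - p) + q * (q0 - q)).
      by rewrite -mulrN ler_pM2l// lerNl; apply: le_trans (ler_norm _) _; rewrite normrN.
    have := sqr_ge0 (t * (p0 - p)); have := sqr_ge0 (t * (q0 - q)).
    have E3 : t * (2 * D + 1) = 2 * (t * D) + t by ring.
    by rewrite E3 in t2; lra.
  have hm' : majorant (p + t * (p0 - p)) (q + t * (q0 - q)) (c + t * (c0 - c)).
    move=> z Sz; have i1 := hm z Sz; have i2 := hm0 z Sz.
    have w1 : 0 <= 1 - t by lra.
    have := ler_wpM2l w1 i1; have := ler_wpM2l (ltW t0) i2.
    by lra.
  have := envelope_le_plane _ _ _ _ Sy hA' hm'; rewrite E /=.
  have -> : c + t * (c0 - c) + (p + t * (p0 - p)) * y1 + (q + t * (q0 - q)) * y2 =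
    (c + p * y1 + q * y2) - t * ((c + p * y1 + q * y2) - (c0 + p0 * y1 + q0 * y2)) by ring.
  have -> : c0 + p0 * y1 + q0 * y2 = u (y1, y2) by rewrite /c0; ring.
  move: lt; rewrite E /= => lt.
  have := mulr_gt0 t0 (_ : 0 < c + p * y1 + q * y2 - u (y1, y2)); rewrite subr_gt0 => /(_ lt).
  by lra.
split => //; case: hA => // ge1.
(* Only the unit circle is left. The density is [1 / 2] there, and [s_small] bounds
   [s1 * p + s2 * q] by [1 / 2]. *)
have e1 : p ^+ 2 + q ^+ 2 = 1 by apply/eqP; rewrite eq_le le1.
have -> : slope_density p q = 2^-1 by rewrite /slope_density -addrA e1.
have cs : (s1 * p + s2 * q) ^+ 2 <= s1 ^+ 2 + s2 ^+ 2.
  have := sqr_ge0 (s1 * q - s2 * p).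
  have : (s1 * p + s2 * q) ^+ 2 + (s1 * q - s2 * p) ^+ 2 = s1 ^+ 2 + s2 ^+ 2.
    rewrite -[RHS]mulr1 -e1; ring.
  by lra.
have : s1 * p + s2 * q <= 2^-1.
  rewrite leNgt; apply/negP => gt.
  have : (2^-1 : R) ^+ 2 < (s1 * p + s2 * q) ^+ 2.
    by rewrite ltr_pXn2r// ?nnegrE ?invr_ge0// ltW// (lt_trans _ gt)// invr_gt0.
  have -> : (2^-1 : R) ^+ 2 = 1 / 4 by field.
  have := s_small; lra.
have -> : (2^-1 : R) = 1 / 2 by field.
lra.
Qed.

End Envelope.

(** * Gradients with equal integrals *)

Section BalancedSlices.
Context {R : realType}.
Local Notation mu := (@lebesgue_measure R).

Variables (Z : R -> R -> Prop) (U V : R -> R -> R) (B c : R).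
Hypotheses (cZ : cvx2 Z) (hB : forall x y, Z x y -> `|x| <= B).
Variables (k p q : R -> R) (E : set R).
Hypotheses (ik : mu.-integrable setT (EFin \o k)) (mE : measurable E) (E0 : mu E = 0%E).
Hypothesis selV : forall r r', inner Z r c -> Z r' c -> V r' c <= V r c + p r * (r' - r).
Hypothesis selU : forall r r', inner Z r c -> Z r' c -> U r' c <= U r c + q r * (r' - r).
Hypothesis kout : forall r, ~ E r -> ~ inner Z r c -> k r = 0.
Hypothesis kin : forall r, ~ E r -> inner Z r c -> k r = p r - q r /\ - 2 <= k r.
Hypothesis edge : forall r sg al m, inner Z r c -> `|sg| = 1 ->
  (forall z1 z2, Z z1 z2 -> 0 <= sg * (z1 - al) + m * (z2 - c)) ->
  `|V r c - U r c| <= 2 * (sg * (r - al)).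

(** The inner part of the slice is an open interval; a supporting line of [Z] through each of its
    ends turns [edge] into the linear bounds required by [slice_balance]. *)
Lemma slice_integral_ge0 : 0 <= \int[mu]_r k r.
Proof.
have [[x ix]|nex] := pselect (exists x, inner Z x c); last first.
  have k1 r : ~ E r -> k r = 0 by move=> nE; apply: kout => // ir; apply: nex; exists r.
  have := @slice_cut _ k (cst 0) (cst 0) (cst 0) (cst 0) E 0 0 0 0 0 0 ik mE E0.
  rewrite !subrr !mul0r subrr lexx; apply => //.
  - by move=> *; rewrite /cst mul0r addr0.
  - by move=> *; rewrite /cst mul0r addr0.
  - by move=> r nE _; rewrite k1.
  - by move=> r nE _; rewrite k1// subr0 mul0r.
  - by move=> r nE _; rewrite k1// subr0 mul0r.
pose I := [set r | inner Z r c].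
have IB r : I r -> - B <= r <= B by move=> /inner_sub /hB; rewrite ler_norml.
have I0 : I !=set0 by exists x.
have hs : has_sup I by split => //; exists B => r /IB /andP[].
have hi : has_inf I by split => //; exists (- B) => r /IB /andP[].
pose al := inf I; pose be := sup I.
have Iopen r : I r -> exists2 d, 0 < d & I (r - d) /\ I (r + d).
  move=> [d d0 hd]; exists (d / 2); first by rewrite divr_gt0.
  have d2 : 0 < d / 2 by rewrite divr_gt0.
  have dd : d / 2 < d by lra.
  have aux z : `|z - r| <= d / 2 -> I z.
    move=> hz; exists (d / 2) => // a b ha hb; apply: hd; last by lra.
    by have := ler_normD (a - z) (z - r); rewrite addrA subrK; lra.
  by split; apply: aux; rewrite addrAC subrr add0r ?normrN gtr0_norm.
have Il r : I r -> al < r.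
  move=> /Iopen[d d0 [h _]]; apply: (@le_lt_trans _ _ (r - d)); last by lra.
  by apply: ge_inf => //; case: hi.
have Ir r : I r -> r < be.
  move=> /Iopen[d d0 [_ h]]; apply: (@lt_le_trans _ _ (r + d)); first by lra.
  by apply: ub_le_sup => //; case: hs.
have Iconv r r' z : I r -> I r' -> r <= z <= r' -> I z.
  move=> ir ir' /andP[rz zr]; have [->//|ne] := eqVneq z r'.
  have d0 : 0 < r' - r by rewrite subr_gt0 (le_lt_trans rz)// lt_neqAle ne.
  pose t := (r' - z) / (r' - r).
  have t01 : 0 <= t <= 1 by rewrite /t divr_ge0 ?ler_pdivrMr; lra.
  have := inner_cvx _ cZ _ _ _ _ _ t01 ir ir'.
  have -> : t * r + (1 - t) * r' = z by rewrite /t; field; rewrite gt_eqF.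
  by have -> : t * c + (1 - t) * c = c by ring.
have Iin z : al < z < be -> I z.
  move=> /andP[lz zb].
  have zl : 0 < z - al by rewrite subr_gt0.
  have zr : 0 < be - z by rewrite subr_gt0.
  have [r1 i1 h1] := inf_adherent zl hi; have [r2 i2 h2] := sup_adherent zr hs.
  apply: (Iconv r1 r2) => //; rewrite -/al in h1; rewrite -/be in h2; lra.
have closer z t : Z z c -> 0 < t <= 1 -> I (t * x + (1 - t) * z).
  move=> Zz t01; have := inner_conv _ _ _ _ _ _ cZ t01 ix Zz.
  by have -> : t * c + (1 - t) * c = c by ring.
have Zl z : Z z c -> 0 <= 1 * (z - al).
  move=> Zz; rewrite mul1r subr_ge0 leNgt; apply/negP => lt.
  have xl := Il _ ix.
  have d0 : 0 < x - z by lra.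
  pose t := (al - z) / (2 * (x - z)).
  have t01 : 0 < t <= 1 by rewrite /t divr_gt0 ?ler_pdivrMr; lra.
  have := Il _ (closer z t Zz t01).
  have -> : t * x + (1 - t) * z = z + (al - z) / 2 by rewrite /t; field; rewrite gt_eqF.
  lra.
have Zr z : Z z c -> 0 <= -1 * (z - be).
  move=> Zz; rewrite mulN1r oppr_ge0 subr_le0 leNgt; apply/negP => lt.
  have xr := Ir _ ix.
  have d0 : 0 < z - x by lra.
  pose t := (z - be) / (2 * (z - x)).
  have t01 : 0 < t <= 1 by rewrite /t divr_gt0 ?ler_pdivrMr; lra.
  have := Ir _ (closer z t Zz t01).
  have -> : t * x + (1 - t) * z = z - (z - be) / 2 by rewrite /t; field; rewrite gt_eqF.
  lra.
have [m1 hm1] := support_line _ _ _ _ _ cZ ix Zl.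
have [m2 hm2] := support_line _ _ _ _ _ cZ ix Zr.
have ab : al < be := lt_trans (Il _ ix) (Ir _ ix).
have two0 : 0 <= 2 :> R by [].
apply: (@slice_balance _ k (V^~ c) (U^~ c) p q E al be 2 2) => //.
- by move=> r r' /Iin h1 /Iin h2; apply: selV => //; exact: inner_sub.
- by move=> r r' /Iin h1 /Iin h2; apply: selU => //; exact: inner_sub.
- move=> r /Iin h; rewrite -[r - al]mul1r; exact: (edge _ _ _ m1 h (normr1 _)).
- move=> r /Iin h.
  have -> : be - r = -1 * (r - be) by ring.
  exact: (edge _ _ _ m2 h (normrN1 _)).
- move=> r nE out; rewrite kout// => ir; move/negP: out; apply.
  by rewrite (Il _ ir) (Ir _ ir).
- by move=> r nE /Iin; exact: kin.
Qed.

End BalancedSlices.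

Section BalancedGradients.
Context {R : realType}.
Local Notation mu := (@lebesgue_measure R).
Variables (S N : set (R * R)) (f g : R * R -> R) (M : R).
Hypotheses (cS : cvx2 (cur _ S)) (mS : measurable S) (bS : bounded_set2 S).
Hypotheses (cf : ccv2 (cur _ S) (cur _ f)) (cg : ccv2 (cur _ S) (cur _ g)).
Hypothesis fM : forall x y, cur _ S x y -> 0 <= cur _ f x y <= M.
Hypothesis gM : forall x y, cur _ S x y -> 0 <= cur _ g x y <= M.
Hypotheses (mN : measurable N) (N0 : (mu \x mu)%E N = 0%E).
Hypothesis edge : forall y n0 m1 m2, core S y ->
  (forall z, S z -> 0 <= n0 + m1 * z.1 + m2 * z.2) -> `|m1| = 1 \/ `|m2| = 1 ->
  `|f y - g y| <= 2 * (n0 + m1 * y.1 + m2 * y.2).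
Hypothesis near : forall y, core S y -> ~ N y ->
  `|grad1 S f y - grad1 S g y| <= 2 /\ `|grad2 S f y - grad2 S g y| <= 2.

Let mO := core_measurable S.
Let mD : measurable (core S `\` N). Proof. exact: measurableD. Qed.
Let sub : core S `\` N `<=` core S. Proof. by move=> y []. Qed.
Let bD : bounded_set2 (core S `\` N).
Proof. by have [B hB] := bS; exists B => -[a b] [/inner_sub /hB]. Qed.

Lemma tame_grad1_diff : tame ((fun y => grad1 S f y - grad1 S g y) \_ (core S `\` N)).
Proof.
apply: (@tame_restrict _ _ _ 2) => //; last by move=> y [Cy nN]; case: (near y Cy nN).
apply: measurable_funB; apply: measurable_funS mO sub _.
- exact: measurable_grad1 cS cf fM.
- exact: measurable_grad1 cS cg gM.
Qed.

Lemma tame_grad2_diff : tame ((fun y => grad2 S f y - grad2 S g y) \_ (core S `\` N)).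
Proof.
apply: (@tame_restrict _ _ _ 2) => //; last by move=> y [Cy nN]; case: (near y Cy nN).
apply: measurable_funB; apply: measurable_funS mO sub _.
- exact: measurable_grad2 cS cf fM.
- exact: measurable_grad2 cS cg gM.
Qed.

Let zero_integrable : mu.-integrable setT (EFin \o (fun=> 0 : R)).
Proof. exact: integrable0. Qed.

Let zero_integral : \int[mu]_x (fun=> 0 : R) x = 0.
Proof. by rewrite Rintegral_cst// mul0r. Qed.

(** The assumptions are symmetric in [f] and [g], so the exchange of the two turns this inequality
    into an equality. *)
Lemma grad1_diff_ge0 :
  0 <= \int[(mu \x mu)%E]_z ((fun y => grad1 S f y - grad1 S g y) \_ (core S `\` N)) z.
Proof.
have [B hB] := bS; have [A [mA A0 hA]] := null_section2 N mN N0.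
rewrite -zero_integral; apply: (tame_ge2 _ tame_grad1_diff _ A) => // c nA.
apply: (slice_integral_ge0 (cur _ S) (cur _ g) (cur _ f) B c cS _ _
  (fun r => grad1 S f (r, c)) (fun r => grad1 S g (r, c)) (ysection N c)).
- by move=> x y /hB[].
- exact: (tame_section2 _ tame_grad1_diff).
- exact: measurable_ysection.
- exact: hA.
- by move=> r r'; exact: grad1_slice.
- by move=> r r'; exact: grad1_slice.
- by move=> r _ nC; rewrite patchE memNset// => -[].
- move=> r; rewrite /ysection /= inE => nN ir; rewrite patchE mem_set//; split => //.
  by have [+ _] := near (r, c) ir nN; rewrite ler_norml => /andP[].
- move=> r sg al m ir sg1 h.
  have := edge (r, c) (- (sg * al) - m * c) sg m ir.
  have -> : - (sg * al) - m * c + sg * (r, c).1 + m * (r, c).2 = sg * (r - al) by rewrite /=; ring.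
  apply; last by left.
  move=> [z1 z2] Sz; have := h _ _ Sz.
  by have -> : - (sg * al) - m * c + sg * (z1, z2).1 + m * (z1, z2).2 =
    sg * (z1 - al) + m * (z2 - c) by rewrite /=; ring.
Qed.

Lemma grad2_diff_ge0 :
  0 <= \int[(mu \x mu)%E]_z ((fun y => grad2 S f y - grad2 S g y) \_ (core S `\` N)) z.
Proof.
have [B hB] := bS; have [A [mA A0 hA]] := null_section1 N mN N0.
rewrite -zero_integral; apply: (tame_ge1 _ tame_grad2_diff _ A) => // c nA.
apply: (slice_integral_ge0 (swap2 _ (cur _ S)) (swap2 _ (cur _ g)) (swap2 _ (cur _ f)) B c
  (cvx2_swap _ cS) _ _
  (fun r => grad2 S f (c, r)) (fun r => grad2 S g (c, r)) (xsection N c)).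
- by move=> x y /hB[].
- exact: (tame_section1 _ tame_grad2_diff).
- exact: measurable_xsection.
- exact: hA.
- by move=> r r' /inner_swap; exact: grad2_slice.
- by move=> r r' /inner_swap; exact: grad2_slice.
- by move=> r _ nC; rewrite patchE memNset// => -[] /inner_swap.
- move=> r; rewrite /xsection /= inE => nN /inner_swap ir; rewrite patchE mem_set//; split => //.
  by have [_ +] := near (c, r) ir nN; rewrite ler_norml => /andP[].
- move=> r sg al m /inner_swap ir sg1 h.
  have := edge (c, r) (- (sg * al) - m * c) m sg ir.
  have -> : - (sg * al) - m * c + m * (c, r).1 + sg * (c, r).2 = sg * (r - al) by rewrite /=; ring.
  apply; last by right.
  move=> [z1 z2] Sz; have := h _ _ Sz.
  by have -> : - (sg * al) - m * c + m * (z1, z2).1 + sg * (z1, z2).2 =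
    sg * (z2 - al) + m * (z1 - c) by rewrite /=; ring.
Qed.

End BalancedGradients.

Lemma tilt_gain {R : realType} (s1 s2 p q p' q' d d' kap : R) :
  d' <= 1 - (s1 * p' + s2 * q') -> kap <= d - (1 - (s1 * p + s2 * q)) ->
  s1 * (p' - p) + s2 * (q' - q) + kap <= d - d'.
Proof. by lra. Qed.

(** * Minimality against the envelope *)

Section FlatFaces.
Context {R : realType}.
Local Notation mu := (@lebesgue_measure R).
Variables (S : set (R * R)) (u : R * R -> R) (M : R).
Hypotheses (cS : cvx2 (cur _ S)) (cu : ccv2 (cur _ S) (cur _ u)).
Hypothesis uM : forall x y, cur _ S x y -> 0 <= cur _ u x y <= M.
Hypotheses (core0 : core S !=set0) (mS : measurable S) (bS : bounded_set2 S).
Hypothesis umin : forall v, ccv2 (cur _ S) (cur _ v) ->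
  (forall x y, cur _ S x y -> 0 <= cur _ v x y <= M) ->
  (resistance S u <= resistance S v)%E.
Variables (s1 s2 : R).
Hypothesis s_small : 4 * (s1 ^+ 2 + s2 ^+ 2) < 1.
Let v := envelope S u s1 s2.

Let cv : ccv2 (cur _ S) (cur _ v).
Proof. exact: envelope_ccv cS uM. Qed.

Let vM x y : cur _ S x y -> 0 <= cur _ v x y <= M.
Proof. exact: envelope_bound. Qed.

(** Almost everywhere the plane that attains the envelope has the gradient of [v]. If it touches [u]
    it also has the gradient of [u], which is then allowed; where [u < v], no supergradient of [u]
    is allowed. So the gradient of [u] alone tells the two cases apart. *)
Lemma envelope_dichotomy : exists N : set (R * R), [/\ measurable N,
  (mu \x mu)%E N = 0%E &
  forall y, core S y -> ~ N y ->
  [/\ sgrad (cur _ S) (cur _ u) y.1 y.2 (grad1 S u y) (grad2 S u y),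
    (~ allowed s1 s2 (grad1 S u y) (grad2 S u y) ->
      grad1 S v y ^+ 2 + grad2 S v y ^+ 2 <= 1 /\
      density S v y <= 1 - (s1 * grad1 S v y + s2 * grad2 S v y)) &
    (allowed s1 s2 (grad1 S u y) (grad2 S u y) ->
      grad1 S u y = grad1 S v y /\ grad2 S u y = grad2 S v y)]].
Proof.
have [B hB] := bS.
have [Nu [mNu Nu0 hu]] := ae_gradient S u M cS cu uM.
have [Nv [mNv Nv0 hv]] := ae_gradient S v M cS cv vM.
exists (Nu `|` Nv); split; first exact: measurableU.
  apply/eqP; rewrite eq_le measure_ge0 andbT.
  have H : ((mu \x mu) (Nu `|` Nv) <= (mu \x mu) Nu + (mu \x mu) Nv)%E by exact: measureU2.
  by apply: (le_trans H); rewrite Nu0 Nv0 adde0.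
case=> y1 y2 Cy nN.
have nNu : ~ Nu (y1, y2) by move=> ?; apply: nN; left.
have nNv : ~ Nv (y1, y2) by move=> ?; apply: nN; right.
have Sy : S (y1, y2) := inner_sub _ _ _ Cy.
have [_ _ su uu] := hu _ _ Cy nNu; have [_ _ _ uv] := hv _ _ Cy nNv.
have [p [q [c [hA hm vE]]]] := envelope_attained S u M B s1 s2 uM hB _ Cy.
have [pv qv] := uv _ _ (envelope_sgrad S u s1 s2 _ _ _ _ Sy hA hm vE).
have ge := envelope_ge S u M s1 s2 uM _ Sy.
split => //.
- move=> nA; have lt : u (y1, y2) < v (y1, y2).
    rewrite lt_neqAle ge andbT; apply/eqP => e; apply: nA.
    have [<- <-] := uu _ _ (touching_allowed S u _ _ _ _ hm (etrans e vE)).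
    exact: hA.
  rewrite /density -pv -qv.
  exact: (envelope_slope S u s1 s2 cS cu s_small _ _ _ _ Cy lt hA hm vE).
- move=> uA; have e : u (y1, y2) = v (y1, y2).
    apply/eqP; rewrite eq_le ge leNgt; apply/negP => lt.
    exact: (not_allowed_of_lt S u s1 s2 _ _ _ Sy lt su uA).
  have [<- <-] := uu _ _ (touching_allowed S u _ _ _ _ hm (etrans e vE)).
  by rewrite -pv -qv.
Qed.

Lemma flat_box_impossible (kap c1 c2 r : R) : 0 < kap -> 0 < r ->
  box_in (cur _ S) c1 c2 r ->
  (forall y1 y2 p q, `|y1 - c1| < r -> `|y2 - c2| < r ->
    sgrad (cur _ S) (cur _ u) y1 y2 p q ->
    ~ allowed s1 s2 p q /\ kap <= slope_density p q - (1 - (s1 * p + s2 * q))) -> False.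
Proof.
move=> kap0 r0 hbox hface.
have [N [mN N0 dich]] := envelope_dichotomy.
have [tk le0] := resistance_gap S N u v M cS core0 mS bS cu cv uM vM mN N0 (umin _ cv vM).
set k := _ \_ _ in tk le0.
have edge y n0 m1 m2 : core S y ->
    (forall z, S z -> 0 <= n0 + m1 * z.1 + m2 * z.2) -> `|m1| = 1 \/ `|m2| = 1 ->
    `|v y - u y| <= 2 * (n0 + m1 * y.1 + m2 * y.2).
  move=> Cy hn hm; have Sy : S y by case: (y) Cy => a b; exact: inner_sub.
  rewrite ger0_norm ?subr_ge0; last exact: envelope_ge uM _ Sy.
  by rewrite lerBlDl; exact: envelope_support_bound.
have sq1 (x y : R) : x ^+ 2 + y ^+ 2 <= 1 -> `|x| <= 1.
  move=> h; rewrite -(@ler_pXn2r _ 2) ?nnegrE// expr1n real_normK ?num_real//.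
  by have := sqr_ge0 y; lra.
have near y : core S y -> ~ N y ->
    `|grad1 S v y - grad1 S u y| <= 2 /\ `|grad2 S v y - grad2 S u y| <= 2.
  move=> Cy nN; have [_ h1 h2] := dich y Cy nN.
  have [hA|nA] := pselect (allowed s1 s2 (grad1 S u y) (grad2 S u y)).
    by have [-> ->] := h2 hA; rewrite !subrr normr0.
  have [lt _] := not_allowedP _ _ _ _ nA; have [le _] := h1 nA.
  have a1 := sq1 _ _ (ltW lt); have a2 := sq1 _ _ le.
  rewrite addrC in lt; rewrite addrC in le.
  have a3 := sq1 _ _ (ltW lt); have a4 := sq1 _ _ le.
  by split; apply: le_trans (ler_normB _ _) _; lra.
have edge' y n0 m1 m2 : core S y ->
    (forall z, S z -> 0 <= n0 + m1 * z.1 + m2 * z.2) -> `|m1| = 1 \/ `|m2| = 1 ->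
    `|u y - v y| <= 2 * (n0 + m1 * y.1 + m2 * y.2) by rewrite distrC; exact: edge.
have near' y : core S y -> ~ N y ->
    `|grad1 S u y - grad1 S v y| <= 2 /\ `|grad2 S u y - grad2 S v y| <= 2.
  by rewrite distrC [X in _ /\ X <= _]distrC; exact: near.
pose D := core S `\` N.
pose k1 := (fun y => grad1 S v y - grad1 S u y) \_ D : R * R -> R.
pose k2 := (fun y => grad2 S v y - grad2 S u y) \_ D : R * R -> R.
have t1 : tame k1 by exact: (tame_grad1_diff S N v u M).
have t2 : tame k2 by exact: (tame_grad2_diff S N v u M).
have p1 : 0 <= \int[(mu \x mu)%E]_z k1 z by exact: (grad1_diff_ge0 S N v u M).
have p2 : 0 <= \int[(mu \x mu)%E]_z k2 z by exact: (grad2_diff_ge0 S N v u M).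
have i1 := tame_integrable _ t1; have i2 := tame_integrable _ t2.
have z1 : \int[(mu \x mu)%E]_z k1 z = 0.
  apply/eqP; rewrite eq_le p1 andbT.
  have : 0 <= \int[(mu \x mu)%E]_z ((fun y => grad1 S u y - grad1 S v y) \_ D) z.
    exact: (grad1_diff_ge0 S N u v M).
  have -> : (fun y => grad1 S u y - grad1 S v y) \_ D = (fun y => -1 * k1 y).
    by apply/funext => y; rewrite /k1 !patchE; case: ifP => _; rewrite mulN1r ?opprB ?oppr0.
  by rewrite RintegralZl// mulN1r oppr_ge0.
have z2 : \int[(mu \x mu)%E]_z k2 z = 0.
  apply/eqP; rewrite eq_le p2 andbT.
  have : 0 <= \int[(mu \x mu)%E]_z ((fun y => grad2 S u y - grad2 S v y) \_ D) z.
    exact: (grad2_diff_ge0 S N u v M).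
  have -> : (fun y => grad2 S u y - grad2 S v y) \_ D = (fun y => -1 * k2 y).
    by apply/funext => y; rewrite /k2 !patchE; case: ifP => _; rewrite mulN1r ?opprB ?oppr0.
  by rewrite RintegralZl// mulN1r oppr_ge0.
pose box : set (R * R) := `]c1 - r, c1 + r[ `*` `]c2 - r, c2 + r[.
have mbox : measurable box by apply: measurableX.
have boxP y : box y -> `|y.1 - c1| < r /\ `|y.2 - c2| < r.
  by move=> []; rewrite /= !in_itv /= !ltr_distl.
pose kb := (fun=> kap) \_ box : R * R -> R.
have tb : tame kb.
  apply: (@tame_restrict _ _ _ `|kap|) => //.
  by have [B hB] := bS; exists B => -[a b] /boxP[ha hb]; exact: (hB (a, b) (hbox _ _ ha hb)).
have ib := tame_integrable _ tb.
have posb : 0 < \int[(mu \x mu)%E]_z kb z.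
  rewrite -Rintegral_mkcond Rintegral_cst// mulr_gt0//.
  have E (c : R) : mu `]c - r, c + r[ = (2 * r)%:E.
    rewrite lebesgue_measure_itv /= lte_fin; rewrite ltrD2l gtrN ?r0//.
    by rewrite -EFinD; congr (_%:E); ring.
  pose A1 : set R := `]c1 - r, c1 + r[%classic; pose A2 : set R := `]c2 - r, c2 + r[%classic.
  rewrite [X in fine X](_ : _ = (mu A1 * mu A2)%E); last first.
    by apply: product_measure1E; exact: measurable_itv.
  by rewrite /A1 /A2 !E /= !mulr_gt0.
(* The first two terms integrate to 0 and the last is the strict gain on the box; [e] bounds the
   difference of the densities from below almost everywhere. *)
pose e y := s1 * k1 y + s2 * k2 y + kb y.
have isk1 : (mu \x mu)%E.-integrable setT (EFin \o (fun y => s1 * k1 y)).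
  rewrite (_ : _ \o _ = (fun y => s1%:E * (EFin \o k1) y)%E); first exact: integrableZl.
  by apply/funext.
have isk2 : (mu \x mu)%E.-integrable setT (EFin \o (fun y => s2 * k2 y)).
  rewrite (_ : _ \o _ = (fun y => s2%:E * (EFin \o k2) y)%E); first exact: integrableZl.
  by apply/funext.
have is12 : (mu \x mu)%E.-integrable setT (EFin \o (fun y => s1 * k1 y + s2 * k2 y)).
  rewrite (_ : _ \o _ = (EFin \o (fun y => s1 * k1 y)%R) \+ (EFin \o (fun y => s2 * k2 y)%R))%E.
    exact: integrableD.
  by apply/funext.
have ie : (mu \x mu)%E.-integrable setT (EFin \o e).
  rewrite (_ : _ \o _ = (EFin \o (fun y => s1 * k1 y + s2 * k2 y)%R) \+ (EFin \o kb))%E.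
    exact: integrableD.
  by apply/funext.
have intE : \int[(mu \x mu)%E]_z e z = \int[(mu \x mu)%E]_z kb z.
  by rewrite RintegralD// RintegralD// !RintegralZl// z1 z2 !mulr0 !add0r.
have ik := tame_integrable _ tk.
have : (((\int[(mu \x mu)%E]_z e z)%:E <= \int[mu \x mu]_z (k z)%:E))%E.
  apply: (le_integral_ae _ _ (mu \x mu)%E e (EFin \o k) N) => // y nN.
  rewrite lee_fin /e /k1 /k2 /k /kb !patchE.
  have [Dy|nDy] := boolP (y \in D); last first.
    rewrite (_ : point = 0 :> R)// !mulr0 !add0r.
    case: ifPn => // /set_mem yb; have [b1 b2] := boxP _ yb.
    move/negP: nDy => nDy; exfalso; apply: nDy; apply/mem_set; split => //.
    by case: (y) b1 b2 => a b b1 b2; exact: (box_core _ _ _ _ hbox _ _ b1 b2).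
  have [Cy _] := set_mem Dy; have [su h1 h2] := dich y Cy nN.
  have [hA|nA] := pselect (allowed s1 s2 (grad1 S u y) (grad2 S u y)).
    have [e1 e2] := h2 hA; rewrite /density e1 e2 !subrr !mulr0 !add0r.
    case: ifPn => // /set_mem yb; have [b1 b2] := boxP _ yb.
    by have [] := hface _ _ _ _ b1 b2 su.
  have [_ lt] := not_allowedP _ _ _ _ nA; have [_ le] := h1 nA.
  case: ifPn => [/set_mem yb|_].
    have [b1 b2] := boxP _ yb; have [_ hk] := hface _ _ _ _ b1 b2 su.
    exact: (tilt_gain _ _ _ _ _ _ _ _ _ le hk).
  rewrite (_ : point = 0 :> R)// ; apply: (tilt_gain _ _ _ _ _ _ _ _ _ le).
  by rewrite subr_ge0; exact: ltW.
rewrite intE [X in (_ <= X)%E](_ : _ = (\int[(mu \x mu)%E]_z k z)%:E).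
  by rewrite lee_fin => le1; have := lt_le_trans posb (le_trans le1 le0); rewrite ltxx.
by rewrite /Rintegral fineK//; exact: (integrable_fin_num measurableT ik).
Qed.

End FlatFaces.

Section FaceGradient.
Context {R : realType}.

Lemma segment_point (a r x : R) : 0 < r -> `|x - a| <= r ->
  exists2 t, 0 <= t <= 1 & x = t * (a + r) + (1 - t) * (a - r).
Proof.
move=> r0; rewrite ler_norml => /andP[h1 h2]; exists ((x - a + r) / (2 * r)).
  by rewrite divr_ge0 ?ler_pdivrMr//; lra.
by field; rewrite gt_eqF.
Qed.

(** Concavity carries an affine lower bound from the corners to two opposite sides, and from these
    to the square. *)
Lemma square_lower (S : R -> R -> Prop) (U : R -> R -> R) (a b r c g1 g2 : R) :
  cvx2 S -> ccv2 S U -> 0 < r ->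
  (forall d1 d2, `|d1| = r -> `|d2| = r ->
    S (a + d1) (b + d2) /\ c + g1 * d1 + g2 * d2 <= U (a + d1) (b + d2)) ->
  forall x y, `|x - a| <= r -> `|y - b| <= r ->
    S x y /\ c + g1 * (x - a) + g2 * (y - b) <= U x y.
Proof.
move=> cS cU r0 corner x y /(segment_point _ _ _ r0)[t t01 ->] /(segment_point _ _ _ r0)[l l01 ->].
have side d1 : `|d1| = r -> S (a + d1) (l * (b + r) + (1 - l) * (b - r)) /\
    c + g1 * d1 + g2 * (l * (b + r) + (1 - l) * (b - r) - b) <=
    U (a + d1) (l * (b + r) + (1 - l) * (b - r)).
  move=> hd; have [||s1 u1] := corner d1 r => //; first by rewrite gtr0_norm.
  have [||s2 u2] := corner d1 (- r) => //; first by rewrite normrN gtr0_norm.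
  have E : a + d1 = l * (a + d1) + (1 - l) * (a + d1) by ring.
  split; first by rewrite E; exact: cS.
  rewrite [X in U X _]E; apply: le_trans (cU _ _ _ _ _ l01 s1 s2).
  by clear -u1 u2 l01; case/andP: l01 => l0 l1; nra.
have [|s1 u1] := side r; first by rewrite gtr0_norm.
have [|s2 u2] := side (- r); first by rewrite normrN gtr0_norm.
set l' := l * (b + r) + _ in s1 u1 s2 u2 *.
have E : l' = t * l' + (1 - t) * l' by ring.
split; first by rewrite E; exact: cS.
rewrite [X in U _ X]E; apply: le_trans (cU _ _ _ _ _ t01 s1 s2).
by clear -u1 u2 t01; case/andP: t01 => t0 t1; nra.
Qed.

(** On a square of twice the size [U] stays within [eta] below an affine function. Steps of length
    [r] in the four coordinate directions bound each component of a supergradient from both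
    sides. *)
Lemma gradient_near (S : R -> R -> Prop) (U : R -> R -> R) (a b r c g1 g2 eta : R) :
  0 < r ->
  (forall x y, `|x - a| <= 2 * r -> `|y - b| <= 2 * r ->
    S x y /\ c + g1 * (x - a) + g2 * (y - b) - eta <= U x y) ->
  (forall x y, S x y -> U x y <= c + g1 * (x - a) + g2 * (y - b)) ->
  forall x y p q, `|x - a| < r -> `|y - b| < r -> sgrad S U x y p q ->
    `|p - g1| * r <= eta /\ `|q - g2| * r <= eta.
Proof.
move=> r0 lo up x y p q hx hy sg.
have near d (z m : R) : `|z - m| < r -> `|d| <= r -> `|z + d - m| <= 2 * r.
  move=> hz hd; rewrite addrAC; apply: le_trans (ler_normD _ _) _.
  by clear -hz hd; lra.
have near0 (z m : R) : `|z - m| < r -> `|z - m| <= 2 * r.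
  by move=> hz; clear -hz r0; lra.
have rr : `|r| <= r by rewrite gtr0_norm.
have rN : `|- r| <= r by rewrite normrN gtr0_norm.
have [Sxy _] := lo _ _ (near0 _ _ hx) (near0 _ _ hy).
have Uxy := up _ _ Sxy.
have [S1 l1] := lo _ _ (near r _ _ hx rr) (near0 _ _ hy); have u1 := sg _ _ S1.
have [S2 l2] := lo _ _ (near (- r) _ _ hx rN) (near0 _ _ hy); have u2 := sg _ _ S2.
have [S3 l3] := lo _ _ (near0 _ _ hx) (near r _ _ hy rr); have u3 := sg _ _ S3.
have [S4 l4] := lo _ _ (near0 _ _ hx) (near (- r) _ _ hy rN); have u4 := sg _ _ S4.
have N (z : R) : z * r <= eta -> - (z * r) <= eta -> `|z| * r <= eta.
  by move=> z1 z2; rewrite -(gtr0_norm r0) -normrM ler_norml lerNl z1 z2.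
clear -N r0 Uxy l1 u1 l2 u2 l3 u3 l4 u4.
by split; apply: N; nra.
Qed.

Lemma slope_density_near (p q g1 g2 eps : R) :
  `|p - g1| <= eps -> `|q - g2| <= eps -> eps <= 1 -> g1 ^+ 2 + g2 ^+ 2 < 1 ->
  p ^+ 2 + q ^+ 2 <= g1 ^+ 2 + g2 ^+ 2 + 6 * eps /\
  slope_density g1 g2 - 6 * eps <= slope_density p q.
Proof.
move=> hp hq he hg; have e0 : 0 <= eps := le_trans (normr_ge0 _) hp.
have sq (x y : R) : `|x - y| <= eps -> y ^+ 2 <= 1 -> x ^+ 2 <= y ^+ 2 + 3 * eps.
  rewrite ler_norml => /andP[h1 h2] hy.
  have y1 : -1 <= y <= 1 by clear -hy; apply/andP; split; nra.
  by clear -h1 h2 y1 e0 he; case/andP: y1 => ? ?; nra.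
have P : p ^+ 2 + q ^+ 2 <= g1 ^+ 2 + g2 ^+ 2 + 6 * eps.
  have a1 : g1 ^+ 2 <= 1 by have := sqr_ge0 g2; clear -hg; lra.
  have a2 : g2 ^+ 2 <= 1 by have := sqr_ge0 g1; clear -hg; lra.
  by have := sq _ _ hp a1; have := sq _ _ hq a2; clear; lra.
split => //; rewrite /slope_density.
have D1 : 1 <= 1 + p ^+ 2 + q ^+ 2 by have := sqr_ge0 p; have := sqr_ge0 q; clear; lra.
have D2 : 1 <= 1 + g1 ^+ 2 + g2 ^+ 2 by have := sqr_ge0 g1; have := sqr_ge0 g2; clear; lra.
have {P} : 1 + p ^+ 2 + q ^+ 2 <= 1 + g1 ^+ 2 + g2 ^+ 2 + 6 * eps by clear -P; lra.
move: (1 + p ^+ 2 + q ^+ 2) (1 + g1 ^+ 2 + g2 ^+ 2) D1 D2 => X Y X1 Y1 XY.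
have X0 : 0 < X by clear -X1; lra.
have Y0 : 0 < Y by clear -Y1; lra.
rewrite lerBlDr -subr_ge0.
rewrite (_ : _ - _ = (6 * eps * X * Y - (X - Y)) / (X * Y)); last first.
  by field; rewrite !gt_eqF.
rewrite divr_ge0 ?mulr_ge0 ?(ltW X0) ?(ltW Y0)// subr_ge0.
have XY1 : 1 <= X * Y by clear -X1 Y1; nra.
by clear -XY XY1 e0; nra.
Qed.

Lemma tilt_exists (r2 : R) : 0 < r2 < 1 -> exists lam : R,
  [/\ 0 < lam, 4 * (lam ^+ 2 * r2) < 1 & 0 < (1 + r2)^-1 - (1 - lam * r2)].
Proof.
(* For [lam = 1 / (1 + r2)] the last quantity would be 0, and [4 * (lam ^+ 2 * r2) < 1] because
   [(1 + r2) ^+ 2 - 4 * r2 = (1 - r2) ^+ 2]. The factor [1 + d] makes the former positive and costs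
   at most [12 * d * r2] in the latter, less than the available [13 * d]. *)
move=> /andP[r0 r1]; pose d := (1 - r2) ^+ 2 / 13.
have q0 : 0 < 1 - r2 by lra.
have d0 : 0 < d by rewrite divr_gt0// exprn_gt0.
have dE : 13 * d = (1 - r2) ^+ 2 by rewrite /d; field.
have d1 : d <= 1 by clear -dE r0 r1; nra.
exists ((1 + d) / (1 + r2)).
have R0 : 0 < 1 + r2 by clear -r0; lra.
split; first by rewrite divr_gt0//; clear -d0; lra.
  rewrite (_ : 4 * _ = 4 * (1 + d) ^+ 2 * r2 / (1 + r2) ^+ 2); last first.
    by field; rewrite gt_eqF.
  rewrite ltr_pdivrMr ?exprn_gt0// mul1r.
  have D : (1 + d) ^+ 2 <= 1 + 3 * d by clear -d0 d1; nra.
  apply: (@le_lt_trans _ _ (4 * (1 + 3 * d) * r2)).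
    by clear -D r0; nra.
  have : d * r2 <= d by clear -d0 r1; nra.
  by clear -dE d0 r0; nra.
rewrite (_ : _ - _ = r2 * d / (1 + r2)); first by rewrite divr_gt0// mulr_gt0.
by field; rewrite gt_eqF.
Qed.

(** The directions [w + d] are the corners of a square under a single face of the cone. Scaled by a
    small [h], it carries [u] close to the face plane relative to [h], so by [gradient_near] all
    supergradients near its centre are close to [g]. The box argument then applies with
    [s = lam * g]. *)
Lemma face_gradient (S : set (R * R)) (u : R * R -> R) (M : R) :
  cvx2 (cur _ S) -> ccv2 (cur _ S) (cur _ u) ->
  (forall x y, cur _ S x y -> 0 <= cur _ u x y <= M) ->
  core S !=set0 -> measurable S -> bounded_set2 S ->
  (forall v, ccv2 (cur _ S) (cur _ v) ->
    (forall x y, cur _ S x y -> 0 <= cur _ v x y <= M) ->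
    (resistance S u <= resistance S v)%E) ->
  forall a b g1 g2 w1 w2 : R,
  core S (a, b) -> `|w1| <= 1 -> `|w2| <= 1 ->
  (forall s r, S (s, r) -> u (s, r) <= u (a, b) + g1 * (s - a) + g2 * (r - b)) ->
  (forall d1 d2 eps, `|d1| = 4^-1 -> `|d2| = 4^-1 -> 0 < eps -> exists2 h0, 0 < h0 &
    forall h, 0 < h -> h < h0 ->
      u (a, b) + h * (g1 * (w1 + d1) + g2 * (w2 + d2) - eps) <=
      u (a + h * (w1 + d1), b + h * (w2 + d2))) ->
  ~ (0 < g1 ^+ 2 + g2 ^+ 2 < 1).
Proof.
move=> cS cu uM core0 mS bS umin a b g1 g2 w1 w2 Cab hw1 hw2 up lo g01; have [lam [lam0 lam1 F0]] := tilt_exists _ g01.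
have /andP[gpos glt] := g01.
set F := _ - _ in F0.
(* The density loses at most [6 * eps] and the linear term [2 * eps], together at most half of [F].
   The denominator 7 leaves room for the [6 * eps] by which the squared length may grow. *)
pose eps := Num.min (F / 16) (Num.min 1 ((1 - (g1 ^+ 2 + g2 ^+ 2)) / 7)).
have F16 : 0 < F / 16 by rewrite divr_gt0// ltr0n.
have eps0 : 0 < eps by rewrite !lt_min F16 ltr01 divr_gt0 ?subr_gt0 ?ltr0n.
have epsF : eps <= F / 16 by rewrite ge_min lexx.
have eps1 : eps <= 1 by rewrite !ge_min lexx orbT.
have epsg : eps <= (1 - (g1 ^+ 2 + g2 ^+ 2)) / 7 by rewrite !ge_min lexx !orbT.
pose s1 := lam * g1; pose s2 := lam * g2.
have s_small : 4 * (s1 ^+ 2 + s2 ^+ 2) < 1 by rewrite /s1 /s2 !exprMn -mulrDr.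
have [rho rho0 hbox] := Cab.
have e80 : 0 < eps / 8 by rewrite divr_gt0.
have n4 : `|4^-1 : R| = 4^-1 by rewrite gtr0_norm.
have nN4 : `|- 4^-1 : R| = 4^-1 by rewrite normrN.
have [h1 h10 l1] := lo _ _ _ n4 n4 e80; have [h2 h20 l2] := lo _ _ _ n4 nN4 e80.
have [h3 h30 l3] := lo _ _ _ nN4 n4 e80; have [h4 h40 l4] := lo _ _ _ nN4 nN4 e80.
pose h0 := Num.min (Num.min h1 h2) (Num.min (Num.min h3 h4) (rho / 2)).
have h00 : 0 < h0 by rewrite !lt_min h10 h20 h30 h40 divr_gt0.
pose h := h0 / 2; have h_0 : 0 < h by rewrite divr_gt0.
have hh0 : h < h0 by rewrite /h; clear -h00; lra.
move: (hh0); rewrite !lt_min => /andP[/andP[hh1 hh2] /andP[/andP[hh3 hh4] hhr]].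
(* The square with known corners has half-side [2 * r = h / 4], the box has radius [r], and the
   error [h * (eps / 8) = eps * r] becomes [eps] in [gradient_near]. *)
pose A := a + h * w1; pose B := b + h * w2; pose r := h / 8.
have r0 : 0 < r by rewrite divr_gt0.
pose c := u (a, b) + g1 * (A - a) + g2 * (B - b).
have nd (d : R) : `|d| = 4^-1 -> d = 4^-1 \/ d = - 4^-1.
  by move=> <-; have [d0|d0] := leP 0 d; [left; rewrite ger0_norm|right; rewrite ltr0_norm ?opprK].
have corner d1 d2 : `|d1| = 4^-1 -> `|d2| = 4^-1 ->
    u (a, b) + h * (g1 * (w1 + d1) + g2 * (w2 + d2) - eps / 8) <=
    u (a + h * (w1 + d1), b + h * (w2 + d2)).
  by move=> /nd[]-> /nd[]->; [exact: l1|exact: l2|exact: l3|exact: l4].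
have small (w d : R) : `|w| <= 1 -> `|d| = 4^-1 -> `|h * (w + d)| < rho.
  move=> hw hd; rewrite normrM (gtr0_norm h_0).
  have : `|w + d| <= 2 by apply: le_trans (ler_normD _ _) _; rewrite hd; clear -hw; lra.
  by clear -h_0 hhr; nra.
have E2 : 2 * r = h * 4^-1 by rewrite /r; field.
have sq x y : `|x - A| <= 2 * r -> `|y - B| <= 2 * r ->
    cur _ S x y /\ c - h * (eps / 8) + g1 * (x - A) + g2 * (y - B) <= cur _ u x y.
  apply: (square_lower (cur _ S) (cur _ u) A B (2 * r)) => //; first by rewrite mulr_gt0.
  move=> d1 d2 n1 n2.
  have dE (d : R) : `|d| = 2 * r -> `|d / h| = 4^-1.
    by move=> hd; rewrite normrM normfV (gtr0_norm h_0) hd E2; field; rewrite gt_eqF.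
  have m1 := dE _ n1; have m2 := dE _ n2.
  have x1 : A + d1 = a + h * (w1 + d1 / h) by rewrite /A; field; rewrite gt_eqF.
  have x2 : B + d2 = b + h * (w2 + d2 / h) by rewrite /B; field; rewrite gt_eqF.
  have := corner _ _ m1 m2; rewrite -x1 -x2 /cur => lo1; split.
    by apply: hbox; rewrite ?x1 ?x2 addrC addKr small.
  apply: le_trans lo1; rewrite le_eqVlt; apply/orP; left; apply/eqP.
  by rewrite /c /A /B; field; rewrite gt_eqF.
have near := gradient_near (cur _ S) (cur _ u) A B r c g1 g2 (h * (eps / 8)) r0.
have {}near : forall x y p q, `|x - A| < r -> `|y - B| < r ->
    sgrad (cur _ S) (cur _ u) x y p q -> `|p - g1| <= eps /\ `|q - g2| <= eps.
  move=> x y p q hx hy sg; have [||n1 n2] := near _ _ x y p q hx hy sg.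
  - by move=> x' y' hx' hy'; have [s' l'] := sq _ _ hx' hy'; split => //; clear -l'; lra.
  - by move=> x' y' /up; rewrite /c /cur; clear; lra.
  move: n1 n2; rewrite (_ : h * (eps / 8) = eps * r); last by rewrite /r; field.
  by rewrite !ler_pM2r.
have F2 : 0 < F / 2 by rewrite divr_gt0.
apply: (flat_box_impossible S u M cS cu uM core0 mS bS umin s1 s2 s_small (F / 2) A B r F2 r0).
  move=> x y hx hy; have [] // := sq x y; clear -hx hy r0; lra.
move=> x y p q hx hy sg; have [np nq] := near _ _ _ _ hx hy sg.
have [G1 G2] := slope_density_near _ _ _ _ _ np nq eps1 glt.
have lin : s1 * g1 + s2 * g2 - 2 * eps <= s1 * p + s2 * q.
  have sle (s : R) : s ^+ 2 <= 4^-1 -> `|s| <= 1 by rewrite ler_norml => hs; clear -hs; apply/andP; split; nra.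
  have q1 : `|s1| <= 1 by apply: sle; have := sqr_ge0 s2; clear -s_small; lra.
  have q2 : `|s2| <= 1 by apply: sle; have := sqr_ge0 s1; clear -s_small; lra.
  have e1 : `|s1 * (p - g1)| <= eps by rewrite normrM -[leRHS]mul1r ler_pM.
  have e2 : `|s2 * (q - g2)| <= eps by rewrite normrM -[leRHS]mul1r ler_pM.
  by move: e1 e2; rewrite !ler_norml => /andP[e1 _] /andP[e2 _]; clear -e1 e2; lra.
have FE : F = slope_density g1 g2 - (1 - (s1 * g1 + s2 * g2)).
  by rewrite /F /slope_density /s1 /s2 addrA; congr (_ - (1 - _)); ring.
have key : F / 2 <= slope_density p q - (1 - (s1 * p + s2 * q)).
  by clear -FE lin G2 epsF; lra.
split => // -[ge1|le1]; last by clear -key le1 F2; lra.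
by clear -ge1 G1 epsg glt; lra.
Qed.

End FaceGradient.

(** * Angles and the tangent cone *)

Section RidgeAngles.
Context {R : realType}.
Implicit Types phi t : R.

Lemma cos_piquarter_sqr : cos (pi / 4 : R) ^+ 2 = 1 / 2.
Proof.
have := @cos_pihalf R; rewrite (_ : pi / 2 = (pi / 4) *+ 2); last by field.
by rewrite cos_mulr2n => h; lra.
Qed.

Lemma piquarter_itv : - (pi / 2) < (pi : R) / 4 < pi / 2.
Proof. by have := @pi_gt0 R; lra. Qed.

Lemma cos_piquarter : cos (pi / 4 : R) = 1 / Num.sqrt 2.
Proof.
have c0 := ltW (cos_gt0_pihalf piquarter_itv).
have s0 : 0 < Num.sqrt 2 :> R by rewrite sqrtr_gt0.
apply/eqP; rewrite -(@eqrXn2 _ 2)// ?divr_ge0 ?(ltW s0)//.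
by rewrite cos_piquarter_sqr expr_div_n sqr_sqrtr// expr1n.
Qed.

Lemma normr_pihalf phi : - (pi / 2) < phi < pi / 2 -> `|phi| \in `[0, pi].
Proof.
move=> /andP[h1 h2]; rewrite in_itv /= normr_ge0 /=.
by have := @pi_gt0 R; rewrite ler_norml => p0; apply/andP; split; lra.
Qed.

Lemma cos_le_abs phi t : - (pi / 2) < phi < pi / 2 -> 0 <= t <= pi ->
  cos phi <= cos t -> t <= `|phi|.
Proof.
move=> hphi ht; rewrite -cos_norm => h; rewrite leNgt; apply/negP => lt.
by move: h; rewrite leNgt ltr_cos ?lt ?normr_pihalf// in_itv.
Qed.

Lemma acos_le_abs phi t : - (pi / 2) < phi < pi / 2 -> -1 <= t <= 1 ->
  cos phi <= t -> acos t <= `|phi|.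
Proof.
move=> hphi ht le; apply: cos_le_abs => //; first by rewrite acos_ge0// acos_lepi.
by rewrite acosK// in_itv.
Qed.

(** [cos (2 * phi + t)] equals [cos phi ^+ 2 * cos t] times
    [1 - (2 * tan phi * tan t + tan phi ^+ 2)], hence is nonnegative. Beyond [pi / 2] the angle
    would still lie below [3 * pi / 2], where the cosine is negative. *)
Lemma double_angle_le phi t :
  - (pi / 2) < phi < pi / 2 -> - (pi / 2) < t < pi / 2 ->
  2 * tan phi * tan t + tan phi ^+ 2 <= 1 -> 2 * phi + t <= pi / 2.
Proof.
move=> hp ht; have c1 := cos_gt0_pihalf hp; have c2 := cos_gt0_pihalf ht => h.
rewrite leNgt; apply/negP => lt.
have : 0 < cos (2 * phi + t - pi).
  apply: cos_gt0_pihalf; move: hp ht lt => /andP[p1 p2] /andP[t1 t2] lt.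
  by apply/andP; split; lra.
rewrite cosB cospi sinpi mulr0 addr0 mulrN1 oppr_gt0 ltNge => /negP; apply.
rewrite (_ : 2 * phi = phi *+ 2); last by rewrite mulr2n; ring.
rewrite cosD cos_mulr2n sin_mulr2n.
have s1 : sin phi = tan phi * cos phi by rewrite /tan divfK ?gt_eqF.
have s2 : sin t = tan t * cos t by rewrite /tan divfK ?gt_eqF.
have E := cos2Dsin2 phi; move: E; rewrite s1 s2 => E.
rewrite (_ : _ - _ = cos phi ^+ 2 * cos t * (1 - (2 * tan phi * tan t + tan phi ^+ 2)) +
  cos t * (cos phi ^+ 2 + (tan phi * cos phi) ^+ 2 - 1)); last by rewrite !mulr2n; ring.
rewrite E subrr mulr0 addr0; apply: mulr_ge0; last by rewrite subr_ge0.
by apply: mulr_ge0; [exact: sqr_ge0|exact: ltW].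
Qed.

(** Here [(n1, n2, 0)] and [(p, q, z)] are the basis [f1], [f2], and [d] spans the edge. The
    horizontal parts of [f2] and [d] are both orthogonal to [n], hence parallel, and the
    orthogonality of [d] and [f2] gives [sin theta ^+ 2 = 1 - z ^+ 2]. *)
Lemma horizontal_angle_cos (n1 n2 p q z d1 d2 d3 theta : R) :
  n1 ^+ 2 + n2 ^+ 2 = 1 -> p ^+ 2 + q ^+ 2 + z ^+ 2 = 1 -> n1 * p + n2 * q = 0 -> 0 < z ->
  d1 * n1 + d2 * n2 = 0 -> d1 * p + d2 * q + d3 * z = 0 -> 0 < d1 * d1 + d2 * d2 + d3 * d3 ->
  0 <= theta < pi / 2 ->
  theta = asin (`|d3| / Num.sqrt (d1 * d1 + d2 * d2 + d3 * d3)) -> cos theta = z.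
Proof.
move=> nn fz np z0 dn df d0 ht tE.
have mu2 : (q * n1 - p * n2) ^+ 2 = 1 - z ^+ 2.
  by rewrite -fz (_ : _ ^+ 2 = (p ^+ 2 + q ^+ 2) * (n1 ^+ 2 + n2 ^+ 2) - (n1 * p + n2 * q) ^+ 2);
    [rewrite nn np; ring|ring].
have nu2 : (d2 * n1 - d1 * n2) ^+ 2 = d1 ^+ 2 + d2 ^+ 2.
  by rewrite (_ : _ ^+ 2 = (d1 ^+ 2 + d2 ^+ 2) * (n1 ^+ 2 + n2 ^+ 2) - (d1 * n1 + d2 * n2) ^+ 2);
    [rewrite nn dn; ring|ring].
have dz : d3 * z = - ((d2 * n1 - d1 * n2) * (q * n1 - p * n2)).
  have -> : d3 * z = - (d1 * p + d2 * q) by rewrite -[LHS]subr0 -df; ring.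
  congr (- _); rewrite -[LHS]mulr1 -nn.
  rewrite -[LHS]subr0 -(mul0r (n1 * p + n2 * q)) -dn; ring.
have dE : d3 ^+ 2 = (d1 * d1 + d2 * d2 + d3 * d3) * (1 - z ^+ 2).
  have : (d3 * z) ^+ 2 = (d1 ^+ 2 + d2 ^+ 2) * (1 - z ^+ 2) by rewrite dz sqrrN exprMn nu2 mu2.
  by move=> h; rewrite -[LHS](subrK ((d3 * z) ^+ 2)) {2}h; ring.
set D := _ + _ + _ in d0 tE dE.
have D0 : 0 < Num.sqrt D by rewrite sqrtr_gt0.
have r2 : (`|d3| / Num.sqrt D) ^+ 2 = 1 - z ^+ 2.
  by rewrite expr_div_n real_normK ?num_real// dE sqr_sqrtr ?(ltW d0)// mulrAC divff ?mul1r ?gt_eqF.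
have r0 : 0 <= `|d3| / Num.sqrt D by rewrite divr_ge0 ?(ltW D0).
have r1 : `|d3| / Num.sqrt D <= 1.
  by rewrite -(@ler_pXn2r _ 2) ?nnegrE// expr1n r2 gerBl sqr_ge0.
by rewrite tE cos_asin ?r1 ?(le_trans _ r0)// r2 subKr sqrtr_sqr gtr0_norm//.
Qed.

Lemma ridge_gradient_sqr (n1 n2 e z phi : R) :
  n1 ^+ 2 + n2 ^+ 2 = 1 -> 0 < z -> z^-1 ^+ 2 = 1 + e ^+ 2 -> cos phi != 0 ->
  ridge_gx n1 n2 e z^-1 (tan phi) ^+ 2 + ridge_gy n1 n2 e z^-1 (tan phi) ^+ 2 =
  ((z * cos phi) ^+ 2)^-1 - 1.
Proof.
move=> nn z0 zE c0; rewrite /ridge_gx /ridge_gy.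
rewrite [LHS](_ : _ = (n1 ^+ 2 + n2 ^+ 2) * (e ^+ 2 + z^-1 ^+ 2 * tan phi ^+ 2)); last by ring.
have eE : e ^+ 2 = z^-1 ^+ 2 - 1 by rewrite zE addrAC subrr add0r.
have tE : tan phi ^+ 2 = (cos phi ^+ 2)^-1 - 1.
  have -> : (cos phi ^+ 2)^-1 = 1 + tan phi ^+ 2 := cos2_tan2 c0.
  by rewrite addrAC subrr add0r.
by rewrite nn mul1r eE tE; field; rewrite c0 gt_eqF.
Qed.

Lemma gradient_gap (z phi : R) : 0 < z -> 0 < cos phi ->
  ~ (0 < ((z * cos phi) ^+ 2)^-1 - 1 < 1) -> z * cos phi <= 1 ->
  z * cos phi = 1 \/ z * cos phi <= cos (pi / 4).
Proof.
move=> z0 c0; have k0 : 0 < z * cos phi by rewrite mulr_gt0.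
move: (z * cos phi) k0 => k k0 gap k1.
have [ge|lt] := leP 1 k; [left; apply/eqP; rewrite eq_le k1 ge//|right].
have K0 : 0 < k ^+ 2 by rewrite exprn_gt0.
rewrite -(@ler_pXn2r _ 2) ?nnegrE ?(ltW k0) ?(ltW (cos_gt0_pihalf piquarter_itv))//.
rewrite cos_piquarter_sqr leNgt; apply/negP => h; apply: gap.
have K1 : k ^+ 2 < 1 by rewrite expr_lt1// ltW.
rewrite subr_gt0 invf_gt1// K1 /= ltrBlDr.
by rewrite -(ltr_pM2r K0) mulVf ?gt_eqF//; clear -h; lra.
Qed.

(** The product is 1 only for [theta = 0] and [phi = 0]. For [theta = 0] at most one of the two
    angles vanishes, and then the inequalities for the sums force the other to have modulus exactly
    [pi / 4]. If neither vanishes, they exclude equal signs. *)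
Lemma ridge_angle_cases (theta phi1 phi2 : R) : 0 <= theta < pi / 2 ->
  - (pi / 2) < phi2 -> phi2 < phi1 -> phi1 < pi / 2 ->
  2 * phi1 + phi2 <= pi / 2 -> - (pi / 2) <= phi1 + 2 * phi2 ->
  (forall phi, phi = phi1 \/ phi = phi2 ->
    cos theta * cos phi = 1 \/ cos theta * cos phi <= cos (pi / 4)) ->
  let phi_star := acos ((1 / Num.sqrt 2) / cos theta) in
  [/\ pi / 4 <= theta < pi / 2 ->
        2 * phi1 + phi2 <= pi / 2 /\ - (pi / 2) <= phi1 + 2 * phi2,
      0 < theta < pi / 4 ->
        [/\ 2 * phi1 + phi2 <= pi / 2, - (pi / 2) <= phi1 + 2 * phi2,
            phi_star <= `|phi1| & phi_star <= `|phi2|]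
    & theta = 0 ->
        [\/ (phi1, phi2) = (pi / 4, 0),
            (phi1, phi2) = (0, - (pi / 4))
          | [/\ 2 * phi1 + phi2 <= pi / 2, - (pi / 2) <= phi1 + 2 * phi2,
                pi / 4 <= phi1 & phi2 <= - (pi / 4)]]].
Proof.
move=> ht p2 p21 p1 A1 A2 gap phi_star; split=> //.
- move=> /andP[t0 t4].
  have p0 := @pi_gt0 R.
  have itv phi : phi = phi1 \/ phi = phi2 -> - (pi / 2) < phi < pi / 2.
    by move=> [->|->]; apply/andP; split; lra.
  have c4 : 0 < cos (pi / 4 : R) := cos_gt0_pihalf piquarter_itv.
  have ct4 : cos (pi / 4) < cos theta by rewrite ltr_cos// in_itv /=; apply/andP; split; lra.
  have ct1 : cos theta < 1 by rewrite -(@cos0 R) ltr_cos// in_itv /=; apply/andP; split; lra.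
  have ct0 : 0 < cos theta := lt_trans c4 ct4.
  have bd : -1 <= cos (pi / 4) / cos theta <= 1.
    rewrite (le_trans (lerN10 _)) ?divr_ge0 ?(ltW c4) ?(ltW ct0)//=.
    by rewrite ler_pdivrMr// mul1r ltW.
  have star phi : phi = phi1 \/ phi = phi2 -> phi_star <= `|phi|.
    move=> hp; rewrite /phi_star -cos_piquarter; apply: acos_le_abs => //; first exact: itv.
    rewrite ler_pdivlMr// mulrC; case: (gap _ hp) => // E.
    have := @cos_le1 R phi; have := cos_gt0_pihalf (itv _ hp).
    by move: ct1 ct0 E; clear; nra.
  by split=> //; apply: star; [left|right].
move=> t0; have p0 := @pi_gt0 R.
have flat phi : phi = phi1 \/ phi = phi2 -> phi = 0 \/ pi / 4 <= `|phi|.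
  move=> hp; have itv : - (pi / 2) < phi < pi / 2.
    by case: hp => ->; apply/andP; split; lra.
  case: (gap _ hp); rewrite t0 cos0 mul1r => E; last first.
    by right; apply: cos_le_abs => //; apply/andP; split; lra.
  left; apply/eqP; rewrite -normr_eq0; apply/eqP; apply: (@cos_inj R).
  - exact: normr_pihalf.
  - by rewrite in_itv /= lexx ltW.
  by rewrite cos_norm cos0.
have absP (phi : R) : pi / 4 <= `|phi| -> phi <= - (pi / 4) \/ pi / 4 <= phi.
  have [h|h] := leP 0 phi; first by rewrite ger0_norm//; right.
  by rewrite ltr0_norm// => k; left; lra.
have [z1|/absP h1] := flat phi1 (or_introl erefl);
  have [z2|/absP h2] := flat phi2 (or_intror erefl).
- by exfalso; lra.
- apply: Or32; congr (_, _) => //; case: h2 => h2; last by lra.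
  by apply/eqP; rewrite eq_le h2; lra.
- apply: Or31; congr (_, _) => //; case: h1 => h1; first by lra.
  by apply/eqP; rewrite eq_le h1 andbT; lra.
by apply: Or33; case: h1 => h1; case: h2 => h2; split => //; lra.
Qed.

End RidgeAngles.

(** * From the tangent cone to estimates for [u] *)

Section RidgeBody.
Context {R : realType}.
Implicit Types Om : set (plane R).

Lemma convex_set_cvx2 Om : convex_set (M := plane R) Om -> cvx2 (cur _ Om).
Proof.
move=> cO a b a' b' t /andP[t0 t1] h h'.
by have := cO (a, b) (a', b') (Itv01 t0 t1) (mem_set h) (mem_set h'); rewrite inE.
Qed.

Lemma convex_function_ccv2 Om (v : plane R -> R) :
  convex_function (E := plane R) Om (fun x => - v x) -> ccv2 (cur _ Om) (cur _ v).
Proof.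
move=> cv a b a' b' t /andP[t0 t1] h h'.
have := cv (Itv01 t0 t1) (a, b) (a', b') (mem_set h) (mem_set h').
by rewrite convRE /= !mulrN -opprD lerN2.
Qed.

Lemma ccv2_convex_function Om (v : plane R -> R) :
  ccv2 (cur _ Om) (cur _ v) -> convex_function (E := plane R) Om (fun x => - v x).
Proof.
move=> cv t [a b] [a' b'] /set_mem h /set_mem h'; rewrite convRE /= !mulrN -opprD lerN2.
apply: (cv a b a' b' t%:num) => //.
by rewrite ge0 le1.
Qed.

Lemma compact_bounded_set2 Om : compact Om -> bounded_set2 Om.
Proof.
move=> /compact_bounded /pinfty_ex_gt0[B B0 hB]; exists B => -[a b] /hB /=.
by rewrite ge_max => /andP.
Qed.

Lemma compact_measurable_plane Om : compact Om -> measurable (Om : set (R * R)).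
Proof.
move=> cO; rewrite -[Om]setCK; apply: measurableC; apply: open_prod_measurable => a b h.
by apply: open_inner => //; rewrite openC; exact: compact_closed.
Qed.

Lemma interior_core Om a b : interior Om (a, b) -> core Om (a, b).
Proof.
move=> h; have [r r0 hr] := open_inner (interior Om) a b (@open_interior _ _) h.
by exists r => // a' b' ha hb; have := @interior_subset _ _ _ (hr a' b' ha hb).
Qed.

(** The closed tangent cone only provides points of the body whose scaled position from the apex is
    close to the given direction. Concavity on the segment from the apex transports the height to
    every small [h], and [ccv2_lower] passes to the exact direction at a cost linear in [h]; [d] is
    chosen so that the total cost is [h * eps]. *)
Lemma cone_lower (S : set (R * R)) (u : R * R -> R) (M a b g1 g2 k1 k2 : R) :
  cvx2 (cur _ S) -> ccv2 (cur _ S) (cur _ u) ->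
  (forall x y, cur _ S x y -> 0 <= cur _ u x y <= M) -> core S (a, b) ->
  (forall v1 v2 z d, z <= g1 * v1 + g2 * v2 -> z <= k1 * v1 + k2 * v2 -> 0 < d ->
    exists p1 p2 t, [/\ S (p1, p2), 0 <= t, `|v1 - t * (p1 - a)| < d, `|v2 - t * (p2 - b)| < d
      & z - d < t * (u (p1, p2) - u (a, b))]) ->
  forall v1 v2 eps : R, 0 < eps -> exists2 h0, 0 < h0 & forall h, 0 < h -> h < h0 ->
    u (a, b) + h * (Num.min (g1 * v1 + g2 * v2) (k1 * v1 + k2 * v2) - eps) <=
    u (a + h * v1, b + h * v2).
Proof.
move=> cS cu uM [r r0 hr] cone v1 v2 eps eps0.
have M0 : 0 <= M.
  have /uM/andP[] : cur _ S a b by apply: hr; rewrite subrr normr0.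
  exact: le_trans.
have K0 : 0 < 1 + 2 * M / r by rewrite ltr_wpDr// divr_ge0 ?mulr_ge0 ?(ltW r0).
pose d := eps / (1 + 2 * M / r); have d0 : 0 < d by rewrite divr_gt0.
have dE : d + M * (d / (r / 2)) = eps.
  have -> : d + M * (d / (r / 2)) = d * (1 + 2 * M / r) by field; rewrite gt_eqF.
  by rewrite /d divfK ?gt_eqF.
set z := Num.min _ _.
have [p1 [p2 [t [Sp t0 e1 e2 lt]]]] : exists p1 p2 t,
    [/\ S (p1, p2), 0 <= t, `|v1 - t * (p1 - a)| < d, `|v2 - t * (p2 - b)| < d
      & z - d < t * (u (p1, p2) - u (a, b))].
  by apply: cone => //; rewrite /z ge_min lexx ?orbT.
pose Q := `|v1| + `|v2| + d.
have Q0 : 0 < Q by rewrite ltr_wpDl// addr_ge0.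
exists (Num.min ((t + 1)^-1) (r / 2 / Q)).
  by rewrite lt_min invr_gt0 !divr_gt0 ?ltr_wpDl.
move=> h h0; rewrite lt_min => /andP[ht hQ].
have t10 : 0 < t + 1 by rewrite ltr_wpDl.
have {}hQ : h * Q < r / 2 by rewrite -ltr_pdivlMr.
have {}ht : h * t <= 1.
  have : h * (t + 1) < 1 by rewrite -ltr_pdivlMr// div1r.
  by rewrite mulrDr mulr1; clear -h0; lra.
have v1n := normr_ge0 v1; have v2n := normr_ge0 v2.
pose A := a + h * (t * (p1 - a)); pose B := b + h * (t * (p2 - b)).
have shift (c v w : R) : `|v - w| < d -> `|v| + d <= Q -> `|c + h * w - c| < r / 2.
  move=> vw vQ; rewrite addrC addKr normrM (gtr0_norm h0); apply: le_lt_trans hQ.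
  rewrite ler_pM2l//; apply: le_trans vQ; rewrite -[w](subrK v) addrC.
  apply: le_trans (ler_normD _ _) _; rewrite lerD2l distrC; exact: ltW.
have hA : `|A - a| < r / 2 by apply: (shift _ v1) => //; rewrite /Q lerD2r lerDl.
have hB : `|B - b| < r / 2 by apply: (shift _ v2) => //; rewrite /Q lerD2r lerDr.
have box : box_in (cur _ S) A B (r / 2).
  move=> x y hx hy; apply: hr.
    by rewrite (_ : x - a = (x - A) + (A - a)); [apply: le_lt_trans (ler_normD _ _) _; clear -hx hA; lra|ring].
  by rewrite (_ : y - b = (y - B) + (B - b)); [apply: le_lt_trans (ler_normD _ _) _; clear -hy hB; lra|ring].
have hd : 0 < h * d <= r / 2.
  rewrite mulr_gt0//=; apply: le_trans (ltW hQ); rewrite ler_pM2l// /Q lerDr addr_ge0//.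
have near (c v w : R) : `|v - w| < d -> `|c + h * v - (c + h * w)| < h * d.
  by move=> vw; rewrite opprD addrACA subrr add0r -mulrBr normrM (gtr0_norm h0) ltr_pM2l.
have low := ccv2_lower (cur _ S) (cur _ u) M A B _ _ _ _ cS cu uM box hd (near a _ _ e1) (near b _ _ e2).
have ht01 : 0 <= h * t <= 1 by rewrite ht mulr_ge0// ltW.
have Sab : cur _ S a b by apply: hr; rewrite subrr normr0.
have conc := cu p1 p2 a b (h * t) ht01 Sp Sab.
have EA : h * t * p1 + (1 - h * t) * a = A by rewrite /A; ring.
have EB : h * t * p2 + (1 - h * t) * b = B by rewrite /B; ring.
rewrite EA EB /cur in conc; rewrite /cur in low.
have hz : h * (z - d) <= h * (t * (u (p1, p2) - u (a, b))) by rewrite ler_pM2l// ltW.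
have E : M * (h * d / (r / 2)) = h * eps - h * d by rewrite -dE; ring.
rewrite E in low.
move: low conc hz; move: (u _) (u _) (u _) (u _) => u1 u2 u3 u4; clear.
by rewrite !mulrBr mulrA mulrBl mul1r; lra.
Qed.

Lemma unit_coord_le (n m : R) : n ^+ 2 + m ^+ 2 = 1 -> `|n| <= 1.
Proof.
by move=> h; rewrite ler_norml; have := sqr_ge0 m => m0; apply/andP; split; nra.
Qed.

(** If [u] vanished at the apex, its nonnegativity would make both face planes nonnegative along [n]
    and [- n], so that [T1 = T2 = 0]. The cut lowers the apex by a fraction of this height. *)
Lemma apex_pos (S : set (R * R)) (u : R * R -> R) (a b n1 n2 e kappa T1 T2 : R) :
  core S (a, b) -> (forall x y, S (x, y) -> 0 <= u (x, y)) ->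
  n1 ^+ 2 + n2 ^+ 2 = 1 -> 0 < kappa -> T2 < T1 ->
  (forall T, T = T1 \/ T = T2 -> forall s r, S (s, r) ->
    u (s, r) <= u (a, b) + ridge_gx n1 n2 e kappa T * (s - a) + ridge_gy n1 n2 e kappa T * (r - b)) ->
  0 < u (a, b).
Proof.
move=> [r r0 hr] u_ge0 nn k0 T21 faces.
have Sab : S (a, b) by apply: hr; rewrite subrr normr0.
rewrite lt_neqAle u_ge0// andbT eq_sym; apply/eqP => u0.
pose s := r / 2; have s0 : 0 < s by rewrite divr_gt0.
have small sg n m : `|sg| = s -> n ^+ 2 + m ^+ 2 = 1 -> `|sg * n| < r.
  move=> hs /unit_coord_le hn; rewrite normrM hs; apply: (@le_lt_trans _ _ (s * 1)).
    by rewrite ler_pM2l.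
  by rewrite mulr1 /s; clear -r0; lra.
have mn : n2 ^+ 2 + n1 ^+ 2 = 1 by rewrite addrC.
have side T sg : T = T1 \/ T = T2 -> `|sg| = s -> 0 <= sg * T.
  move=> hT hs; have Sq : S (a + sg * n1, b + sg * n2).
    by apply: hr; rewrite addrC addKr; [exact: small hs nn|exact: small hs mn].
  have := le_trans (u_ge0 _ _ Sq) (faces T hT _ _ Sq).
  rewrite u0 /ridge_gx /ridge_gy add0r.
  rewrite [X in 0 <= X](_ : _ = kappa * (sg * T) * (n1 ^+ 2 + n2 ^+ 2)); last by ring.
  by rewrite nn mulr1 (pmulr_rge0 _ k0).
have zero T : T = T1 \/ T = T2 -> T = 0.
  move=> hT; have h1 := side T s hT (gtr0_norm s0).
  have h2 := side T (- s) hT (etrans (normrN _) (gtr0_norm s0)).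
  by apply/eqP; rewrite eq_le -(pmulr_rge0 _ s0) h1 andbT -oppr_ge0 -(pmulr_rge0 _ s0) mulrN -mulNr.
by move: T21; rewrite (zero T1 (or_introl erefl)) (zero T2 (or_intror erefl)) ltxx.
Qed.

End RidgeBody.

Section TangentConeBody.
Context {R : realType}.
Implicit Types (Om : set (plane R)) (u : plane R -> R).

Lemma tangent_cone_upper Om u (a b : R) (e : R^o * R^o * R^o) (s r : R) :
  tangent_cone (body Om u) ((a, b), u (a, b)) `<=` halfspace ((a, b), u (a, b)) e ->
  Om (s, r) -> 0 <= u (s, r) ->
  e.1.1 * (s - a) + e.1.2 * (r - b) + e.2 * (u (s, r) - u (a, b)) <= 0.
Proof.
move=> sub Osr usr; apply: (sub ((s, r), u (s, r))); apply: subset_closure.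
exists ((s, r), u (s, r)); first by split => //=; rewrite usr lexx.
by exists 1 => //; rewrite scale1r addrC subrK.
Qed.

Lemma tangent_cone_lower Om u (a b v1 v2 z d : R) :
  tangent_cone (body Om u) ((a, b), u (a, b)) ((a + v1, b + v2), u (a, b) + z) -> 0 < d ->
  exists p1 p2 t, [/\ Om (p1, p2), 0 <= t, `|v1 - t * (p1 - a)| < d, `|v2 - t * (p2 - b)| < d
    & z - d < t * (u (p1, p2) - u (a, b))].
Proof.
move=> cl d0; have := cl _ (nbhsx_ballx _ d d0).
move=> [_ [[[[p1 p2] p3] [/= Op /andP[p30 p3u]] [t t0 ->]] [[/= b1 b2] /= b3]]].
move: b1 b2 b3; rewrite -!ball_normE /= => b1 b2 b3.
exists p1, p2, t; split => //.
- by move: b1; rewrite opprD addrACA subrr add0r.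
- by move: b2; rewrite opprD addrACA subrr add0r.
apply: (@lt_le_trans _ _ (t * (p3 - u (a, b)))); last by rewrite ler_wpM2l// lerD2r.
move: b3; rewrite opprD addrACA subrr add0r ltr_norml => /andP[_].
by rewrite ltrBlDr ltrBlDl addrC.
Qed.

End TangentConeBody.

Section RidgeFaces.
Context {R : realType}.

Lemma ridge_faces (S : set (R * R)) (u : R * R -> R) (M : R) :
  cvx2 (cur _ S) -> ccv2 (cur _ S) (cur _ u) ->
  (forall x y, cur _ S x y -> 0 <= cur _ u x y <= M) ->
  measurable S -> bounded_set2 S ->
  (forall v, ccv2 (cur _ S) (cur _ v) ->
    (forall x y, cur _ S x y -> 0 <= cur _ v x y <= M) ->
    (resistance S u <= resistance S v)%E) ->
  forall a b n1 n2 e kappa T1 T2 : R,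
  let gx := ridge_gx n1 n2 e kappa in let gy := ridge_gy n1 n2 e kappa in
  core S (a, b) -> n1 ^+ 2 + n2 ^+ 2 = 1 -> 0 < kappa -> kappa ^+ 2 = 1 + e ^+ 2 -> T2 < T1 ->
  (forall T, T = T1 \/ T = T2 -> forall s r, S (s, r) ->
    u (s, r) <= u (a, b) + gx T * (s - a) + gy T * (r - b)) ->
  (forall v1 v2 z d, z <= gx T1 * v1 + gy T1 * v2 -> z <= gx T2 * v1 + gy T2 * v2 -> 0 < d ->
    exists p1 p2 t, [/\ S (p1, p2), 0 <= t, `|v1 - t * (p1 - a)| < d, `|v2 - t * (p2 - b)| < d
      & z - d < t * (u (p1, p2) - u (a, b))]) ->
  [/\ 2 * T1 * T2 + T1 ^+ 2 <= 1, 2 * T1 * T2 + T2 ^+ 2 <= 1,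
      ~ (0 < gx T1 ^+ 2 + gy T1 ^+ 2 < 1) & ~ (0 < gx T2 ^+ 2 + gy T2 ^+ 2 < 1)].
Proof.
move=> cS cu uM mS bS umin a b n1 n2 e kappa T1 T2 gx gy Cab nn k0 kE T21 faces cone.
have core0 : core S !=set0 by exists (a, b).
have u_ge0 x y : S (x, y) -> 0 <= u (x, y) by move=> /uM/andP[].
have u0 : 0 < u (a, b).
  exact: (apex_pos S u a b n1 n2 e kappa T1 T2 Cab u_ge0 nn k0 T21 faces).
have R3 := cone_lower S u M a b _ _ _ _ cS cu uM Cab cone.
have F1 := faces T1 (or_introl erefl); have F2 := faces T2 (or_intror erefl).
have [A1 A2] := ridge_slopes S u M cS cu uM core0 mS bS umin a b n1 n2 e kappa T1 T2
  Cab u0 nn k0 kE T21 F1 F2 R3.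
have mn : n2 ^+ 2 + n1 ^+ 2 = 1 by rewrite addrC.
have n1l := unit_coord_le _ _ nn; have n2l := unit_coord_le _ _ mn.
(* The direction [- n] lies under the face of [T1] and [n] under that of [T2]. Corners at offset
   [1 / 4] stay on the same side, since the product is at least [1 - 1 / 4 - 1 / 4] for a unit
   vector [n]. *)
have lin sg d1 d2 : `|d1| = 4^-1 -> `|d2| = 4^-1 -> sg = 1 \/ sg = -1 ->
    0 < sg * (n1 * (sg * n1 + d1) + n2 * (sg * n2 + d2)).
  move=> h1 h2 hs.
  have s2 : sg ^+ 2 = 1 by case: hs => ->; rewrite ?sqrrN expr1n.
  have sn : `|sg| = 1 by case: hs => ->; rewrite ?normrN normr1.
  have m1 : `|sg * n1 * d1| <= 4^-1 by rewrite !normrM sn mul1r h1 ler_piMl.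
  have m2 : `|sg * n2 * d2| <= 4^-1 by rewrite !normrM sn mul1r h2 ler_piMl.
  rewrite [X in 0 < X](_ : _ = sg ^+ 2 * (n1 ^+ 2 + n2 ^+ 2) + sg * n1 * d1 + sg * n2 * d2); last by ring.
  rewrite s2 nn mul1r; move: m1 m2; rewrite !ler_norml => /andP[m1 _] /andP[m2 _].
  by clear -m1 m2; lra.
have gap v1 v2 : gx T1 * v1 + gy T1 * v2 - (gx T2 * v1 + gy T2 * v2) =
    kappa * (T1 - T2) * (n1 * v1 + n2 * v2).
  by rewrite /gx /gy /ridge_gx /ridge_gy; ring.
have kT : 0 < kappa * (T1 - T2) by rewrite mulr_gt0 ?subr_gt0.
split => //.
- apply: (face_gradient S u M cS cu uM core0 mS bS umin a b _ _ (-1 * n1) (-1 * n2) Cab) => //.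
  + by rewrite mulN1r normrN.
  + by rewrite mulN1r normrN.
  move=> d1 d2 eps h1 h2 eps0.
  have [h0 h00 hh] := R3 (-1 * n1 + d1) (-1 * n2 + d2) eps eps0; exists h0 => // h hp hl.
  have := hh h hp hl; rewrite min_l// -subr_le0 gap pmulr_rle0//.
  by have := lin (-1) _ _ h1 h2 (or_intror erefl); rewrite mulN1r oppr_gt0 => /ltW.
apply: (face_gradient S u M cS cu uM core0 mS bS umin a b _ _ (1 * n1) (1 * n2) Cab) => //.
+ by rewrite mul1r.
+ by rewrite mul1r.
move=> d1 d2 eps h1 h2 eps0.
have [h0 h00 hh] := R3 (1 * n1 + d1) (1 * n2 + d2) eps eps0; exists h0 => // h hp hl.
have := hh h hp hl; rewrite min_r// -subr_ge0 gap pmulr_rge0//.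
by have := lin 1 _ _ h1 h2 (or_introl erefl); rewrite mul1r => /ltW.
Qed.

End RidgeFaces.

Theorem theorem1 (R : realType) (Om : set (plane R)) (M : R)
    (u : plane R -> R) (x : plane R) (theta phi1 phi2 : R)
    (Om_compact : compact Om)
    (Om_convex : convex_set (M := plane R) Om)
    (Om_interior : interior Om !=set0)
    (M_gt0 : 0 < M)
    (u_min : minimizer Om M u)
    (x_int : interior Om x)
    (r0_ridge : ridge_point (body Om u) (x, u x))
    (angles : associated_angles (body Om u) (x, u x) theta phi1 phi2) :
  let phi_star := acos ((1 / Num.sqrt 2) / cos theta) in
  [/\ pi / 4 <= theta < pi / 2 ->
        2 * phi1 + phi2 <= pi / 2 /\ - (pi / 2) <= phi1 + 2 * phi2,
      0 < theta < pi / 4 ->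
        [/\ 2 * phi1 + phi2 <= pi / 2, - (pi / 2) <= phi1 + 2 * phi2,
            phi_star <= `|phi1| & phi_star <= `|phi2|]
    & theta = 0 ->
        [\/ (phi1, phi2) = (pi / 4, 0),
            (phi1, phi2) = (0, - (pi / 4))
          | [/\ 2 * phi1 + phi2 <= pi / 2, - (pi / 2) <= phi1 + 2 * phi2,
                pi / 4 <= phi1 & phi2 <= - (pi / 4)]]].
Proof.
case: x x_int r0_ridge angles => a b x_int _.
move=> [e1 [e2 [[[d1 d2] d3] [[[n1 n2] f13] [[[p q] z] [[_ _ _ cone] [d_neq0 _ _] [ht tE]]]]]]].
rewrite /horizontal_angle /enorm /dot /= in tE *.
move=> [df1 df2 [f1E f2E] f12 [/= f130 z0]] [p2 p21 p1 e1E e2E].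
rewrite {f13}f130 in df1 df2 f1E f12 e1E e2E.
have sq1 (y : R) : Num.sqrt y = 1 -> y = 1.
  by move=> h; have [y0|y0] := leP 0 y; [rewrite -(sqr_sqrtr y0) h expr1n|
    move: h; rewrite ler0_sqrtr ?ltW// => /esym/eqP; rewrite oner_eq0].
have nn : n1 ^+ 2 + n2 ^+ 2 = 1 by move: (sq1 _ f1E); rewrite mulr0 addr0 -!expr2.
have ff : p ^+ 2 + q ^+ 2 + z ^+ 2 = 1 by move: (sq1 _ f2E); rewrite -!expr2.
have np : n1 * p + n2 * q = 0 by move: f12; rewrite mul0r addr0.
have dn : d1 * n1 + d2 * n2 = 0 by move: df1; rewrite mulr0 addr0.
have dd : 0 < d1 * d1 + d2 * d2 + d3 * d3.
  rewrite lt_neqAle !addr_ge0 -?expr2 ?sqr_ge0// andbT eq_sym.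
  apply: contraNN d_neq0; rewrite !paddr_eq0 ?addr_ge0 ?sqr_ge0// !sqrf_eq0.
  by move=> /andP[/andP[/eqP-> /eqP->] /eqP->].
have ct : cos theta = z.
  exact: (horizontal_angle_cos n1 n2 p q z d1 d2 d3).
have i1 : - (pi / 2) < phi1 < pi / 2 by rewrite p1 (lt_trans p2).
have i2 : - (pi / 2) < phi2 < pi / 2 by rewrite p2 (lt_trans p21).
have c1 := cos_gt0_pihalf i1; have c2 := cos_gt0_pihalf i2.
have T21 : tan phi2 < tan phi1 by rewrite ltr_tan ?in_itv.
(* The horizontal part of [f2] is [z * e] times [(- n2, n1)]. Hence the plane with normal
   [cos phi *: f2 - sin phi *: f1] is a graph whose gradient is given by [ridge_gx] and [ridge_gy]
   at [tan phi], with [kappa = z^-1]. *)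
pose e := (q * n1 - p * n2) / z; have zn0 : z != 0 by rewrite gt_eqF.
have pE : p = - z * (e * n2).
  have -> : - z * (e * n2) = p * (n1 ^+ 2 + n2 ^+ 2) - n1 * (n1 * p + n2 * q) by rewrite /e; field.
  by rewrite nn np mulr0 mulr1 subr0.
have qE : q = z * (e * n1).
  have -> : z * (e * n1) = q * (n1 ^+ 2 + n2 ^+ 2) - n2 * (n1 * p + n2 * q) by rewrite /e; field.
  by rewrite nn np mulr0 mulr1 subr0.
have kE : z^-1 ^+ 2 = 1 + e ^+ 2.
  have : z ^+ 2 * (1 + e ^+ 2) = 1.
    have pq : p ^+ 2 + q ^+ 2 = z ^+ 2 * e ^+ 2 * (n1 ^+ 2 + n2 ^+ 2) by rewrite pE qE; ring.
    by move: ff; rewrite pq nn mulr1 => h; rewrite -[RHS]h; ring.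
  by move=> h; rewrite -[LHS]mulr1 -[X in _ * X = _]h; field.
pose gx := ridge_gx n1 n2 e z^-1; pose gy := ridge_gy n1 n2 e z^-1.
have [[uc uM] umin] := u_min.
have uge y : Om y -> 0 <= u y by move=> /uM/andP[].
have normalE phi : 0 < cos phi -> forall v1 v2 w : R,
    (cos phi * p - sin phi * n1) * v1 + (cos phi * q - sin phi * n2) * v2 + (cos phi * z) * w =
    cos phi * z * (w - (gx (tan phi) * v1 + gy (tan phi) * v2)).
  move=> c0 v1 v2 w; have -> : sin phi = tan phi * cos phi by rewrite /tan divfK ?gt_eqF.
  by rewrite {1}pE {1}qE /gx /gy /ridge_gx /ridge_gy; field.
have halfE phi (e0 : R^o * R^o * R^o) : 0 < cos phi ->
    e0 = cos phi *: ((p, q), z) - sin phi *: ((n1, n2), 0) -> forall v1 v2 w : R,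
    e0.1.1 * v1 + e0.1.2 * v2 + e0.2 * w <= 0 <-> w <= gx (tan phi) * v1 + gy (tan phi) * v2.
  move=> c0 -> v1 v2 w; rewrite /= /GRing.scale /= mulr0 subr0 normalE// pmulr_rle0 ?mulr_gt0//.
  by rewrite subr_le0.
have faces T : T = tan phi1 \/ T = tan phi2 -> forall s r, Om (s, r) ->
    u (s, r) <= u (a, b) + gx T * (s - a) + gy T * (r - b).
  move=> hT s r Osr; rewrite -addrA -lerBlDl.
  case: hT => ->.
    apply/(halfE _ _ c1 e1E); apply: (tangent_cone_upper Om u a b e1 s r _ Osr (uge _ Osr)).
    by rewrite cone => ? [].
  apply/(halfE _ _ c2 e2E); apply: (tangent_cone_upper Om u a b e2 s r _ Osr (uge _ Osr)).
  by rewrite cone => ? [].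
have low v1 v2 w d : w <= gx (tan phi1) * v1 + gy (tan phi1) * v2 ->
    w <= gx (tan phi2) * v1 + gy (tan phi2) * v2 -> 0 < d ->
    exists p1 p2 t, [/\ Om (p1, p2), 0 <= t, `|v1 - t * (p1 - a)| < d, `|v2 - t * (p2 - b)| < d
      & w - d < t * (u (p1, p2) - u (a, b))].
  have K (m n : R) : m + n - m = n by ring.
  move=> h1 h2; apply: tangent_cone_lower; rewrite cone; split; rewrite /halfspace /dot /= !K.
    by apply/(halfE _ _ c1 e1E).
  by apply/(halfE _ _ c2 e2E).
have mOm := compact_measurable_plane _ Om_compact.
have bOm := compact_bounded_set2 _ Om_compact.
have cOm := convex_set_cvx2 _ Om_convex.
have cu := convex_function_ccv2 _ _ uc.
have Cab := interior_core _ _ _ x_int.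
have z1 : 0 < z^-1 by rewrite invr_gt0.
have [A1 A2 B1 B2] := ridge_faces Om u M cOm cu (fun x y => uM (x, y)) mOm bOm
  (fun v cv vM => umin v (conj (ccv2_convex_function _ _ cv)
    (fun y => let: (y1, y2) := y in vM y1 y2)))
  a b n1 n2 e z^-1 (tan phi1) (tan phi2) Cab nn z1 kE T21 faces low.
apply: ridge_angle_cases => //.
- by apply: double_angle_le => //; move: A1; rewrite -!mulrA.
(* A reflection exchanges the two angles and changes their signs, so the second inequality is an
   instance of the first. *)
- have : 2 * (- phi2) + (- phi1) <= pi / 2.
    apply: double_angle_le; rewrite ?tanN ?sqrrN.
    + by rewrite ltrN2 ltrNl; move: i2 => /andP[-> ->].
    + by rewrite ltrN2 ltrNl; move: i1 => /andP[-> ->].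
    by rewrite (_ : 2 * - tan phi2 * - tan phi1 = 2 * tan phi1 * tan phi2)//; ring.
  by clear; lra.
move=> phi hphi; rewrite ct.
have cphi : 0 < cos phi by case: hphi => ->.
have z_le1 : z <= 1 by rewrite -ct cos_le1.
apply: gradient_gap => //.
- rewrite -(ridge_gradient_sqr n1 n2 e z phi nn z0 kE); first by case: hphi => ->.
  by rewrite gt_eqF.
by rewrite -[leRHS]mulr1 ler_pM ?(ltW z0) ?(ltW cphi) ?cos_le1.
Qed.
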